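(* Let $\mu=\chi_\Omega w\,\mathrm{dA}+\nu$ be a positive measure on $\mathbb{C}$, where $\Omega\subset\mathbb{C}$ is a bounded simply connected domain with piecewise smooth boundary, $w$ is a positive continuous weight on $\Omega$, and $\nu$ is a finite atomic measure (finitely many atoms), all power moments $\int_{\mathbb{C}}z^k\overline z^{\,\ell}\,d\mu(z)$, $k,\ell\ge0$, being finite. Assume that $L^2_a(\Omega,w\,\mathrm{dA})=P^2(\chi_\Omega w\,\mathrm{dA})$. Let $S=S_\mu$ (represented by the Hessenberg matrix of $\mu$). Let $\tilde S$ be a bounded operator on $P^2(\mu)$ such that either (a) $\tilde S-S$ is trace class; or (b) $\tilde S-S$ is Hilbert–Schmidt and $\operatorname{Tr}\big|[\tilde S^*,\tilde S]\big|<\infty$. Then $$\operatorname{Tr}[(S^* )^{k+1},S^{\ell+1}]=\operatorname{Tr}[(\tilde S^* )^{k+1},\tilde S^{\ell+1}],\qquad k,\ell\ge0.$$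
   Context: $\mathrm{dA}$ is two-dimensional Lebesgue measure on $\mathbb{C}$, $\chi_\Omega$ is the characteristic function of $\Omega$, and $[A,B]=AB-BA$. For a compactly supported finite positive Borel measure $\tau$ on $\mathbb{C}$, $P^2(\tau)$ is the closure of the complex polynomials $\mathbb{C}[z]$ in $L^2(\tau)$, and $S_\tau$ is the operator of multiplication by $z$ on $P^2(\tau)$. $L^2_a(\Omega,w\,\mathrm{dA})$ is the weighted Bergman space of analytic functions in $\Omega$ which are square integrable with respect to $w\,\mathrm{dA}$. The Hessenberg matrix of $\mu$ is the matrix $(h_{nk})_{n,k\ge0}$ of $S_\mu$ in the orthonormal basis $(p_k)_{k\ge0}$ of $P^2(\mu)$ formed by the orthonormal polynomials of $\mu$ ($p_k$ of degree $k$ with positive leading coefficient), i.e. $zp_k=\sum_{n=0}^{k+1}h_{nk}p_n$. *)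

(* Defs.v *)
From HB Require Import structures.
From mathcomp Require Export all_boot all_order all_algebra.
From mathcomp Require Export all_classical all_reals all_analysis.
From mathcomp Require Export measurable_realfun complex.
From mathcomp Require Import ring lra.

Set Implicit Arguments.
Unset Strict Implicit.
Unset Printing Implicit Defensive.

Import Order.TTheory GRing.Theory Num.Theory.
Export numFieldNormedType.Exports.

Local Open Scope classical_set_scope.
Local Open Scope ring_scope.
Local Open Scope quotient_scope.

(* Measures on the complex plane are measures on R * R, whose product
   sigma-algebra is the Borel one; [zpt] is the identification with R[i].
   The topology of the complex numbers is that of R[i]^o. *)
Notation plane R := (measurableTypeR R * measurableTypeR R)%type.

Definition zpt (R : realType) (p : plane R) : R[i]^o := (p.1 +i* p.2)%C.

Definition area (R : realType) : {measure set (plane R) -> \bar R} :=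
  (lebesgue_measure \x lebesgue_measure)%E.

Section complex_integration.
Context {R : realType} (mu : {measure set (plane R) -> \bar R}).
Implicit Types f g : plane R -> R[i]^o.

Definition cmeasurable f :=
  measurable_fun setT (fun p => complex.Re (f p)) /\
  measurable_fun setT (fun p => complex.Im (f p)).

Definition cintegrable f :=
  mu.-integrable setT (fun p => (complex.Re (f p))%:E) /\
  mu.-integrable setT (fun p => (complex.Im (f p))%:E).

Definition cintegral f : R[i] :=
  ((\int[mu]_p complex.Re (f p))%R +i* (\int[mu]_p complex.Im (f p))%R)%C.

Definition sqdist f g : \bar R :=
  (\int[mu]_p (ComplexField.Normc.normc (f p - g p) ^+ 2)%:E)%E.

Definition square_integrable f := cmeasurable f /\ (sqdist f 0%R < +oo)%E.

(* The functions in the closure of the polynomials in L^2(mu), before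
   identification of functions that agree almost everywhere. *)
Definition P2fun : set (plane R -> R[i]^o) :=
  [set f | square_integrable f /\
    forall eps : R, 0 < eps -> exists q : {poly R[i]},
      (sqdist f (fun p => q.[zpt p]) < (eps ^+ 2)%:E)%E].

Definition P2pred : {pred plane R -> R[i]^o} := [pred f | f \in P2fun].

Import ComplexField.Normc.

Let sqn (z : R[i]) : R := normc z ^+ 2.

Let sqnE z : sqn z = complex.Re z ^+ 2 + complex.Im z ^+ 2.
Proof. by case: z => a b; rewrite /sqn /= sqr_sqrtr// addr_ge0// sqr_ge0. Qed.

Let sqnM a z : sqn (a * z) = sqn a * sqn z.
Proof. by rewrite !sqnE; case: a z => a b [c d] /=; ring. Qed.

Let sqnD u v : sqn (u + v) <= 2 * sqn u + 2 * sqn v.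
Proof.
rewrite !sqnE; case: u v => a b [c d] /=.
have := sqr_ge0 (a - c); have := sqr_ge0 (b - d); nra.
Qed.

Let sqn_ge0 z : 0 <= sqn z. Proof. exact: sqr_ge0. Qed.

Fact cmeasurable_sqn f : cmeasurable f ->
  measurable_fun setT (fun p => sqn (f p)).
Proof.
move=> [mr mi]; under eq_fun do rewrite sqnE.
by apply: measurable_funD; apply: measurable_funX.
Qed.

Fact cmeasurable_cst c : cmeasurable (fun=> c).
Proof. by split; exact: measurable_cst. Qed.

Fact cmeasurableD f g :
  cmeasurable f -> cmeasurable g -> cmeasurable (f \+ g).
Proof.
move=> [fr fi] [gr gi]; split.
- rewrite (_ : (fun p => _) = (fun p => complex.Re (f p)) \+ (fun p => complex.Re (g p))).
    exact: measurable_funD.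
  by apply/funext => p /=; case: (f p) (g p) => [? ?] [].
- rewrite (_ : (fun p => _) = (fun p => complex.Im (f p)) \+ (fun p => complex.Im (g p))).
    exact: measurable_funD.
  by apply/funext => p /=; case: (f p) (g p) => [? ?] [].
Qed.

Fact cmeasurableM f g :
  cmeasurable f -> cmeasurable g -> cmeasurable (f \* g).
Proof.
move=> [fr fi] [gr gi]; split.
- rewrite (_ : (fun p => _) = ((fun p => complex.Re (f p)) \* (fun p => complex.Re (g p)))
       \- ((fun p => complex.Im (f p)) \* (fun p => complex.Im (g p)))).
    by apply: measurable_funB; exact: measurable_funM.
  by apply/funext => p /=; case: (f p) (g p) => [? ?] [].
- rewrite (_ : (fun p => _) = ((fun p => complex.Re (f p)) \* (fun p => complex.Im (g p)))
       \+ ((fun p => complex.Im (f p)) \* (fun p => complex.Re (g p)))).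
    by apply: measurable_funD; exact: measurable_funM.
  by apply/funext => p /=; case: (f p) (g p) => [? ?] [].
Qed.

Fact cmeasurable_poly (q : {poly R[i]}) : cmeasurable (fun p => q.[zpt p]).
Proof.
elim/poly_ind: q => [|q c ih].
  by under [X in cmeasurable X]eq_fun do rewrite horner0; exact: cmeasurable_cst.
under [X in cmeasurable X]eq_fun do rewrite hornerMXaddC.
apply: cmeasurableD; last exact: cmeasurable_cst.
apply: cmeasurableM => //; split.
- exact: measurable_fst.
- exact: measurable_snd.
Qed.

Fact sqdist_lin_le a f g u v :
  cmeasurable f -> cmeasurable g -> cmeasurable u -> cmeasurable v ->
  (sqdist (a *: f + g)%R (a *: u + v)%R
   <= (2 * sqn a)%:E * sqdist f u + 2%:E * sqdist g v)%E.
Proof.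
move=> mf mg mu' mv.
have mB (h k : plane R -> R[i]^o) : cmeasurable h -> cmeasurable k ->
    measurable_fun setT (fun p => sqn (h p - k p)).
  move=> mh mk; apply: (cmeasurable_sqn (f := fun p => h p - k p)).
  rewrite (_ : (fun p => _) = h \+ ((fun=> -1) \* k)); last first.
    by apply/funext => p /=; rewrite mulN1r.
  by apply: cmeasurableD => //; apply: cmeasurableM => //; exact: cmeasurable_cst.
have mS (h k : plane R -> R[i]^o) : cmeasurable h -> cmeasurable k ->
    cmeasurable (a *: h + k).
  move=> mh mk; apply: cmeasurableD => //.
  by apply: (cmeasurableM (f := fun=> a)) => //; exact: cmeasurable_cst.
have nn (c : R) (h k : plane R -> R[i]^o) p : 0 <= c ->
    (0 <= c%:E * (sqn (h p - k p))%:E)%E.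
  by move=> c0; rewrite -EFinM lee_fin mulr_ge0// sqn_ge0.
have mE (c : R) (h k : plane R -> R[i]^o) : cmeasurable h -> cmeasurable k ->
    measurable_fun setT (fun p => (c%:E * (sqn (h p - k p))%:E)%E).
  move=> mh mk; apply/measurable_EFinP.
  by apply: measurable_funM; [exact: measurable_cst|exact: mB].
have Zl (c : R) (h k : plane R -> R[i]^o) : 0 <= c -> cmeasurable h ->
    cmeasurable k -> (c%:E * sqdist h k =
      \int[mu]_p (c%:E * (sqn (h p - k p))%:E))%E.
  move=> c0 mh mk; rewrite ge0_integralZl ?lee_fin//.
    by apply/measurable_EFinP; exact: mB.
  by move=> p _; rewrite lee_fin sqn_ge0.
have a0 : 0 <= 2 * sqn a by apply: mulr_ge0 => //; exact: sqn_ge0.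
rewrite (Zl _ f u)// (Zl _ g v)// -ge0_integralD//; do ?[by apply: mE|
  by move=> p _; exact: nn].
apply: ge0_le_integral => //.
- by move=> p _; rewrite lee_fin sqn_ge0.
- by apply/measurable_EFinP; apply: mB; exact: mS.
- by apply: emeasurable_funD; exact: mE.
- move=> p _; rewrite -!EFinM -EFinD lee_fin.
  have -> : (a *: f + g)%R p - (a *: u + v)%R p = a * (f p - u p) + (g p - v p).
    by rewrite mulrBr opprD addrACA.
  by apply: le_trans (sqnD _ _) _; rewrite sqnM mulrA.
Qed.

Fact P2pred_submod : submod_closed P2pred.
Proof.
have d00 : sqdist 0 0 = 0%E.
  rewrite /sqdist; apply: integral0_eq => p _.
  by rewrite subrr -/(sqn _) sqnE /= expr0n addr0.
have m0 : cmeasurable 0 by exact: cmeasurable_cst.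
have polyE (q : {poly R[i]}) : cmeasurable (fun p => q.[zpt p]).
  exact: cmeasurable_poly.
split.
  rewrite inE; split; first by split=> //; rewrite d00.
  move=> e e0; exists 0; rewrite (_ : (fun p => _) = 0).
    by rewrite d00 lte_fin exprn_gt0.
  by apply/funext => p; rewrite horner0.
move=> a f g; rewrite !inE => -[[mf lf] cf] [[mg lg] cg].
split.
  split.
    apply: cmeasurableD => //.
    by apply: (cmeasurableM (f := fun=> a)) => //; exact: cmeasurable_cst.
  have := sqdist_lin_le a mf mg m0 m0; rewrite scaler0 addr0.
  move/le_lt_trans; apply; apply: lte_add_pinfty.
    by rewrite lte_mul_pinfty// lee_fin; apply: mulr_ge0 => //; exact: sqn_ge0.
  by rewrite lte_mul_pinfty// lee_fin.
move=> e e0.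
pose A := 2 * sqn a + 2.
have A0 : 0 < A by apply: ltr_wpDl => //; apply: mulr_ge0 => //; exact: sqn_ge0.
pose d := e / (A + 1).
have d0 : 0 < d by rewrite divr_gt0// addr_gt0.
have [q hq] := cf d d0; have [r hr] := cg d d0.
exists (a *: q + r).
rewrite (_ : (fun p => _) = a *: ((fun p => q.[zpt p]) : plane R -> R[i]^o) +
   ((fun p => r.[zpt p]) : plane R -> R[i]^o)); last first.
  by apply/funext => p; rewrite hornerD hornerZ.
apply: (le_lt_trans (sqdist_lin_le a mf mg (polyE q) (polyE r))).
apply: (@le_lt_trans _ _
    ((2 * sqn a)%:E * (d ^+ 2)%:E + 2%:E * (d ^+ 2)%:E)%E).
  have a2 : 0 <= 2 * sqn a by apply: mulr_ge0 => //; exact: sqn_ge0.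
  by apply: leeD; apply: lee_wpmul2l; rewrite ?lee_fin// ltW.
have dE : d * (A + 1) = e by rewrite /d divfK// gt_eqF// addr_gt0.
rewrite -!EFinM -EFinD lte_fin -mulrDl -/A -dE.
clearbody d A.
rewrite exprMn [ltLHS]mulrC ltr_pM2l ?exprn_gt0//.
nra.
Qed.

HB.instance Definition _ := GRing.isSubmodClosed.Build _ _ P2pred P2pred_submod.

Record P2rep := MkP2rep { P2rep_fun :> plane R -> R[i]^o;
                          _ : P2rep_fun \in P2pred }.

HB.instance Definition _ := [isSub for P2rep_fun].
HB.instance Definition _ := [Choice of P2rep by <:].
HB.instance Definition _ := [SubChoice_isSubLmodule of P2rep by <:].

Definition P2null : {pred P2rep} :=
  [pred u : P2rep | `[< {ae mu, forall p, P2rep_fun u p = 0} >]].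

Fact P2null_zmod : zmod_closed P2null.
Proof.
split; first by apply/asboolP; apply: nearW.
move=> u v /asboolP u0 /asboolP v0; apply/asboolP.
apply: filterS2 u0 v0 => p up vp.
by have -> : P2rep_fun (u - v) p = u p - v p by []; rewrite up vp subrr.
Qed.

Fact P2null_scale a u : u \in P2null -> a *: u \in P2null.
Proof.
move=> /asboolP u0; apply/asboolP.
apply: filterS u0 => p up.
by have -> : P2rep_fun (a *: u) p = a *: u p by []; rewrite up scaler0.
Qed.

HB.instance Definition _ := GRing.isZmodClosed.Build _ P2null P2null_zmod.

Definition P2 : Type := {ideal_quot P2null}.

HB.instance Definition _ := GRing.Zmodule.on P2.
HB.instance Definition _ : EqQuotient P2rep (Quotient.equiv P2null) P2 :=
  EqQuotient.on P2.

Definition P2scale (a : R[i]) (x : P2) : P2 := \pi_P2 (a *: (repr x : P2rep)).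

Fact P2_piD (x y : P2rep) : \pi_P2 (x + y) = \pi_P2 x + \pi_P2 y :> P2.
Proof. exact: (@Quotient.pi_add _ P2null). Qed.

Fact P2_piZ (a : R[i]) (x : P2rep) : \pi_P2 (a *: x) = P2scale a (\pi_P2 x).
Proof.
apply/eqP; rewrite -Quotient.idealrBE -scalerBr P2null_scale//.
by rewrite Quotient.idealrBE reprK.
Qed.

Fact P2scaleA a b (x : P2) : P2scale a (P2scale b x) = P2scale (a * b) x.
Proof. by elim/quotW: x => x; rewrite -(P2_piZ b x) -!P2_piZ scalerA. Qed.

Fact P2scale1 : left_id 1 P2scale.
Proof. by elim/quotW => x; rewrite -P2_piZ scale1r. Qed.

Fact P2scaleDr : right_distributive P2scale +%R.
Proof.
move=> a; elim/quotW => x; elim/quotW => y.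
by rewrite -P2_piD -!P2_piZ scalerDr P2_piD.
Qed.

Fact P2scaleDl (x : P2) : {morph P2scale^~ x : a b / a + b}.
Proof. by move=> a b; elim/quotW: x => x; rewrite -!P2_piZ scalerDl P2_piD. Qed.

HB.instance Definition _ := GRing.Zmodule_isLmodule.Build R[i] P2
  P2scaleA P2scale1 P2scaleDr P2scaleDl.

Definition P2fn (x : P2) : plane R -> R[i]^o := (repr x : P2rep).

Definition P2ip (x y : P2) : R[i] :=
  cintegral (fun p => P2fn x p * (P2fn y p)^*%C).

(* S_mu; multiplication by z maps P^2(mu) into itself when mu has compact
   support, and then the element y below exists and is unique. *)
Definition mulz (x : P2) : P2 :=
  xget 0 [set y | {ae mu, forall p, P2fn y p = zpt p * P2fn x p}].

End complex_integration.

(* Operators on a separable infinite-dimensional complex Hilbert space, given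
   by a module V and an inner product ip, linear in its first argument. *)
Section operators.
Context {R : realType} {V : lmodType R[i]} (ip : V -> V -> R[i]).
Implicit Types (A B T : V -> V) (x y : V) (e : nat -> V).

Definition hnorm x : R := Num.sqrt (complex.Re (ip x x)).

Definition bounded_op T :=
  linear T /\ exists M : R, forall x, hnorm (T x) <= M * hnorm x.

Definition orthonormal_basis e :=
  (forall m n, ip (e m) (e n) = (m == n)%:R) /\
  (forall x, (forall n, ip x (e n) = 0) -> x = 0).

Definition adjoint T : V -> V :=
  xget (fun=> 0) [set A | forall x y, ip (T x) y = ip x (A y)].

(* The order of R[i] is partial: 0 <= z means that z is real and nonnegative. *)
Definition positive_op A := bounded_op A /\ forall x, 0 <= ip (A x) x.

(* |T| is the positive square root of T^* T. *)
Definition opabs T : V -> V :=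
  xget (fun=> 0) [set A | positive_op A /\ A \o A = adjoint T \o T].

Definition comm A B : V -> V := (A \o B) \- (B \o A).

(* Tr A < +oo for a positive operator A *)
Definition finite_trace A := forall e, orthonormal_basis e ->
  (\sum_(0 <= n <oo) (complex.Re (ip (A (e n)) (e n)))%:E < +oo)%E.

Definition trace_class T := bounded_op T /\ finite_trace (opabs T).

Definition hilbert_schmidt T := bounded_op T /\
  forall e, orthonormal_basis e ->
  (\sum_(0 <= n <oo) (hnorm (T (e n)) ^+ 2)%:E < +oo)%E.

(* The trace does not depend on the orthonormal basis if T is trace class. *)
Definition Tr T : R[i]^o :=
  xget 0 [set t : R[i]^o | forall e, orthonormal_basis e ->
    series (fun n => ip (T (e n)) (e n) : R[i]^o) @ \oo --> t].

End operators.

Section plane_domains.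
Context {R : realType}.
Implicit Types (D : set R[i]^o) (g : R -> R[i]^o).
Local Notation I := (`[0, 1]%classic : set R).

Definition domain D := [/\ D !=set0, open D & connected D].

Definition loop_in D g :=
  [/\ {within I, continuous g}, g 0 = g 1 &
      forall t, I t -> D (g t)].

Definition null_homotopic_in D g := exists H : R * R -> R[i]^o,
  [/\ {within I `*` I, continuous H},
      (forall t, I t -> H (0, t) = g t /\ H (1, t) = g 0),
      (forall s, I s -> H (s, 0) = g 0 /\ H (s, 1) = g 0) &
      forall s t, I s -> I t -> D (H (s, t))].

Definition simply_connected D :=
  connected D /\ forall g, loop_in D g -> null_homotopic_in D g.

Definition C1 (x : R -> R) :=
  (forall t, derivable x t 1) /\ continuous (derive1 x).

(* A simple regular C^1 arc. Asking the parametrization to be C^1 on the whole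
   line loses nothing, as a C^1 function on [0, 1] extends to one. *)
Definition smooth_arc (A : set R[i]^o) := exists x y : R -> R,
  [/\ C1 x, C1 y,
      (forall t, I t -> (derive1 x t, derive1 y t) != (0, 0)),
      {in I &, injective (fun t => (x t, y t))} &
      A = (fun t => (x t +i* y t)%C : R[i]^o) @` I].

Definition boundary D := closure D `\` interior D.

Definition piecewise_smooth_boundary D :=
  exists (n : nat) (arc : 'I_n -> set R[i]^o),
    (forall i, smooth_arc (arc i)) /\ boundary D = \bigcup_i arc i.

Definition analytic_on D (F : R[i]^o -> R[i]^o) :=
  forall z, D z -> derivable F z (1 : R[i]^o).

Implicit Type mu : {measure set (plane R) -> \bar R}.

Definition weighted_area D (w : R[i]^o -> R) mu := forall A, measurable A ->
  mu A = (\int[area R]_(p in A `&` @zpt R @^-1` D) (w (zpt p))%:E)%E.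

Definition finitely_atomic mu :=
  exists (n : nat) (a : 'I_n -> plane R) (c : 'I_n -> R),
    (forall j, 0 < c j) /\
    forall A, measurable A -> mu A = (\sum_(j < n) (c j)%:E * \d_(a j) A)%E.

Definition finite_moments mu := forall k l : nat,
  cintegrable mu (fun p => zpt p ^+ k * (zpt p)^*%C ^+ l).

(* The weighted Bergman space L^2_a(D, w dA), where mu = chi_D w dA; like P2fun,
   before identification of functions that agree almost everywhere. The values
   of F outside D are irrelevant, as mu does not charge the complement of D. *)
Definition bergman D mu : set (plane R -> R[i]^o) :=
  [set f | square_integrable mu f /\
    exists F, analytic_on D F /\ {ae mu, forall p, f p = F (zpt p)}].

End plane_domains.

(* Main.v *)
From HB Require Import structures.
Require Import Defs.
From mathcomp Require Import ring lra.

Set Implicit Arguments.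
Unset Strict Implicit.
Unset Printing Implicit Defensive.

Import Order.TTheory GRing.Theory Num.Theory.

Local Open Scope classical_set_scope.
Local Open Scope ring_scope.

(** The operator [S] of multiplication by [z] is a bounded hyponormal operator
    on [P^2(mu)], [|S^* x| <= |S x|], with the constant function [1] as a cyclic
    vector; these two facts imply the theorem for every such operator on a
    Hilbert space.

    Let [P_n] be the orthogonal projection onto the span of [1, z, ..., z^(n-1)].
    In an orthonormal basis adapted to these spaces [S] has a Hessenberg matrix,
    so the corner [(1 - P_n) S P_n] has a single nonzero entry, and by
    hyponormality the corner [(1 - P_n) S^* P_n] is no larger in Hilbert-Schmidt
    norm. The first [n] terms of the trace of the positive operator [[S^*, S]]
    add up to the difference of the squared norms of these two corners. Hence
    they are bounded by [|S|^2], and [[S^*, S]] is of trace class (an elementary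
    case of the theorem of Berger and Shaw, lemma [berger_shaw]). The commutators
    of powers are then of trace class too, by the Leibniz rule.

    Let [T] be the perturbed operator. In case (a), [T - S] is Hilbert-Schmidt
    and [[T^*, T]] is of trace class, so that (a) is a special case of (b). In
    case (b) write [T^*^(k+1) = B + K2] and [T^(l+1) = B' + K1], where [B] and
    [B'] are the powers of [S^*] and [S] and where [K1], [K2] are
    Hilbert-Schmidt. The difference of the two commutators is
    [[B, K1] + [K2, B'] + [K2, K1]]. It is of trace class, and so is the last
    term, whose trace vanishes. The trace of the rest is the limit of its
    truncations by [P_n]. The truncated trace of [[B, K]] pairs the corners of
    [B] and [B^*], which are bounded in Hilbert-Schmidt norm, with those of [K]
    and [K^*], which tend to zero because [K] is Hilbert-Schmidt (lemma
    [trace_comm_hs0]). So the limit is zero.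

    The operator theory is developed in a real Hilbert space, with the real part
    of the inner product; real and imaginary part of a complex trace are the real
    traces of the operator and of its product with [-i]. The notions built on
    the absolute value [|T|] are related to products of Hilbert-Schmidt operators
    through square roots ([psd_sqrt]) and factorization ([douglas]). Adjoints
    exist because [P^2(mu)] is complete ([riesz_fischer], [P2_complete]). *)

(** * Linear maps and real sequences *)

Section linear_maps.
Context {R : nzRingType} {V : lmodType R}.

Lemma linB (T : V -> V) : linear T -> {morph T : x y / x - y}.
Proof. by move=> lT x y; rewrite addrC -scaleN1r lT scaleN1r addrC. Qed.
Lemma lin0 (T : V -> V) : linear T -> T 0 = 0.
Proof. by move=> lT; rewrite -{1}(subrr 0) linB// subrr. Qed.
Lemma linD (T : V -> V) : linear T -> {morph T : x y / x + y}.
Proof. by move=> lT x y; rewrite -{1}(scale1r x) lT scale1r. Qed.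
Lemma linZ (T : V -> V) : linear T -> forall a, {morph T : x / a *: x}.
Proof. by move=> lT a x; rewrite -{1}(addr0 (a *: x)) lT lin0// addr0. Qed.

Lemma lin_sum (T : V -> V) n (F : nat -> V) : linear T ->
  T (\sum_(0 <= k < n) F k) = \sum_(0 <= k < n) T (F k).
Proof.
move=> lT; elim: n => [|n ih]; first by rewrite !big_geq// (lin0 lT).
by rewrite !big_nat_recr//= (linD lT) ih.
Qed.
End linear_maps.

Section sequences.
Context {R : realType}.

Lemma cvg0_le (u v : nat -> R) : (forall n, `|u n| <= v n) ->
  v @ \oo --> (0 : R) -> u @ \oo --> (0 : R).
Proof.
move=> uv v0; apply/cvgrPdist_le => e e0.
move/cvgrPdist_le: v0 => /(_ e e0); apply: filterS => n.
by rewrite !sub0r !normrN => ve; apply: le_trans (uv n) (le_trans (ler_norm _) ve).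
Qed.

Lemma cvg0_sqr (u : nat -> R) :
  (fun n => u n ^+ 2) @ \oo --> (0 : R) -> u @ \oo --> (0 : R).
Proof.
move=> u0; apply/cvgrPdist_le => e e0.
move/cvgrPdist_le: u0 => /(_ (e ^+ 2)); rewrite exprn_gt0// => /(_ isT).
apply: filterS => n; rewrite !sub0r !normrN normrX => h.
by rewrite -(@ler_pXn2r _ 2)// nnegrE// ltW.
Qed.

Lemma cvg0Ml (c : R) (u : nat -> R) :
  u @ \oo --> (0 : R) -> (fun n => c * u n) @ \oo --> (0 : R).
Proof. by move=> u0; rewrite -[X in _ --> X](mulr0 c); apply: cvgM => //; exact: cvg_cst. Qed.

Lemma cvg0D (u v : nat -> R) : u @ \oo --> (0 : R) -> v @ \oo --> (0 : R) ->
  (fun n => u n + v n) @ \oo --> (0 : R).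
Proof. by move=> u0 v0; rewrite -[X in _ --> X](addr0 0); exact: cvgD. Qed.

Lemma cvg_le_ub (u : nat -> R) (l M : R) : u @ \oo --> l ->
  (forall n, u n <= M) -> l <= M.
Proof.
move=> ul uM; rewrite -(cvg_lim _ ul)//.
by apply: limr_le; [apply/cvg_ex; exists l|apply: nearW].
Qed.

Lemma cvg_ge_lb (u : nat -> R) (l M : R) : u @ \oo --> l ->
  (forall n, M <= u n) -> M <= l.
Proof.
move=> ul uM; rewrite -(cvg_lim _ ul)//.
by apply: limr_ge; [apply/cvg_ex; exists l|apply: nearW].
Qed.

Lemma nondecreasing_le_cvg (u : nat -> R) (l : R) : (forall n, u n <= u n.+1) ->
  u @ \oo --> l -> forall n, u n <= l.
Proof.
move=> /nondecreasing_seqP nu ul n; rewrite -(cvg_lim _ ul)//.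
by apply: nondecreasing_cvgn_le => //; apply/cvg_ex; exists l.
Qed.

Lemma nondecreasing_bounded_cvg (u : nat -> R) (M : R) :
  (forall n, u n <= u n.+1) -> (forall n, u n <= M) ->
  exists2 l, u @ \oo --> l & l <= M.
Proof.
move=> nu uM; have /cvg_ex[l ul] : cvgn u.
  apply: nondecreasing_is_cvgn; first exact/nondecreasing_seqP.
  by exists M => _ [n _ <-].
by exists l => //; exact: cvg_le_ub ul uM.
Qed.

Lemma cvg_uniq (u : nat -> R) (l l' : R) : u @ \oo --> l -> u @ \oo --> l' -> l = l'.
Proof. by move=> h h'; rewrite -(cvg_lim _ h)// (cvg_lim _ h'). Qed.

Lemma harmonic0 (c : R) : (fun n => c * n.+1%:R^-1) @ \oo --> (0 : R).
Proof. by apply: cvg0Ml; exact: cvg_harmonic. Qed.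

(** The first variation vanishes at a minimum. *)
Lemma quadratic_ge0_linear_eq0 (a b : R) : (forall t, 0 <= 2 * t * a + t ^+ 2 * b) -> a = 0.
Proof.
move=> h.
have b0 : 0 <= b by have := h 1; have := h (-1); lra.
have := h (- a / (b + 1)).
have b1 : 0 < b + 1 by lra.
have -> : 2 * (- a / (b + 1)) * a + (- a / (b + 1)) ^+ 2 * b =
   - (a ^+ 2 * (b + 2)) / (b + 1) ^+ 2 by field; rewrite gt_eqF.
rewrite mulNr oppr_ge0 => h1.
have : a ^+ 2 * (b + 2) <= 0.
  by rewrite -(pmulr_lle0 _ (x := ((b + 1) ^+ 2)^-1)) ?invr_gt0 ?exprn_gt0// mulrC.
rewrite pmulr_lle0; last by lra.
by move=> a2; apply/eqP; rewrite -sqrf_eq0 eq_le a2 sqr_ge0.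
Qed.
End sequences.

(** * Real Hilbert spaces *)

Section real_hilbert.
Context {R : realType} {V : lmodType R} (q : V -> V -> R).
Local Notation N x := (q x x).

(** Convergence is expressed by squared norms, which expand by bilinearity. *)
Definition ncvg (u : nat -> V) (l : V) :=
  (fun n => N (u n - l)) @ \oo --> (0 : R).

Definition ncauchy (u : nat -> V) := forall eps, 0 < eps ->
  exists m, forall j k, (m <= j)%N -> (m <= k)%N -> N (u j - u k) <= eps.

Record real_hilbert : Prop := RealHilbert {
  ipDl : forall x y z, q (x + y) z = q x z + q y z ;
  ipZl : forall a x z, q (a *: x) z = a * q x z ;
  ipC : forall x y, q x y = q y x ;
  ip_ge0 : forall x, 0 <= N x ;
  ip_eq0 : forall x, N x = 0 -> x = 0 ;
  ip_complete : forall u, ncauchy u -> exists l, ncvg u l }.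

Hypothesis H : real_hilbert.

Lemma ipDr x y z : q z (x + y) = q z x + q z y.
Proof. by rewrite ipC// ipDl// !(ipC H z). Qed.
Lemma ipZr a x z : q z (a *: x) = a * q z x.
Proof. by rewrite ipC// ipZl// (ipC H z). Qed.
Lemma ipNl x z : q (- x) z = - q x z.
Proof. by rewrite -scaleN1r ipZl// mulN1r. Qed.
Lemma ipNr x z : q z (- x) = - q z x.
Proof. by rewrite ipC// ipNl (ipC H z). Qed.
Lemma ipBl x y z : q (x - y) z = q x z - q y z.
Proof. by rewrite ipDl// ipNl. Qed.
Lemma ipBr x y z : q z (x - y) = q z x - q z y.
Proof. by rewrite ipDr ipNr. Qed.
Lemma ip0l z : q 0 z = 0.
Proof. by rewrite -(scale0r 0) ipZl// mul0r. Qed.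
Lemma ip0r z : q z 0 = 0.
Proof. by rewrite ipC// ip0l. Qed.
Lemma ip_suml n (F : nat -> V) z :
  q (\sum_(0 <= k < n) F k) z = \sum_(0 <= k < n) q (F k) z.
Proof.
elim: n => [|n ih]; first by rewrite !big_geq// ip0l.
by rewrite !big_nat_recr//= ipDl// ih.
Qed.

Definition ipE := (ipDl H, ipBl, ipNl, ipZl H, ipDr, ipBr, ipNr, ipZr).

Lemma ipxx_eq (x y : V) : (forall z, q z x = q z y) -> x = y.
Proof.
move=> xy; apply/eqP; rewrite -subr_eq0; apply/eqP/(ip_eq0 H).
by rewrite ipBr xy subrr.
Qed.

Lemma normD2 x y : N (x + y) = N x + N y + 2 * q x y.
Proof. by rewrite !ipE (ipC H y x); ring. Qed.
Lemma normB2 x y : N (x - y) = N x + N y - 2 * q x y.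
Proof. by rewrite !ipE (ipC H y x); ring. Qed.
Lemma normD2_le x y : N (x + y) <= 2 * N x + 2 * N y.
Proof. by have := ip_ge0 H (x - y); rewrite normB2 normD2; lra. Qed.
Lemma normN2 x : N (- x) = N x.
Proof. by rewrite !ipE opprK. Qed.
Lemma normC2 x y : N (x - y) = N (y - x).
Proof. by rewrite -normN2 opprB. Qed.
Lemma normZ2 a x : N (a *: x) = a ^+ 2 * N x.
Proof. by rewrite !ipE; ring. Qed.

Lemma psd_cauchy_schwarz (a : V -> V -> R) :
  (forall x y z, a (x + y) z = a x z + a y z) ->
  (forall c x z, a (c *: x) z = c * a x z) ->
  (forall x y, a x y = a y x) -> (forall x, 0 <= a x x) ->
  forall x y, a x y ^+ 2 <= a x x * a y y.
Proof.
move=> aD aZ aC a0 x y.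
have ex t : a (x + t *: y) (x + t *: y) = a x x + 2 * t * a x y + t ^+ 2 * a y y.
  by rewrite aD aZ (aC x) (aC y (_ + _)) !aD !aZ (aC y x); ring.
have [y0|yn] := eqVneq (a y y) 0.
  have xx := a0 x.
  have : a x y = 0.
    have [//|xyn] := eqVneq (a x y) 0.
    have := a0 (x + (- (a x x + 1) / (2 * a x y)) *: y); rewrite ex y0 mulr0 addr0.
    rewrite (_ : a x x + _ = -1); last by field.
    by rewrite oppr_ge0 ler10.
  by move=> ->; rewrite y0 expr0n mulr0.
have yp : 0 < a y y by rewrite lt_neqAle eq_sym yn a0.
have := a0 (x + (- a x y / a y y) *: y); rewrite ex.
rewrite (_ : _ + _ = a x x - a x y ^+ 2 / a y y); last by field.
by rewrite subr_ge0 ler_pdivrMr.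
Qed.

Lemma cauchy_schwarz x y : q x y ^+ 2 <= N x * N y.
Proof.
apply: psd_cauchy_schwarz; [exact: ipDl|exact: ipZl|exact: ipC|exact: ip_ge0].
Qed.

(** The weight [d] makes a product small when one factor is small and the other
    one merely bounded. *)
Lemma ip_amgm (d : R) x y : 0 < d -> `|q x y| <= d^-1 * N x + d * N y.
Proof.
move=> d0; have dn : d != 0 by rewrite gt_eqF.
have h1 := ip_ge0 H (d^-1 *: x + y); have h2 := ip_ge0 H (d^-1 *: x - y).
rewrite normD2 normZ2 !ipE in h1; rewrite normB2 normZ2 !ipE in h2.
have e1 : d * (d^-1 ^+ 2 * N x + N y + 2 * (d^-1 * q x y)) =
  d^-1 * N x + d * N y + 2 * q x y by field.
have e2 : d * (d^-1 ^+ 2 * N x + N y - 2 * (d^-1 * q x y)) =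
  d^-1 * N x + d * N y - 2 * q x y by field.
have := mulr_ge0 (ltW d0) h1; have := mulr_ge0 (ltW d0) h2; rewrite e1 e2.
have a0 : 0 <= d^-1 * N x by apply: mulr_ge0; [rewrite invr_ge0 ltW|exact: ip_ge0].
have b0 : 0 <= d * N y by apply: mulr_ge0; [exact: ltW|exact: ip_ge0].
by move=> h3 h4; rewrite ler_norml; apply/andP; split; lra.
Qed.

Definition qnorm x := Num.sqrt (N x).

Lemma qnorm_ge0 x : 0 <= qnorm x. Proof. exact: sqrtr_ge0. Qed.
Lemma qnorm_sqr x : qnorm x ^+ 2 = N x. Proof. by rewrite sqr_sqrtr// ip_ge0. Qed.
Lemma ip_le_qnorm x y : q x y <= qnorm x * qnorm y.
Proof.
apply: le_trans (ler_norm _) _.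
by rewrite -(@ler_pXn2r _ 2) ?nnegrE ?mulr_ge0 ?qnorm_ge0// real_normK ?num_real//
  exprMn !qnorm_sqr cauchy_schwarz.
Qed.
Lemma qnormD x y : qnorm (x + y) <= qnorm x + qnorm y.
Proof.
rewrite -(@ler_pXn2r _ 2) ?nnegrE ?addr_ge0 ?qnorm_ge0//.
rewrite sqrrD !qnorm_sqr normD2; have := ip_le_qnorm x y; lra.
Qed.
Lemma qnormZ a x : qnorm (a *: x) = `|a| * qnorm x.
Proof. by rewrite /qnorm normZ2 sqrtrM ?sqr_ge0// sqrtr_sqr. Qed.
Lemma qnorm_le x c : 0 <= c -> (qnorm x <= c) = (N x <= c ^+ 2).
Proof. by move=> c0; rewrite -qnorm_sqr ler_pXn2r// nnegrE// qnorm_ge0. Qed.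

(** * Convergence in norm *)

Lemma ncvg_uniq u l l' : ncvg u l -> ncvg u l' -> l = l'.
Proof.
move=> ul ul'; apply/eqP; rewrite -subr_eq0; apply/eqP/(ip_eq0 H).
apply: (@cvg_uniq _ (fun=> N (l - l'))); first exact: cvg_cst.
apply: (@cvg0_le _ _ (fun n => 2 * N (u n - l) + 2 * N (u n - l'))).
  move=> n; rewrite ger0_norm ?ip_ge0//.
  rewrite -(subrKA (u n)) (normC2 (u n) l); exact: normD2_le.
by apply: cvg0D; exact: cvg0Ml.
Qed.

Lemma ncvg_cst x : ncvg (fun=> x) x.
Proof.
by rewrite /ncvg (_ : (fun=> _) = fun=> 0); [exact: cvg_cst|apply/funext => n; rewrite subrr ip0l].
Qed.

Lemma ncvgD u v x y : ncvg u x -> ncvg v y -> ncvg (fun n => u n + v n) (x + y).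
Proof.
move=> ux vy; apply: (@cvg0_le _ _ (fun n => 2 * N (u n - x) + 2 * N (v n - y))).
  by move=> n; rewrite ger0_norm ?ip_ge0// opprD addrACA; exact: normD2_le.
by apply: cvg0D; exact: cvg0Ml.
Qed.

Lemma ncvgZ a u x : ncvg u x -> ncvg (fun n => a *: u n) (a *: x).
Proof.
move=> ux; apply: (@cvg0_le _ _ (fun n => a ^+ 2 * N (u n - x))); last exact: cvg0Ml.
by move=> n; rewrite ger0_norm ?ip_ge0// -scalerBr normZ2.
Qed.

Lemma ncvgB u v x y : ncvg u x -> ncvg v y -> ncvg (fun n => u n - v n) (x - y).
Proof.
move=> ux vy; apply: (@cvg0_le _ _ (fun n => 2 * N (u n - x) + 2 * N (v n - y))).
  move=> n; rewrite ger0_norm ?ip_ge0// -(normN2 (v n - y)).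
  rewrite (_ : _ - (x - y) = (u n - x) + - (v n - y)); first exact: normD2_le.
  by rewrite !opprD !opprK addrACA.
by apply: cvg0D; exact: cvg0Ml.
Qed.

Lemma ncvg_bounded (T : V -> V) c u x : {morph T : x y / x - y} ->
  (forall x, N (T x) <= c * N x) -> ncvg u x -> ncvg (T \o u) (T x).
Proof.
move=> TB Tc ux; apply: (@cvg0_le _ _ (fun n => c * N (u n - x))); last exact: cvg0Ml.
by move=> n; rewrite ger0_norm ?ip_ge0//= -TB.
Qed.

Lemma ncvg_ip u x y : ncvg u x -> (fun n => q (u n) y) @ \oo --> q x y.
Proof.
move=> ux; have h : (fun n => q (u n - x) y) @ \oo --> (0 : R).
  apply: cvg0_sqr; apply: (@cvg0_le _ _ (fun n => N y * N (u n - x))).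
    by move=> n; rewrite ger0_norm ?sqr_ge0// mulrC cauchy_schwarz.
  exact: cvg0Ml.
have -> : (fun n => q (u n) y) = (fun n => q (u n - x) y + q x y).
  by apply/funext => n; rewrite !ipE subrK.
by rewrite -[X in _ --> X]add0r; apply: cvgD => //; exact: cvg_cst.
Qed.

Lemma ncvg_norm u x : ncvg u x -> (fun n => N (u n)) @ \oo --> N x.
Proof.
move=> ux; have -> : (fun n => N (u n)) = (fun n => N (u n - x) + (2 * q (u n) x - N x)).
  by apply/funext => n; rewrite normB2; ring.
rewrite -[X in _ --> X]add0r; apply: cvgD => //.
have {2}-> : N x = 2 * N x - N x by ring.
apply: cvgB; last exact: cvg_cst.
by apply: cvgM; [exact: cvg_cst|exact: ncvg_ip].
Qed.

(** * Riesz representation, adjoints and range inclusion *)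

(** The functional [phi] is continuous for the seminorm [x |-> |B x|], so
   [|B x|^2 - 2 phi x] is bounded below; the images under [B] of a minimizing
   sequence are Cauchy by the parallelogram law, and their limit represents
   [phi]. With [B] the identity this is the Riesz representation theorem. *)
Lemma riesz_range (B : V -> V) (phi : V -> R) (M : R) : linear B ->
  (forall a x y, phi (a *: x + y) = a * phi x + phi y) -> 0 <= M ->
  (forall x, phi x <= M * qnorm (B x)) ->
  exists z, [/\ forall x, phi x = q (B x) z,
                exists u, ncvg (B \o u) z & qnorm z <= M].
Proof.
move=> lB lphi M0 phiM.
have phi0 : phi 0 = 0.
  by have := lphi 1 0 0; rewrite scale1r addr0 mul1r; lra.
have phiZ a x : phi (a *: x) = a * phi x.
  by rewrite -{1}(addr0 (a *: x)) lphi phi0 addr0.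
have phiD x y : phi (x + y) = phi x + phi y.
  by rewrite -{1}(scale1r x) lphi mul1r.
pose J x := N (B x) - 2 * phi x.
have Jlb x : - M ^+ 2 <= J x.
  have := phiM x; rewrite /J -qnorm_sqr; have := sqr_ge0 (qnorm (B x) - M); nra.
pose E := [set J x | x in setT].
have hE : has_inf E by split; [exists (J 0), 0|exists (- M ^+ 2) => _ [x _ <-]].
have infJ x : inf E <= J x by apply: ge_inf; [exact: hE.2|exists x].
have /choice[u uP] : forall n : nat, exists x, J x < inf E + n.+1%:R^-1.
  move=> n; have [_ [x _ <-] h] := @inf_adherent _ E n.+1%:R^-1 ltac:(by []) hE.
  by exists x.
have par x y : N (B x - B y) = 2 * J x + 2 * J y - 4 * J (2^-1 *: (x + y)).
  rewrite /J (linZ lB) (linD lB) normB2 normZ2 normD2 phiZ phiD; by field.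
have [z uz] : exists z, ncvg (B \o u) z.
  apply: (ip_complete H) => eps e0.
  have /cvgrPdist_le/(_ eps e0)[m _ hm] := harmonic0 (4 : R).
  exists m => j k mj mk /=; rewrite par.
  have h := infJ (2^-1 *: (u j + u k)).
  have := hm j mj; have := hm k mk; rewrite !sub0r !normrN /=.
  move=> /(le_trans (ler_norm _)) h1 /(le_trans (ler_norm _)) h2.
  have := uP j; have := uP k; move: h1 h2.
  set a := k.+1%:R^-1; set b := j.+1%:R^-1 => h1 h2; clearbody a b; lra.
have rep x : phi x = q (B x) z.
  apply/eqP; rewrite -subr_eq0 -oppr_eq0 opprB; apply/eqP.
  apply: (@quadratic_ge0_linear_eq0 _ _ (N (B x))) => t.
  have lim : (fun n => 2 * t * (q (B (u n)) (B x) - phi x) + t ^+ 2 * N (B x) +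
       n.+1%:R^-1) @ \oo --> 2 * t * (q (B x) z - phi x) + t ^+ 2 * N (B x).
    rewrite -[X in _ --> X]addr0; apply: cvgD; last exact: cvg_harmonic.
    apply: cvgD; last exact: cvg_cst.
    apply: cvgM; first exact: cvg_cst.
    by apply: cvgB; [rewrite ipC//; exact: ncvg_ip|exact: cvg_cst].
  apply: cvg_ge_lb lim _ => n.
  have := uP n; have := infJ (u n + t *: x); rewrite /J.
  rewrite (linD lB) (linZ lB) normD2 normZ2 ipZr phiD phiZ.
  set b := n.+1%:R^-1; clearbody b; lra.
exists z; split => //; first by exists u.
have h1 : (fun n => phi (u n)) @ \oo --> N z.
  under eq_fun do rewrite rep.
  exact: ncvg_ip.
have h2 : (fun n => M * qnorm (B (u n))) @ \oo --> M * qnorm z.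
  apply: cvgM; first exact: cvg_cst.
  exact: (cvg_comp _ _ (ncvg_norm uz) (@sqrt_continuous R (N z))).
have : N z <= M * qnorm z.
  rewrite -(cvg_lim _ h1)// -(cvg_lim _ h2)//.
  apply: ler_lim; [by apply/cvg_ex; exists (N z)|by apply/cvg_ex; exists (M * qnorm z)|].
  by apply: nearW => n; exact: phiM.
rewrite -qnorm_sqr expr2; have [->//|zn] := eqVneq (qnorm z) 0.
by rewrite ler_pM2r// lt_neqAle eq_sym zn qnorm_ge0.
Qed.

End real_hilbert.

Section real_operators.
Context {R : realType} {V : lmodType R} (q : V -> V -> R).
Local Notation N x := (q x x).
Hypothesis H : real_hilbert q.
Implicit Types (T U B C : V -> V) (x y z : V).
Local Notation nrm := (qnorm q).

(** The adjoint is carried along, so that it is at hand for sums, products and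
    powers; [c] bounds the square of the norm. *)
Record bop (c : R) T T' : Prop := Bop {
  bop_gt0 : 0 < c ;
  bop_lin : linear T ;
  bop_lin' : linear T' ;
  bop_adj : forall x y, q (T x) y = q x (T' y) ;
  bop_le : forall x, N (T x) <= c * N x ;
  bop_le' : forall x, N (T' x) <= c * N x }.

Lemma bopC c T T' : bop c T T' -> bop c T' T.
Proof. by move=> [c0 l l' a b b']; split=> // x y; rewrite (ipC H) -a (ipC H). Qed.

Lemma bop_id : bop 1 id id.
Proof. by split=> // x; rewrite mul1r. Qed.

Lemma bop_comp c d T T' U U' : bop c T T' -> bop d U U' ->
  bop (c * d) (T \o U) (U' \o T').
Proof.
move=> [c0 l l' a b b'] [d0 k k' e f f']; split.
- exact: mulr_gt0.
- by move=> r x y /=; rewrite k l.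
- by move=> r x y /=; rewrite l' k'.
- by move=> x y /=; rewrite a e.
- move=> x /=; apply: le_trans (b _) _; rewrite -mulrA ler_wpM2l//; exact: ltW.
- move=> x /=; apply: le_trans (f' _) _.
  by rewrite (mulrC c) -mulrA ler_wpM2l// ltW.
Qed.

Lemma bopD c d T T' U U' : bop c T T' -> bop d U U' ->
  bop (2 * c + 2 * d) (fun x => T x + U x) (fun x => T' x + U' x).
Proof.
move=> [c0 l l' a b b'] [d0 k k' e f f']; split.
- lra.
- by move=> r x y /=; rewrite k l scalerDr addrACA.
- by move=> r x y /=; rewrite l' k' scalerDr addrACA.
- by move=> x y; rewrite !(ipE H) a e.
- by move=> x; have := normD2_le H (T x) (U x); have := b x; have := f x; lra.
- by move=> x; have := normD2_le H (T' x) (U' x); have := b' x; have := f' x; lra.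
Qed.

Lemma bopN c T T' : bop c T T' -> bop c (fun x => - T x) (fun x => - T' x).
Proof.
move=> [c0 l l' a b b']; split=> //.
- by move=> r x y; rewrite l opprD scalerN.
- by move=> r x y; rewrite l' opprD scalerN.
- by move=> x y; rewrite !(ipE H) a.
- by move=> x; rewrite (normN2 H).
- by move=> x; rewrite (normN2 H).
Qed.

Lemma bop_iter c T T' n : bop c T T' -> bop (c ^+ n) (iter n T) (iter n T').
Proof.
move=> b; elim: n => [|n ih]; first by rewrite expr0; exact: bop_id.
rewrite exprS (_ : iter n.+1 T' = iter n T' \o T'); last first.
  by apply/funext => x; rewrite iterSr.
by have := bop_comp b ih.
Qed.

Lemma bop_adj_uniq c d T T' U' : bop c T T' -> bop d T U' -> T' = U'.
Proof.
move=> [_ _ _ a _ _] [_ _ _ a' _ _]; apply/funext => y; apply: (ipxx_eq H) => x.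
by rewrite -a a'.
Qed.

(** The vector representing [x |-> q (C x) y] in the closure of the range of
    [B] is unique, hence depends linearly on [y]. *)
Lemma range_adjoint B C (c : R) : linear B -> linear C -> 0 <= c ->
  (forall x, N (C x) <= c * N (B x)) ->
  exists W, [/\ linear W, forall x y, q (B x) (W y) = q (C x) y &
                forall y, N (W y) <= c * N y].
Proof.
move=> lB lC c0 CB.
have hC x : nrm (C x) <= Num.sqrt c * nrm (B x).
  rewrite (qnorm_le H) ?mulr_ge0 ?sqrtr_ge0//.
  by rewrite exprMn sqr_sqrtr// (qnorm_sqr H).
have /choice[W WP] : forall y, exists z, [/\ forall x, q (C x) y = q (B x) z,
    exists u, ncvg q (B \o u) z & nrm z <= Num.sqrt c * nrm y].
  move=> y; apply: (riesz_range H (phi := fun x => q (C x) y)) => //.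
  - by move=> a u v; rewrite lC !(ipE H).
  - by rewrite mulr_ge0 ?sqrtr_ge0.
  - move=> x; apply: le_trans (ip_le_qnorm H _ _) _.
    by rewrite mulrAC ler_wpM2r// qnorm_ge0.
exists W; split=> [a y z|x y|y].
- apply/eqP; rewrite -subr_eq0; apply/eqP/(ip_eq0 H).
  set d := _ - _.
  have d0 x : q (B x) d = 0.
    rewrite /d !(ipE H).
    have [<- _ _] := WP (a *: y + z); have [<- _ _] := WP y; have [<- _ _] := WP z.
    by rewrite !(ipE H) subrr.
  have [_ [u1 cu1] _] := WP (a *: y + z).
  have [_ [u2 cu2] _] := WP y; have [_ [u3 cu3] _] := WP z.
  have cd : ncvg q (B \o (fun n => u1 n - (a *: u2 n + u3 n))) d.
    rewrite (_ : _ \o _ = (fun n => B (u1 n) - (a *: B (u2 n) + B (u3 n)))).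
      apply: (ncvgB H) => //; apply: (ncvgD H) => //; exact: (ncvgZ H).
    by apply/funext => n; rewrite /= (linB lB) (linD lB) (linZ lB).
  apply: cvg_uniq (ncvg_ip H (y := d) cd) _; under eq_fun do rewrite d0.
  exact: cvg_cst.
- by have [-> _ _] := WP y.
- have [_ _ h] := WP y; rewrite (qnorm_le H) ?mulr_ge0 ?sqrtr_ge0// in h.
  by rewrite exprMn sqr_sqrtr// (qnorm_sqr H) in h.
Qed.

Lemma exists_adjoint T (c : R) : linear T -> 0 < c -> (forall x, N (T x) <= c * N x) ->
  exists T', bop c T T'.
Proof.
move=> lT c0 Tc.
have [W [lW WE Wc]] := @range_adjoint id T c (fun _ _ _ => erefl) lT (ltW c0) Tc.
by exists W; split=> // x y; rewrite -WE.
Qed.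

(** Douglas factorization: if [|C x| <= |B x|] then [C] factors through [B] by a
    contraction. Both the factor of the polar decomposition and its inverse arise
    in this way. *)
Lemma douglas B C : linear B -> linear C -> (forall x, N (C x) <= N (B x)) ->
  exists W W', bop 1 W W' /\ C = W \o B.
Proof.
move=> lB lC CB.
have [|U [lU UE Uc]] := @range_adjoint B C 1 lB lC ler01.
  by move=> x; rewrite mul1r.
have [W bW] := @exists_adjoint U 1 lU ltr01 Uc.
exists W, U; split; first exact: bopC.
apply/funext => x; apply: (ipxx_eq H) => y /=.
by rewrite -(bop_adj bW) (ipC H y) -UE (ipC H).
Qed.

(** * The square root of a positive operator *)

(** Cauchy-Schwarz for the form [q (A x) y], applied to [x] and [A x]. *)
Lemma psd_norm_le A c : bop c A A -> (forall x, 0 <= q (A x) x) ->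
  forall s, (forall x, q (A x) x <= s * N x) -> forall x, N (A x) <= s * q (A x) x.
Proof.
move=> bA A0 s As x.
have lA := bop_lin bA.
have h : q (A x) (A x) ^+ 2 <= q (A x) x * q (A (A x)) (A x).
  apply: (psd_cauchy_schwarz (a := fun x y => q (A x) y)) => //.
  - by move=> u v z; rewrite (linD lA) (ipDl H).
  - by move=> a u z; rewrite (linZ lA) (ipZl H).
  - by move=> u v; rewrite (bop_adj bA) (ipC H).
have [e|n0] := eqVneq (N (A x)) 0.
  have [->|xn] := eqVneq x 0; first by rewrite (lin0 lA) (ip0l H) mulr0.
  have xp : 0 < N x.
    rewrite lt_neqAle (ip_ge0 H) andbT eq_sym; apply: contra_neq xn; exact: ip_eq0.
  have s0 : 0 <= s.
    by have := le_trans (A0 x) (As x); rewrite pmulr_lge0.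
  by rewrite e mulr_ge0.
have Np : 0 < N (A x) by rewrite lt_neqAle eq_sym n0 (ip_ge0 H).
rewrite -(ler_pM2r Np) -expr2; apply: le_trans h _.
by rewrite (mulrC s) -mulrA ler_wpM2l.
Qed.

(** Scale [A] so that [D = 1 - A] is a contraction. The solution [Y] of
    [Y = (D + Y^2) / 2] then gives the root [1 - Y]; the iteration defining it
    is dominated in norm by the same iteration for the number [1]. Taking for [J]
    the multiplication by [i] shows that the root of a complex linear operator is
    complex linear. *)
Lemma psd_sqrt A c : bop c A A -> (forall x, 0 <= q (A x) x) ->
  exists h d, [/\ bop d h h, forall x, 0 <= q (h x) x,
    forall x, h (h x) = A x &
    forall J e, linear J -> (forall x, N (J x) <= e * N x) ->
      (forall x, J (A x) = A (J x)) -> forall x, J (h x) = h (J x)].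
Proof.
move=> bA A0.
have c0 := bop_gt0 bA; have lA := bop_lin bA.
pose s := c + 1; have s0 : 0 < s by rewrite /s; lra.
have sn : s != 0 by rewrite gt_eqF.
have As x : q (A x) x <= s * N x.
  have := ip_amgm H (A x) x ltr01; rewrite invr1 !mul1r => /(le_trans (ler_norm _)).
  by have := bop_le bA x; rewrite /s; lra.
pose D x := x - s^-1 *: A x.
have lD : linear D.
  move=> a x y; rewrite /D lA scalerBr scalerDr opprD !scalerA.
  by rewrite addrACA (mulrC a).
have Dsym x y : q (D x) y = q x (D y).
  by rewrite /D !(ipE H) (bop_adj bA).
have Dle x : nrm (D x) <= nrm x.
  rewrite (qnorm_le H) ?qnorm_ge0// (qnorm_sqr H) /D (normB2 H) (normZ2 H) (ipZr H) (ipC H x).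
  have h1 := psd_norm_le bA A0 As x; have h2 := A0 x.
  have si : 0 < s^-1 by rewrite invr_gt0.
  have h3 : s^-1 ^+ 2 * N (A x) <= s^-1 * q (A x) x.
    rewrite expr2 -mulrA ler_pM2l// mulrC ler_pdivrMr// mulrC; exact: h1.
  have h4 : 0 <= s^-1 * q (A x) x by rewrite mulr_ge0// ltW.
  lra.
pose Y := fix Y n : V -> V := if n is m.+1 then
  fun x => 2^-1 *: (D x + Y m (Y m x)) else fun=> 0.
pose y := fix y n : R := if n is m.+1 then (1 + y m ^+ 2) / 2 else 0.
have yb n : 0 <= y n <= 1.
  by elim: n => [|n ih] /=; [rewrite lexx ler01|nra].
have ym n : y n <= y n.+1 by rewrite /=; have := sqr_ge0 (1 - y n); lra.
have lY n : linear (Y n).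
  elim: n => [|n ih] a u v /=; first by rewrite scaler0 addr0.
  by rewrite lD !ih addrACA scalerA (mulrC a) -scalerA -scalerDr -scalerDr.
have Yle n x : nrm (Y n x) <= y n * nrm x.
  elim: n x => [|n ih] x /=.
    by rewrite /qnorm (ip0l H) sqrtr0 mul0r.
  rewrite (qnormZ H) ger0_norm// mulrC ler_pdivrMr// mulrAC divfK//.
  apply: le_trans (qnormD H _ _) _; rewrite mulrDl mul1r; apply: lerD (Dle x) _.
  have /andP[y0 _] := yb n.
  apply: le_trans (ih _) _; rewrite expr2 -mulrA ler_wpM2l//.
have Yd n x : nrm (Y n.+1 x - Y n x) <= (y n.+1 - y n) * nrm x.
  elim: n x => [|n ih] x.
    have -> : Y 1 x - Y 0 x = 2^-1 *: D x by rewrite /= addr0 subr0.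
    have -> : y 1 - y 0 = 2^-1 by rewrite /=; field.
    by rewrite (qnormZ H) ger0_norm// ler_wpM2l.
  have -> : Y n.+2 x - Y n.+1 x = 2^-1 *: (Y n.+1 (Y n.+1 x - Y n x) +
      (Y n.+1 (Y n x) - Y n (Y n x))).
    rewrite [Y n.+2 x]/= [Y n.+1 x in RHS]/= [Y n.+1 x in X in _ - X]/=.
    rewrite -scalerBr opprD addrACA subrr add0r.
    congr (_ *: _); rewrite (linB (lY n.+1)) subrKA//.
  rewrite (qnormZ H) ger0_norm//.
  have /andP[y0 y1] := yb n.+1; have /andP[z0 z1] := yb n.
  have e1 := le_trans (Yle n.+1 _) (ler_wpM2l y0 (ih x)).
  have e2 := le_trans (ih (Y n x)) (ler_wpM2l (y := _) _ (Yle n x)).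
  have {}e2 : nrm (Y n.+1 (Y n x) - Y n (Y n x)) <= (y n.+1 - y n) * (y n * nrm x).
    by apply: e2; rewrite subr_ge0.
  have e3 := qnormD H (Y n.+1 (Y n.+1 x - Y n x)) (Y n.+1 (Y n x) - Y n (Y n x)).
  rewrite mulrC ler_pdivrMr//.
  apply: le_trans e3 _; apply: le_trans (lerD e1 e2) _.
  have -> : y n.+2 - y n.+1 = (y n.+1 ^+ 2 - y n ^+ 2) / 2 by rewrite /=; field.
  by rewrite le_eqVlt; apply/orP; left; apply/eqP; field.
have Ymono j k x : (j <= k)%N -> nrm (Y k x - Y j x) <= (y k - y j) * nrm x.
  elim: k => [|k ih]; first by rewrite leqn0 => /eqP->; rewrite !subrr mul0r /qnorm (ip0l H) sqrtr0.
  rewrite leq_eqVlt => /orP[/eqP->|]; first by rewrite !subrr mul0r /qnorm (ip0l H) sqrtr0.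
  rewrite ltnS => /ih h; rewrite -(subrKA (Y k x)) -(subrKA (y k)) mulrDl.
  exact: le_trans (qnormD H _ _) (lerD (Yd k x) h).
have [l yl _] : exists2 l, y @ \oo --> l & l <= 1.
  by apply: nondecreasing_bounded_cvg => // n; have /andP[] := yb n.
have Ycau x : ncauchy q (fun n => Y n x).
  move=> e e0; pose e' := e / (2 * (N x + 1)).
  have N1 : 0 < N x + 1 by have := ip_ge0 H x; lra.
  have e'0 : 0 < e' by rewrite divr_gt0// mulr_gt0.
  have /cvgrPdist_le/(_ e' e'0)[m _ hm] := yl.
  have key j k : (m <= j)%N -> (j <= k)%N -> N (Y k x - Y j x) <= e.
    move=> mj jk; have mk := leq_trans mj jk.
    have ykj : y j <= y k by move/nondecreasing_seqP : ym; apply.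
    have d1 : y k - y j <= 2 * e'.
      have /= := hm j mj; have /= := hm k mk; rewrite !ler_norml => /andP[? ?] /andP[? ?].
      lra.
    rewrite -(qnorm_sqr H); have h := Ymono j k x jk.
    have /andP[yj0 yj1] := yb j; have /andP[yk0 yk1] := yb k.
    have d0 : 0 <= y k - y j by rewrite subr_ge0.
    have h2 : nrm (Y k x - Y j x) ^+ 2 <= (y k - y j) ^+ 2 * N x.
      by rewrite -(qnorm_sqr H) -exprMn ler_pXn2r// nnegrE ?qnorm_ge0// mulr_ge0 ?qnorm_ge0.
    have d2 : (y k - y j) ^+ 2 <= 2 * e'.
      by apply: le_trans d1; rewrite expr2 ler_piMr//; lra.
    have e'E : 2 * e' * (N x + 1) = e by rewrite /e'; field; rewrite gt_eqF.
    have h3 := ler_wpM2r (ip_ge0 H x) d2.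
    have : 2 * e' * N x <= e by rewrite -e'E mulrDr mulr1; lra.
    lra.
  exists m => j k mj mk; have [jk|/ltnW kj] := leqP j k; last exact: key.
  by rewrite (normC2 H); exact: key.
have /choice[Z ZP] : forall x, exists z, ncvg q (fun n => Y n x) z.
  by move=> x; exact: (ip_complete H (Ycau x)).
have YleN n x : N (Y n x) <= N x.
  have /andP[y0 y1] := yb n; rewrite -!(qnorm_sqr H) ler_pXn2r ?nnegrE ?qnorm_ge0//.
  by apply: le_trans (Yle n x) _; rewrite ler_piMl// qnorm_ge0.
have lZ : linear Z.
  move=> a u v; apply: (ncvg_uniq H (ZP _)).
  rewrite (_ : (fun n => _) = (fun n => a *: Y n u + Y n v)); last first.
    by apply/funext => n; rewrite lY.
  by apply: (ncvgD H) => //; exact: (ncvgZ H).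
have ZleN x : N (Z x) <= N x by apply: cvg_le_ub (ncvg_norm H (ZP x)) _ => n.
have Ysym n u v : q (Y n u) v = q u (Y n v).
  elim: n u v => [|n ih] u v /=; first by rewrite (ip0l H) (ip0r H).
  by rewrite (ipZl H) (ipZr H) (ipDl H) (ipDr H) Dsym !ih.
have Zsym u v : q (Z u) v = q u (Z v).
  apply: cvg_uniq (ncvg_ip H (y := v) (ZP u)) _.
  under eq_fun do rewrite Ysym (ipC H).
  by rewrite (ipC H); exact: (ncvg_ip H (ZP v)).
have YY x : ncvg q (fun n => Y n (Y n x)) (Z (Z x)).
  apply: (@cvg0_le _ _ (fun n => 2 * N (Y n x - Z x) + 2 * N (Y n (Z x) - Z (Z x)))).
    move=> n; rewrite ger0_norm ?(ip_ge0 H)// -(subrKA (Y n (Z x))) -(linB (lY n)).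
    apply: le_trans (normD2_le H _ _) _; rewrite lerD2r ler_wpM2l//.
  by apply: cvg0D; apply: cvg0Ml; exact: ZP.
have ZE x : Z x = 2^-1 *: (D x + Z (Z x)).
  apply: (ncvg_uniq H (u := fun n => Y n.+1 x)).
    by have := ZP x; rewrite /ncvg -(cvg_shiftS (fun n => N (Y n x - Z x))).
  by apply: (ncvgZ H); apply: (ncvgD H) => //; exact: (ncvg_cst H).
pose r := Num.sqrt s.
have rr : r * r = s by rewrite -expr2 sqr_sqrtr// ltW.
pose h x := r *: (x - Z x).
have lh : linear h.
  move=> a u v; rewrite /h lZ opprD addrACA -scalerBr.
  by rewrite scalerDr !scalerA (mulrC r).
have hh x : h (h x) = A x.
  rewrite /h (linZ lZ) -scalerBr scalerA rr (linB lZ).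
  have -> : x - Z x - (Z x - Z (Z x)) = x - D x.
    have e : Z x + Z x = D x + Z (Z x).
      by rewrite -mulr2n -scaler_nat {1}ZE scalerA divff ?scale1r// pnatr_eq0.
    have -> : D x = Z x + Z x - Z (Z x) by rewrite e addrK.
    by rewrite !opprD !opprK !addrA.
  by rewrite /D opprB addrC subrK scalerA divff// scale1r.
exists h, (s * 4); split=> //.
- split=> //; first lra.
  + by move=> u v; rewrite /h !(ipE H) Zsym.
  + move=> x; rewrite /h (normZ2 H) expr2 rr -mulrA ler_pM2l//.
    by rewrite (normB2 H); have := ZleN x; have := normD2 H x (Z x); have := ip_ge0 H (x + Z x); lra.
  + move=> x; rewrite /h (normZ2 H) expr2 rr -mulrA ler_pM2l//.
    by rewrite (normB2 H); have := ZleN x; have := normD2 H x (Z x); have := ip_ge0 H (x + Z x); lra.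
- move=> x; rewrite /h !(ipE H) mulr_ge0 ?sqrtr_ge0// subr_ge0.
  have := ip_le_qnorm H (Z x) x; move/le_trans; apply.
  rewrite -(qnorm_sqr H) expr2 ler_wpM2r ?qnorm_ge0//.
  by rewrite (qnorm_le H) ?qnorm_ge0// (qnorm_sqr H).
- move=> J e lJ Je JA.
  have JD x : J (D x) = D (J x) by rewrite /D (linB lJ) (linZ lJ) JA.
  have JY n x : J (Y n x) = Y n (J x).
    elim: n x => [|n ih] x /=; first by rewrite (lin0 lJ).
    by rewrite (linZ lJ) (linD lJ) JD !ih.
  have JZ x : J (Z x) = Z (J x).
    have := ncvg_bounded H (linB lJ) Je (ZP x) => h1.
    apply: (ncvg_uniq H h1); rewrite (_ : _ \o _ = (fun n => Y n (J x))) //.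
    by apply/funext => n /=; rewrite JY.
  by move=> x; rewrite /h (linZ lJ) (linB lJ) JZ.
Qed.

End real_operators.

Lemma cvg_bigsum (R : realType) n (u : nat -> nat -> R) (l : nat -> R) :
  (forall k, u k @ \oo --> l k) ->
  (fun j => \sum_(0 <= k < n) u k j) @ \oo --> \sum_(0 <= k < n) l k.
Proof.
move=> ul; elim: n => [|n ih].
  rewrite big_geq//; under eq_fun do rewrite big_geq//; exact: cvg_cst.
rewrite big_nat_recr//=; under eq_fun do rewrite big_nat_recr//=.
exact: cvgD.
Qed.

(** * Hilbert-Schmidt and trace class operators *)

Section trace_ideal.
Context {R : realType} {V : lmodType R} (q : V -> V -> R).
Local Notation N x := (q x x).
Hypothesis H : real_hilbert q.
Implicit Types (T U B C K L : V -> V) (x y z : V) (e f g : nat -> V).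
Local Notation bop := (bop q).

Definition bessel f := forall x n, \sum_(0 <= k < n) q x (f k) ^+ 2 <= N x.

(** Such a family may contain zero vectors. This allows the Gram-Schmidt family
    of a sequence whose linear independence is not established. *)
Definition parseval f := forall x,
  (fun n => \sum_(0 <= k < n) q x (f k) ^+ 2) @ \oo --> N x.

Lemma sum_ge0_nondecreasing (u : nat -> R) : (forall k, 0 <= u k) ->
  forall n, \sum_(0 <= k < n) u k <= \sum_(0 <= k < n.+1) u k.
Proof. by move=> u0 n; rewrite big_nat_recr//= lerDl. Qed.

Lemma parseval_bessel f : parseval f -> bessel f.
Proof.
move=> pf x n; apply: (nondecreasing_le_cvg _ (pf x)) => m.
by apply: sum_ge0_nondecreasing => k; exact: sqr_ge0.
Qed.

Lemma bessel0 : bessel (fun=> 0).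
Proof.
move=> x n; rewrite big1 ?(ip_ge0 H)// => k _.
by rewrite (ip0r H) expr0n.
Qed.

(** A bound for the square of the Hilbert-Schmidt norm of [T]. Testing [T]
    against Bessel families, rather than against bases, makes the bound stable
    under composition with bounded operators. *)
Definition hsb T (M : R) := forall f, bessel f ->
  forall n, \sum_(0 <= k < n) N (T (f k)) <= M.

Lemma hsb_ge0 T M : hsb T M -> 0 <= M.
Proof. by move=> /(_ _ bessel0 0%N); rewrite big_geq. Qed.

(** Both sums are sums of the squared matrix coefficients [q (T e_k) f_m]. *)
Lemma hsb_adj c T T' e M : bop c T T' -> parseval e ->
  (forall n, \sum_(0 <= k < n) N (T (e k)) <= M) -> hsb T' M.
Proof.
move=> bT pe TM f bf n.
have := @cvg_bigsum R n _ _ (fun m => pe (T' (f m))).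
move=> /cvg_le_ub; apply => j; rewrite exchange_big/=.
apply: le_trans (TM j); apply: ler_sum => k _.
apply: le_trans (bf (T (e k)) n); rewrite le_eqVlt; apply/orP; left; apply/eqP.
by apply: eq_bigr => m _; rewrite (bop_adj bT) (ipC H).
Qed.

Lemma hsb_parseval c T T' e M : bop c T T' -> parseval e ->
  (forall n, \sum_(0 <= k < n) N (T (e k)) <= M) -> hsb T M.
Proof.
move=> bT pe TM; apply: (hsb_adj (bopC H bT) pe).
by apply: (hsb_adj bT pe TM); exact: parseval_bessel.
Qed.

Lemma hsb_scale T M f (a : R) : linear T -> 0 < a -> hsb T M ->
  (forall x n, \sum_(0 <= k < n) q x (f k) ^+ 2 <= a * N x) ->
  forall n, \sum_(0 <= k < n) N (T (f k)) <= a * M.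
Proof.
move=> lT a0 TM fa n; pose r := (Num.sqrt a)^-1.
have rr : r ^+ 2 = a^-1 by rewrite exprVn sqr_sqrtr// ltW.
have bf : bessel (fun k => r *: f k).
  move=> x m; under eq_bigr do rewrite (ipZr H) exprMn rr.
  by rewrite -mulr_sumr mulrC ler_pdivrMr// mulrC; exact: fa.
have := TM _ bf n; under eq_bigr do rewrite (linZ lT) (normZ2 H) rr.
by rewrite -mulr_sumr mulrC ler_pdivrMr// mulrC.
Qed.

Lemma bop_bessel c B B' f : bop c B B' -> bessel f ->
  forall x n, \sum_(0 <= k < n) q x (B (f k)) ^+ 2 <= c * N x.
Proof.
move=> bB bf x n; apply: le_trans (bop_le' bB x).
apply: le_trans (bf (B' x) n); rewrite le_eqVlt; apply/orP; left; apply/eqP.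
by apply: eq_bigr => m _; rewrite (ipC H) (bop_adj bB) (ipC H).
Qed.

Lemma hsbD T U M P : hsb T M -> hsb U P ->
  hsb (fun x => T x + U x) (2 * M + 2 * P).
Proof.
move=> TM UP f bf n.
apply: le_trans (lerD (ler_wpM2l (ler0n _ 2) (TM f bf n)) (ler_wpM2l (ler0n _ 2) (UP f bf n))).
rewrite !mulr_sumr -big_split/=; apply: ler_sum => k _; exact: normD2_le.
Qed.

Lemma hsbN T M : hsb T M -> hsb (fun x => - T x) M.
Proof.
by move=> TM f bf n; under eq_bigr do rewrite (normN2 H); exact: TM.
Qed.

Lemma hsb_compl c B B' T M : bop c B B' -> hsb T M -> hsb (B \o T) (c * M).
Proof.
move=> bB TM f bf n; apply: le_trans (ler_wpM2l (ltW (bop_gt0 bB)) (TM f bf n)).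
by rewrite mulr_sumr; apply: ler_sum => k _; exact: bop_le bB _.
Qed.

Lemma hsb_compr c B B' T M : bop c B B' -> linear T -> hsb T M ->
  hsb (T \o B) (c * M).
Proof.
move=> bB lT TM f bf n.
exact: (hsb_scale lT (bop_gt0 bB) TM (bop_bessel bB bf)).
Qed.

(** A bound for the adjoint is included, as it can only be derived from the one
    for [T] in the presence of a Parseval family. *)
Definition hs T := exists T' c M, [/\ bop c T T', hsb T M & hsb T' M].

Lemma hs_parseval c T T' e M : bop c T T' -> parseval e ->
  (forall n, \sum_(0 <= k < n) N (T (e k)) <= M) -> hs T.
Proof.
move=> bT pe TM; exists T', c, M; split=> //.
  exact: hsb_parseval bT pe TM.
exact: hsb_adj bT pe TM.
Qed.

Lemma hs_adj c T T' : hs T -> bop c T T' -> hs T'.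
Proof.
move=> [U [d [M [bU TM UM]]]] bT; rewrite (bop_adj_uniq H bT bU).
by exists T, d, M; split=> //; exact: bopC.
Qed.

Lemma hsD T U : hs T -> hs U -> hs (fun x => T x + U x).
Proof.
move=> [T' [c [M [bT TM TM']]]] [U' [d [P [bU UP UP']]]].
exists (fun x => T' x + U' x), (2 * c + 2 * d), (2 * M + 2 * P).
by split; [exact: bopD|exact: hsbD|exact: hsbD].
Qed.

Lemma hsN T : hs T -> hs (fun x => - T x).
Proof.
move=> [T' [c [M [bT TM TM']]]]; exists (fun x => - T' x), c, M.
by split; [exact: bopN|exact: hsbN|exact: hsbN].
Qed.

Lemma hs_compl c B B' T : bop c B B' -> hs T -> hs (B \o T).
Proof.
move=> bB [T' [d [M [bT TM TM']]]]; exists (T' \o B'), (c * d), (c * M).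
split; [exact: bop_comp|exact: hsb_compl bB TM|].
by apply: (hsb_compr (bopC H bB)) => //; exact: bop_lin' bT.
Qed.

Lemma hs_compr c B B' T : bop c B B' -> hs T -> hs (T \o B).
Proof.
move=> bB [T' [d [M [bT TM TM']]]]; exists (B' \o T'), (d * c), (c * M).
split; [exact: bop_comp| |exact: hsb_compl (bopC H bB) TM'].
by apply: (hsb_compr bB) => //; exact: bop_lin bT.
Qed.

(** The Hilbert-Schmidt norm depends neither on the family nor on whether it is
    computed from [T] or from its adjoint. *)
Lemma hs_norm_cvg c T T' e f : hs T -> bop c T T' -> parseval e -> parseval f ->
  exists s : R, (fun n => \sum_(0 <= k < n) N (T (e k))) @ \oo --> s /\
            (fun n => \sum_(0 <= k < n) N (T' (f k))) @ \oo --> s.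
Proof.
move=> [U [d [M [bU TM UM]]]] bT pe pf; move: UM.
rewrite -(bop_adj_uniq H bT bU) => TM'.
have [s se _] := @nondecreasing_bounded_cvg _ _ M
  (sum_ge0_nondecreasing (fun k => ip_ge0 H (T (e k)))) (TM _ (parseval_bessel pe)).
have [s' sf _] := @nondecreasing_bounded_cvg _ _ M
  (sum_ge0_nondecreasing (fun k => ip_ge0 H (T' (f k)))) (TM' _ (parseval_bessel pf)).
exists s; split=> //.
suff <- : s' = s by [].
have s_ub := nondecreasing_le_cvg
  (sum_ge0_nondecreasing (fun k => ip_ge0 H (T (e k)))) se.
have s'_ub := nondecreasing_le_cvg
  (sum_ge0_nondecreasing (fun k => ip_ge0 H (T' (f k)))) sf.
apply/eqP; rewrite eq_le; apply/andP; split.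
  apply: cvg_le_ub sf _; exact: hsb_adj bT pe s_ub _ (parseval_bessel pf).
apply: cvg_le_ub se _.
exact: hsb_adj (bopC H bT) pf s'_ub _ (parseval_bessel pe).
Qed.

(** The trace along a given family, without absolute convergence *)
Definition has_trace e C (t : R) :=
  (fun n => \sum_(0 <= k < n) q (C (e k)) (e k)) @ \oo --> t.

(** [Tr (K L) = Tr (L K)] by polarization: both sides are a quarter of the
    difference of the squared norms of [L + K^*] and [L - K^*]. *)
Lemma hs_trace K L e f : hs K -> hs L -> parseval e -> parseval f ->
  exists t, has_trace e (K \o L) t /\ has_trace f (L \o K) t.
Proof.
move=> hK hL pe pf.
have [K' [c [_ [bK _ _]]]] := hK; have [L' [d [_ [bL _ _]]]] := hL.
have hK' := hs_adj hK bK.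
have [s [s1 s2]] := hs_norm_cvg (hsD hL hK') (bopD H bL (bopC H bK)) pe pf.
have [r [r1 r2]] := hs_norm_cvg (hsD hL (hsN hK'))
   (bopD H bL (bopN H (bopC H bK))) pe pf.
exists (4^-1 * (s - r)); split.
- rewrite /has_trace.
  rewrite (_ : (fun n => _) = (fun n => 4^-1 *
    (\sum_(0 <= k < n) N (L (e k) + K' (e k)) - \sum_(0 <= k < n) N (L (e k) - K' (e k))))).
    by apply: cvgM; [exact: cvg_cst|exact: cvgB].
  apply/funext => n; rewrite -sumrB mulr_sumr; apply: eq_bigr => k _ /=.
  by rewrite (bop_adj bK) (normD2 H) (normB2 H); field.
- rewrite /has_trace.
  rewrite (_ : (fun n => _) = (fun n => 4^-1 *
    (\sum_(0 <= k < n) N (L' (f k) + K (f k)) - \sum_(0 <= k < n) N (L' (f k) - K (f k))))).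
    by apply: cvgM; [exact: cvg_cst|exact: cvgB].
  apply/funext => n; rewrite -sumrB mulr_sumr; apply: eq_bigr => k _ /=.
  by rewrite (bop_adj bL) (normD2 H) (normB2 H) (ipC H (L' _)); field.
Qed.

(** Trace class operators, as finite sums of products of two Hilbert-Schmidt
    operators *)
Inductive tc : (V -> V) -> Prop :=
| tc_mul K L : hs K -> hs L -> tc (K \o L)
| tcD C D : tc C -> tc D -> tc (fun x => C x + D x).

Lemma tc_compl c B B' C : bop c B B' -> tc C -> tc (B \o C).
Proof.
move=> bB; elim=> [K L hK hL|C1 D _ h1 _ h2].
  rewrite (_ : B \o (K \o L) = (B \o K) \o L)//; apply: tc_mul => //.
  exact: hs_compl bB hK.
rewrite (_ : _ \o _ = (fun x => (B \o C1) x + (B \o D) x)); first exact: tcD.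
by apply/funext => x /=; rewrite (linD (bop_lin bB)).
Qed.

Lemma tc_compr c B B' C : bop c B B' -> tc C -> tc (C \o B).
Proof.
move=> bB; elim=> [K L hK hL|C1 D _ h1 _ h2].
  rewrite (_ : (K \o L) \o B = K \o (L \o B))//; apply: tc_mul => //.
  exact: hs_compr bB hL.
by have := tcD h1 h2.
Qed.

Lemma tcN C : tc C -> tc (fun x => - C x).
Proof. by move=> hC; have := tc_compl (bopN H (bop_id q)) hC. Qed.

Lemma tcB C D : tc C -> tc D -> tc (fun x => C x - D x).
Proof. by move=> hC /tcN; exact: tcD. Qed.

Lemma tc_adjoint C : tc C -> exists C' c, bop c C C' /\ tc C'.
Proof.
elim=> [K L hK hL|C1 D _ [C' [c [bC hC]]] _ [D' [d [bD hD]]]].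
  have [K' [c [_ [bK _ _]]]] := hK; have [L' [d [_ [bL _ _]]]] := hL.
  exists (L' \o K'), (c * d); split; first exact: bop_comp.
  by apply: tc_mul; [exact: hs_adj hL bL|exact: hs_adj hK bK].
by exists (fun x => C' x + D' x), (2 * c + 2 * d); split; [exact: bopD|exact: tcD].
Qed.

Lemma tc_hs C : tc C -> hs C.
Proof.
elim=> [K L hK hL|C1 D _ h1 _ h2]; last exact: hsD.
by have [K' [c [_ [bK _ _]]]] := hK; exact: hs_compl bK hL.
Qed.

Lemma has_trace_uniq e C s t : has_trace e C s -> has_trace e C t -> s = t.
Proof. exact: cvg_uniq. Qed.

Lemma has_traceD e C D s t : has_trace e C s -> has_trace e D t ->
  has_trace e (fun x => C x + D x) (s + t).
Proof.
move=> hs ht; rewrite /has_trace.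
under eq_fun => n do under eq_bigr do rewrite (ipDl H).
under eq_fun => n do rewrite big_split/=.
exact: cvgD.
Qed.

Lemma has_traceN e C s : has_trace e C s -> has_trace e (fun x => - C x) (- s).
Proof.
move=> h; rewrite /has_trace.
under eq_fun => n do under eq_bigr do rewrite (ipNl H).
under eq_fun => n do rewrite sumrN.
exact: cvgN.
Qed.

Lemma has_traceB e C D s t : has_trace e C s -> has_trace e D t ->
  has_trace e (fun x => C x - D x) (s - t).
Proof. by move=> h1 /has_traceN; exact: has_traceD. Qed.

(** [Tr (B C) = Tr (C B)] for [C] of trace class: move one Hilbert-Schmidt factor
    of [C] at a time. *)
Lemma tc_trace c B B' C e f : bop c B B' -> tc C -> parseval e -> parseval f ->
  exists t, has_trace e (B \o C) t /\ has_trace f (C \o B) t.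
Proof.
move=> bB hC pe pf; elim: hC => [K L hK hL|C1 D _ [s [s1 s2]] _ [t [t1 t2]]].
  have [s [s1 s2]] := hs_trace (hs_compl bB hK) hL pe pe.
  have [t [t1 t2]] := hs_trace (hs_compr bB hL) hK pe pf.
  have st : s = t by exact: has_trace_uniq s2 t1.
  by exists s; split; [exact: s1|rewrite st; exact: t2].
exists (s + t); split; last exact: has_traceD.
rewrite (_ : _ \o _ = (fun x => (B \o C1) x + (B \o D) x)); first exact: has_traceD.
by apply/funext => x /=; rewrite (linD (bop_lin bB)).
Qed.

Lemma tc_trace_indep C e f : tc C -> parseval e -> parseval f ->
  exists t, has_trace e C t /\ has_trace f C t.
Proof. by move=> hC pe pf; exact: (tc_trace (bop_id q) hC pe pf). Qed.

(** * Absolute values and the trace class *)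

Lemma tc_psd c A e M : bop c A A -> (forall x, 0 <= q (A x) x) -> parseval e ->
  (forall n, \sum_(0 <= k < n) q (A (e k)) (e k) <= M) ->
  exists h d, [/\ bop d h h, hs h & A = h \o h].
Proof.
move=> bA A0 pe AM; have [h [d [bh h0 hh _]]] := psd_sqrt H bA A0.
exists h, d; split=> //; last by apply/funext => x; rewrite /= hh.
apply: (hs_parseval (M := M) bh pe) => n.
by under eq_bigr do rewrite (bop_adj bh) hh (ipC H).
Qed.

(** For [A = |T|], factorization gives [T = W A], and [A] is the square of a
    Hilbert-Schmidt operator. *)
Lemma tc_of_abs c d T T' A e M : bop c T T' -> bop d A A ->
  (forall x, 0 <= q (A x) x) -> (forall x, A (A x) = T' (T x)) -> parseval e ->
  (forall n, \sum_(0 <= k < n) q (A (e k)) (e k) <= M) -> tc T.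
Proof.
move=> bT bA A0 AA pe AM.
have [h [r [bh hh hE]]] := tc_psd bA A0 pe AM.
have [|W [W' [bW ->]]] := @douglas _ _ _ H A T (bop_lin bA) (bop_lin bT).
  by move=> x; rewrite (bop_adj bT) -AA (bop_adj bA).
by apply: (tc_compl bW); rewrite hE; exact: tc_mul.
Qed.

(** Conversely [|T| = W T], and the trace class is an ideal. *)
Lemma tc_abs c d T T' A : bop c T T' -> bop d A A ->
  (forall x, A (A x) = T' (T x)) -> tc T -> tc A.
Proof.
move=> bT bA AA hT.
have [|W [W' [bW ->]]] := @douglas _ _ _ H T A (bop_lin bT) (bop_lin bA).
  by move=> x; rewrite (bop_adj bT) -AA (bop_adj bA).
exact: tc_compl bW hT.
Qed.

End trace_ideal.

(** * Orthonormal families and the Gram-Schmidt process *)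

Section orthonormal_families.
Context {R : realType} {V : lmodType R} (q : V -> V -> R).
Local Notation N x := (q x x).
Hypothesis H : real_hilbert q.
Implicit Types (x y z : V) (p v : nat -> V).
Local Notation bop := (bop q).

(** Orthogonal vectors, each of norm one or zero *)
Definition ortho p n := forall j k, (j < n)%N -> (k < n)%N ->
  q (p j) (p k) = ((j == k) && (p j != 0))%:R.

Definition proj p n x := \sum_(0 <= k < n) q x (p k) *: p k.

Lemma projS p n x : proj p n.+1 x = proj p n x + q x (p n) *: p n.
Proof. by rewrite /proj big_nat_recr. Qed.

Lemma proj_linear p n : linear (proj p n).
Proof.
move=> a x y; rewrite /proj scaler_sumr -big_split/=; apply: eq_bigr => k _.
by rewrite !(ipE H) scalerDl scalerA.
Qed.

Lemma proj_ip p n x y : q (proj p n x) y = \sum_(0 <= k < n) q x (p k) * q y (p k).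
Proof.
rewrite /proj (ip_suml H); apply: eq_bigr => k _.
by rewrite (ipZl H) (ipC H y).
Qed.

Lemma proj_sym p n x y : q (proj p n x) y = q x (proj p n y).
Proof.
rewrite (ipC H x) !proj_ip; apply: eq_bigr => k _; exact: mulrC.
Qed.

Lemma proj_coord p n x k : ortho p n -> (k < n)%N -> q (proj p n x) (p k) = q x (p k).
Proof.
move=> po kn; rewrite proj_ip (bigD1_seq k) ?mem_index_iota ?iota_uniq//= big_nat_cond.
rewrite big1 ?addr0; last first.
  by move=> j /andP[/andP[_ jn] jk]; rewrite po// eq_sym (negbTE jk) mulr0.
rewrite po// eqxx/=; have [->|] := eqVneq (p k) 0; last by rewrite mulr1.
by rewrite (ip0r H) mul0r.
Qed.

Lemma proj_norm p n x : ortho p n -> N (proj p n x) = \sum_(0 <= k < n) q x (p k) ^+ 2.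
Proof.
move=> po; rewrite proj_ip; apply: eq_big_nat => k /andP[_ kn].
by rewrite proj_coord// expr2.
Qed.

Lemma proj_dist p n x : ortho p n ->
  N (x - proj p n x) = N x - \sum_(0 <= k < n) q x (p k) ^+ 2.
Proof.
move=> po; rewrite (normB2 H) proj_norm// -proj_sym proj_ip.
under [X in _ - 2 * X]eq_bigr do rewrite -expr2.
by ring.
Qed.

Lemma ortho_le p m n : (m <= n)%N -> ortho p n -> ortho p m.
Proof. by move=> mn po j k jm km; apply: po; exact: leq_trans mn. Qed.

Lemma proj_id_le p m n x : (m <= n)%N -> ortho p n -> proj p m x = x -> proj p n x = x.
Proof.
move=> mn po px; apply/esym/eqP; rewrite -subr_eq0; apply/eqP/(ip_eq0 H)/eqP.
rewrite eq_le (ip_ge0 H) andbT proj_dist// subr_le0.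
have -> : N x = \sum_(0 <= k < m) q x (p k) ^+ 2.
  by rewrite -proj_norm ?px//; exact: ortho_le po.
rewrite (big_cat_nat (leq0n m) mn)//= lerDl; apply: sumr_ge0 => k _; exact: sqr_ge0.
Qed.

Lemma ortho_bessel p : (forall n, ortho p n) -> bessel q p.
Proof.
by move=> po x n; rewrite -subr_ge0 -proj_dist//; exact: ip_ge0.
Qed.

Lemma proj_proj p m n x : (m <= n)%N -> ortho p n -> proj p n (proj p m x) = proj p m x.
Proof.
move=> mn po; apply: (proj_id_le mn po); rewrite /proj; apply: eq_big_nat => k /andP[_ km].
by rewrite -/(proj p m x) proj_coord//; exact: ortho_le po.
Qed.

(** The partial expansions of [x] converge by completeness, and totality
    identifies their limit with [x]. *)
Lemma ortho_total_parseval p : (forall n, ortho p n) ->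
  (forall x, (forall k, q x (p k) = 0) -> x = 0) -> parseval q p.
Proof.
move=> po pt x; pose s n := \sum_(0 <= k < n) q x (p k) ^+ 2.
have smono n : s n <= s n.+1.
  by apply: sum_ge0_nondecreasing => k; exact: sqr_ge0.
have [l sl _] := @nondecreasing_bounded_cvg _ s (N x) smono (ortho_bessel po x).
have dist m n : (m <= n)%N -> N (proj p n x - proj p m x) = s n - s m.
  move=> mn; rewrite (normB2 H) !proj_norm// -/(s n) -/(s m).
  rewrite (ipC H) proj_ip (_ : \sum_(0 <= k < m) _ = s m); first by ring.
  apply: eq_big_nat => k /andP[_ km].
  by rewrite proj_coord ?expr2//; exact: leq_trans km mn.
have cau : ncauchy q (fun n => proj p n x).
  move=> e e0; have /cvgrPdist_le/(_ (e / 2))[|m _ hm] := sl; first by rewrite divr_gt0.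
  have key j k : (m <= j)%N -> (j <= k)%N -> N (proj p k x - proj p j x) <= e.
    move=> mj jk; rewrite dist//.
    have /= := hm j mj; have /= := hm k (leq_trans mj jk).
    by rewrite !ler_norml => /andP[? ?] /andP[? ?]; lra.
  exists m => j k mj mk; have [jk|/ltnW kj] := leqP j k; last exact: key.
  by rewrite (normC2 H); exact: key.
have [z zP] := ip_complete H cau.
have xz : x = z.
  apply/eqP; rewrite -subr_eq0; apply/eqP/pt => k; rewrite (ipBl H); apply/eqP.
  rewrite subr_eq0; apply/eqP/esym; apply: cvg_uniq (ncvg_ip H (y := p k) zP) _.
  have : (fun n => q (proj p (n + k.+1) x) (p k)) @ \oo --> q x (p k).
    under eq_fun do rewrite proj_coord ?leq_addl//; exact: cvg_cst.
  by rewrite (cvg_shiftn k.+1 (fun n => q (proj p n x) (p k))).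
have := ncvg_norm H zP; rewrite -xz.
by under eq_fun do rewrite proj_norm//.
Qed.

(** Gram-Schmidt; a vector depending linearly on its predecessors is replaced
    by [0], because [0^-1 = 0]. *)
Fixpoint gs v (n : nat) : nat -> V := if n is m.+1 then
  fun k => if k == m then
    let r := v m - proj (gs v m) m (v m) in (qnorm q r)^-1 *: r
  else gs v m k else fun=> 0.

Definition gram_schmidt v n := gs v n.+1 n.

Lemma gs_gram_schmidt v m k : (k < m)%N -> gs v m k = gram_schmidt v k.
Proof.
elim: m => // m ih; rewrite ltnS leq_eqVlt => /orP[/eqP->//|km].
by rewrite /= ltn_eqF// ih.
Qed.

Lemma gram_schmidtE v n : let r := v n - proj (gram_schmidt v) n (v n) in
  gram_schmidt v n = (qnorm q r)^-1 *: r.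
Proof.
rewrite /gram_schmidt /= eqxx.
rewrite (_ : proj (gs v n) n (v n) = proj (gram_schmidt v) n (v n))//.
by apply: eq_big_nat => k /andP[_ kn]; rewrite gs_gram_schmidt.
Qed.

Lemma gram_schmidt_ortho v n : ortho (gram_schmidt v) n.
Proof.
set p := gram_schmidt v.
elim: n => [//|n ih] j k.
have pE := gram_schmidtE v n; rewrite /= -/p in pE; set r := v n - _ in pE.
have rp i : (i < n)%N -> q (p n) (p i) = 0.
  by move=> iltn; rewrite pE (ipZl H) /r (ipBl H) proj_coord// subrr mulr0.
rewrite !ltnS (leq_eqVlt j) (leq_eqVlt k) => /orP[/eqP->|jn] /orP[/eqP->|kn].
- rewrite eqxx/=; have [->|pn] := eqVneq (p n) 0; first by rewrite (ip0l H).
  rewrite pE (normZ2 H) -(qnorm_sqr H) -exprMn mulVf ?expr1n//.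
  by apply: contra_neq pn => r0; rewrite pE r0 invr0 scale0r.
- by rewrite rp// gtn_eqF.
- by rewrite (ipC H) rp// ltn_eqF.
- exact: ih.
Qed.

Lemma gram_schmidt_span v n :
  proj (gram_schmidt v) n.+1 (v n) = v n.
Proof.
set p := gram_schmidt v; have po := @gram_schmidt_ortho v; rewrite -/p in po.
have pE := gram_schmidtE v n; rewrite /= -/p in pE; set r := v n - _ in pE.
have vE : v n = proj p n (v n) + qnorm q r *: p n.
  rewrite pE scalerA; have [r0|rn] := eqVneq (qnorm q r) 0.
    have r00 : r = 0 by apply: (ip_eq0 H); rewrite -(qnorm_sqr H) r0 expr0n.
    by rewrite r0 mul0r scale0r addr0; apply/eqP; rewrite -subr_eq0 -/r r00.
  by rewrite divff// scale1r /r addrC subrK.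
have cn : q (v n) (p n) *: p n = qnorm q r *: p n.
  have [->|pn] := eqVneq (p n) 0; first by rewrite !scaler0.
  rewrite vE (ipDl H) (ipZl H) proj_ip big_nat_cond big1 => [|j /andP[/andP[_ jn] _]].
    by rewrite add0r (po n.+1)// eqxx pn mulr1.
  by rewrite (po n.+1)// ?ltnS 1?ltnW// gtn_eqF// mulr0.
by rewrite projS cn -vE.
Qed.

Lemma gram_schmidt_parseval v : (forall x, (forall k, q x (v k) = 0) -> x = 0) ->
  parseval q (gram_schmidt v).
Proof.
move=> vt; apply: ortho_total_parseval; first exact: gram_schmidt_ortho.
move=> x xp; apply: vt => k; rewrite -gram_schmidt_span -proj_sym proj_ip.
by rewrite big1// => j _; rewrite xp mul0r.
Qed.

(** Gram-Schmidt turns a shift of the sequence [v] into a Hessenberg matrix: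
    [S p_k] lies in the span of [p_0, ..., p_(k + d)]. *)
Lemma gram_schmidt_hessenberg v (S : V -> V) d : linear S ->
  (forall k, S (v k) = v (k + d)%N) ->
  forall k, proj (gram_schmidt v) (k + d).+1 (S (gram_schmidt v k)) = S (gram_schmidt v k).
Proof.
move=> lS Sv k; set p := gram_schmidt v.
have po : forall n, ortho p n by exact: gram_schmidt_ortho.
have [n kn] := ubnP k; elim: n k kn => // n ih k; rewrite ltnS => kn.
have pE := gram_schmidtE v k; rewrite /= -/p in pE.
rewrite pE (linZ lS) (linB lS) Sv (linZ (proj_linear _ _)) (linB (proj_linear _ _)).
rewrite gram_schmidt_span; congr (_ *: (_ - _)).
have -> : S (proj p k (v k)) = \sum_(0 <= j < k) S (q (v k) (p j) *: p j).
  exact: lin_sum.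
rewrite (lin_sum _ _ (proj_linear p _)).
apply: eq_big_nat => j /andP[_ jk].
rewrite (linZ lS) (linZ (proj_linear p _)); congr (_ *: _).
apply: (@proj_id_le p (j + d).+1) => //; last exact: ih (leq_trans jk kn).
by rewrite ltnS leq_add2r ltnW.
Qed.
End orthonormal_families.

(** * Commutators and corners *)

Section commutators.
Context {R : realType} {V : lmodType R} (q : V -> V -> R).
Local Notation N x := (q x x).
Hypothesis H : real_hilbert q.
Implicit Types (x y z : V) (S T A B C J K L : V -> V).
Local Notation bop := (bop q).
Local Notation hs := (hs q).
Local Notation tc := (tc q).
Local Notation hsb := (hsb q).

Definition rcomm A B x := A (B x) - B (A x).

Lemma tc_rcommC A B : tc (rcomm A B) -> tc (rcomm B A).
Proof.
move=> /(tcN H); rewrite (_ : (fun x => _) = rcomm B A)//.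
by apply/funext => x; rewrite /rcomm opprB.
Qed.

Lemma tc_rcomm_iterl c A A' d B B' n : bop c A A' -> bop d B B' ->
  tc (rcomm A B) -> tc (rcomm (iter n.+1 A) B).
Proof.
move=> bA bB hAB; elim: n => [//|n ih].
rewrite (_ : rcomm _ _ = fun x => (A \o rcomm (iter n.+1 A) B) x +
    (rcomm A B \o iter n.+1 A) x).
  exact: (tcD (tc_compl H bA ih) (tc_compr H (bop_iter n.+1 bA) hAB)).
by apply/funext => x; rewrite /rcomm [in RHS]/= (linB (bop_lin bA)) subrKA.
Qed.

Lemma tc_rcomm_iter c A A' d B B' m n : bop c A A' -> bop d B B' ->
  tc (rcomm A B) -> tc (rcomm (iter m.+1 A) (iter n.+1 B)).
Proof.
move=> bA bB hAB; apply: tc_rcommC; apply: (tc_rcomm_iterl n bB (bop_iter m.+1 bA)).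
by apply: tc_rcommC; exact: tc_rcomm_iterl bA bB hAB.
Qed.

Variables (p : nat -> V).
Hypothesis po : forall n, ortho q p n.
Hypothesis pp : parseval q p.
Local Notation P n := (proj q p n).

Definition coproj n x := x - P n x.

Lemma proj_bop n : bop 1 (P n) (P n).
Proof.
have Ple x : N (P n x) <= 1 * N x.
  by rewrite mul1r (proj_norm H)//; exact: parseval_bessel.
by split=> //; [exact: proj_linear|exact: proj_linear|exact: proj_sym].
Qed.

Lemma coproj_bop n : bop 1 (coproj n) (coproj n).
Proof.
have le x : N (coproj n x) <= 1 * N x.
  by rewrite mul1r /coproj (proj_dist H)// gerBl; apply: sumr_ge0 => k _; exact: sqr_ge0.
have lin : linear (coproj n).
  move=> a x y; rewrite /coproj (proj_linear H) scalerBr opprD.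
  by rewrite addrACA.
by split=> // x y; rewrite /coproj !(ipE H) (proj_sym H).
Qed.

Lemma proj_basis n k : P n (p k) = if (k < n)%N then p k else 0.
Proof.
have [kn|nk] := ltnP k n.
  have po' := @po n.
  apply: (proj_id_le H (m := k.+1) kn po'); rewrite projS.
  rewrite (_ : proj q p k (p k) = 0); last first.
    rewrite /proj big_nat_cond big1// => j /andP[/andP[_ jk] _].
    by rewrite (po (n := k.+1))// ?ltnS 1?ltnW// gtn_eqF// scale0r.
  rewrite (po (n := k.+1))// eqxx add0r/=.
  by have [->|] := eqVneq (p k) 0; rewrite ?scaler0// scale1r.
rewrite /proj big_nat_cond big1// => j /andP[/andP[_ jn] _].
by rewrite (po (n := k.+1))// ?ltnS ?(leq_trans (ltnW jn))// gtn_eqF ?scale0r// (leq_trans jn).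
Qed.

Lemma basis_le1 k : N (p k) <= 1.
Proof. by rewrite (po (n := k.+1))// eqxx/=; case: (p k != 0). Qed.

(** The square of the Hilbert-Schmidt norm of the corner [(1 - P n) T (P n)] *)
Definition corner T n := \sum_(0 <= k < n) N (coproj n (T (p k))).

Lemma cornerE T n : corner T n = \sum_(0 <= k < n) N (T (p k)) -
  \sum_(0 <= k < n) \sum_(0 <= j < n) q (T (p k)) (p j) ^+ 2.
Proof. by rewrite -sumrB; apply: eq_bigr => k _; rewrite /coproj (proj_dist H). Qed.

(** The ranges of the [P n] are invariant under [T] up to an error bounded in
    Hilbert-Schmidt norm. *)
Definition bounded_corners T := exists M, forall n, hsb (coproj n \o T \o P n) M.

Lemma bounded_cornersP c T T' M : bop c T T' -> (forall n, corner T n <= M) ->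
  bounded_corners T.
Proof.
move=> bT TM; exists M => n.
have b := bop_comp (bop_comp (coproj_bop n) bT) (proj_bop n).
apply: (hsb_parseval H b pp) => m /=; apply: le_trans (TM n).
have z k : (n <= k)%N -> N (coproj n (T (P n (p k)))) = 0.
  move=> nk; rewrite proj_basis ltnNge nk/= (lin0 (bop_lin bT)).
  by rewrite (lin0 (bop_lin (coproj_bop n))) (ip0l H).
have e k : (k < n)%N -> N (coproj n (T (P n (p k)))) = N (coproj n (T (p k))).
  by move=> kn; rewrite proj_basis kn.
have [mn|nm] := leqP m n.
  rewrite /corner (big_cat_nat (leq0n m) mn)/=.
  rewrite (eq_big_nat _ _ (F2 := fun k => N (coproj n (T (p k))))); last first.
    by move=> k /andP[_ km]; rewrite e// (leq_trans km).
  by rewrite lerDl; apply: sumr_ge0 => k _; exact: ip_ge0.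
rewrite (big_cat_nat (leq0n n) (ltnW nm))/= [X in _ + X]big_nat_cond [X in _ + X]big1 ?addr0.
  by rewrite /corner le_eqVlt; apply/orP; left; apply/eqP; apply: eq_big_nat => k /andP[_ /e].
by move=> k /andP[/andP[nk _] _]; exact: z.
Qed.

Lemma corner_le T M n : hsb (coproj n \o T \o P n) M -> corner T n <= M.
Proof.
move=> TM; apply: le_trans (TM _ (parseval_bessel pp) n).
rewrite le_eqVlt; apply/orP; left; apply/eqP; apply: eq_big_nat => k /andP[_ kn] /=.
by rewrite proj_basis kn.
Qed.

(** [(1 - P) T U P = ((1 - P) T P) (U P) + ((1 - P) T) ((1 - P) U P)] *)
Lemma bounded_corners_comp c d T T' U U' : bop c T T' -> bop d U U' ->
  bounded_corners T -> bounded_corners U -> bounded_corners (T \o U).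
Proof.
move=> bT bU [M TM] [M' UM]; exists (2 * (d * 1 * M) + 2 * (1 * c * M')) => n.
rewrite (_ : _ \o _ = fun x => ((coproj n \o T \o P n) \o (U \o P n)) x +
    ((coproj n \o T) \o (coproj n \o U \o P n)) x).
  apply: (hsbD H).
    apply: (hsb_compr H (bop_comp bU (proj_bop n)) _ (TM n)).
    exact: bop_lin (bop_comp (bop_comp (coproj_bop n) bT) (proj_bop n)).
  exact: (hsb_compl (bop_comp (coproj_bop n) bT) (UM n)).
apply/funext => x /=.
rewrite -(linD (bop_lin (coproj_bop n))) -(linD (bop_lin bT)); congr (coproj n (T _)).
by rewrite /coproj addrC subrK.
Qed.

Lemma bounded_corners_iter c T T' n : bop c T T' -> bounded_corners T ->
  bounded_corners (iter n T).
Proof.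
move=> bT hT; elim: n => [|n ih]; last first.
  exact: (bounded_corners_comp bT (bop_iter n bT) hT ih).
exists 0 => n f _ m; rewrite big1// => k _ /=.
by rewrite /coproj (proj_proj H)// subrr (ip0l H).
Qed.

(** The corners of a Hilbert-Schmidt operator tend to zero: they are tails of
    the series for the norm of the adjoint. *)
Lemma hs_corner0 K : hs K -> corner K @ \oo --> (0 : R).
Proof.
move=> hK; have [K' [c [M [bK _ KM]]]] := hK.
have K'M := KM _ (parseval_bessel pp).
have mono := sum_ge0_nondecreasing (fun k => ip_ge0 H (K' (p k))).
have [s sK _] := nondecreasing_bounded_cvg mono K'M.
pose b n := \sum_(0 <= j < n) N (K' (p j)); rewrite -/b in sK.
have s_ub := nondecreasing_le_cvg mono sK.
have lim : (fun n => s - b n) @ \oo --> (0 : R).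
  by rewrite -(subrr s); apply: cvgB => //; exact: cvg_cst.
apply: cvg0_le lim => n.
have c0 : 0 <= corner K n by apply: sumr_ge0 => k _; exact: ip_ge0.
rewrite ger0_norm// cornerE.
have sw m : \sum_(0 <= k < n) \sum_(0 <= j < m) q (K (p k)) (p j) ^+ 2 =
    \sum_(0 <= j < m) \sum_(0 <= k < n) q (K' (p j)) (p k) ^+ 2.
  rewrite exchange_big/=; apply: eq_bigr => j _; apply: eq_bigr => k _.
  by rewrite (bop_adj bK) (ipC H).
rewrite lerBlDr; have := @cvg_bigsum R n _ _ (fun k => @pp (K (p k))).
move=> /cvg_le_ub; apply => m.
rewrite !sw; pose a j := \sum_(0 <= k < n) q (K' (p j)) (p k) ^+ 2.
rewrite -/(a _).
have a0 j : 0 <= a j by apply: sumr_ge0 => k _; exact: sqr_ge0.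
have ab j : a j <= N (K' (p j)) by exact: parseval_bessel.
have [mn|/ltnW nm] := leqP m n.
  rewrite [X in _ + X](big_cat_nat (leq0n m) mn)/=.
  have := s_ub n; rewrite -/(b n) => sb.
  have : 0 <= \sum_(m <= j < n) a j by apply: sumr_ge0.
  move: sb; lra.
rewrite (big_cat_nat (leq0n n) nm)/= addrC lerD2r.
rewrite lerBrDl; apply: le_trans (s_ub m); rewrite /b (big_cat_nat (leq0n n) nm)/=.
by rewrite lerD2l; apply: ler_sum => j _; exact: ab.
Qed.

(** The truncated trace of [[B, K]] only sees the corners of [B], which are
    bounded, against those of [K], which vanish in the limit. *)
Lemma trace_comm_hs0 c B B' K : bop c B B' -> bounded_corners B ->
  bounded_corners B' -> hs K -> has_trace q p (rcomm B K) 0.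
Proof.
move=> bB [M BM] [M' BM'] hK; have [K' [d [_ [bK _ _]]]] := hK.
have hK' := hs_adj H hK bK.
have k0 := cvg0D (hs_corner0 hK) (hs_corner0 hK').
have M0 := hsb_ge0 H (BM 0%N); have M'0 := hsb_ge0 H (BM' 0%N).
have split T U n k : q (T (p k)) (U (p k)) =
    q (P n (T (p k))) (U (p k)) + q (coproj n (T (p k))) (coproj n (U (p k))).
  rewrite (bop_adj (coproj_bop n)) /coproj (linB (proj_linear H p n)) (proj_proj H)//.
  by rewrite subrr subr0 (ipBr H) -(proj_sym H) addrC subrK.
have diff n : \sum_(0 <= k < n) q (rcomm B K (p k)) (p k) =
  \sum_(0 <= k < n) (q (coproj n (K (p k))) (coproj n (B' (p k))) -
                     q (coproj n (K' (p k))) (coproj n (B (p k)))).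
  have e k : q (rcomm B K (p k)) (p k) =
      q (K (p k)) (B' (p k)) - q (K' (p k)) (B (p k)).
    by rewrite /rcomm (ipBl H) (bop_adj bB) [X in _ - X](bop_adj bK) [X in _ - X](ipC H).
  under eq_bigr do rewrite e (split K B' n) (split K' B n) opprD addrACA.
  (* the compressions of two operators by [P n] commute under the trace *)
  rewrite big_split/= [X in X + _](_ : _ = 0) ?add0r//.
  rewrite sumrB; apply/eqP; rewrite subr_eq0; apply/eqP.
  under eq_bigr do rewrite (proj_ip H).
  under [RHS]eq_bigr do rewrite (proj_ip H).
  rewrite exchange_big/=; apply: eq_bigr => j _; apply: eq_bigr => k _.
  by rewrite (bop_adj bK) (ipC H (p k)) (ipC H (B' _)) -(bop_adj bB).
apply/cvgrPdist_le => e e0.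
pose t := e / (2 * (M + M' + 1)).
have MM : 0 < M + M' + 1 by lra.
have t0 : 0 < t by rewrite divr_gt0// mulr_gt0.
have te : 0 < t * (e / 2) by apply: mulr_gt0 => //; rewrite divr_gt0.
move/cvgrPdist_le: k0 => /(_ _ te).
apply: filterS => n; rewrite !sub0r !normrN => /(le_trans (ler_norm _)) kn.
rewrite diff; apply: le_trans (ler_norm_sum _ _ _) _.
have bnd k : `|q (coproj n (K (p k))) (coproj n (B' (p k))) -
               q (coproj n (K' (p k))) (coproj n (B (p k)))| <=
  (t^-1 * (N (coproj n (K (p k))) + N (coproj n (K' (p k))))) +
  t * (N (coproj n (B' (p k))) + N (coproj n (B (p k)))).
  apply: le_trans (ler_normB _ _) _.
  apply: le_trans (lerD (ip_amgm H _ _ t0) (ip_amgm H _ _ t0)) _.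
  by rewrite addrACA !mulrDr.
apply: le_trans (ler_sum _ (fun k _ => bnd k)) _.
rewrite big_split/= -!mulr_sumr !big_split/= -!/(corner _ n).
have h1 : t^-1 * (corner K n + corner K' n) <= e / 2.
  by rewrite mulrC ler_pdivrMr// mulrC.
have h2 : t * (corner B' n + corner B n) <= t * (M' + M).
  by rewrite ler_pM2l// lerD// corner_le.
have h3 : t * (M' + M) <= e / 2.
  have -> : e / 2 = t * (M + M' + 1) by rewrite /t; field; rewrite gt_eqF.
  by rewrite ler_pM2l//; lra.
by apply: le_trans (lerD h1 (le_trans h2 h3)) _; rewrite -splitr.
Qed.

(** * The Berger-Shaw estimate *)

Variables (S S' : V -> V) (c : R) (d : nat).
Hypothesis bS : bop c S S'.
Hypothesis hyponormal : forall x, N (S' x) <= N (S x).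
Hypothesis hessenberg : forall k, P (k + d).+1 (S (p k)) = S (p k).

(** Only the last [d] of the first [n] columns reach below row [n]. *)
Lemma corner_hessenberg n : corner S n <= c * d%:R.
Proof.
have c0 := bop_gt0 bS.
have z k : (k + d < n)%N -> N (coproj n (S (p k))) = 0.
  move=> kn; rewrite /coproj (proj_id_le H kn (@po n) (hessenberg k)).
  by rewrite subrr (ip0l H).
have b k : N (coproj n (S (p k))) <= c.
  apply: le_trans (bop_le (coproj_bop n) _) _; rewrite mul1r.
  by apply: le_trans (bop_le bS _) _; rewrite ler_piMr ?basis_le1// ltW.
rewrite /corner (big_cat_nat (leq0n (n - d)) (leq_subr d n))/=.
rewrite [X in X + _]big_nat_cond [X in X + _]big1 ?add0r; last first.
  by move=> k /andP[/andP[_ kn] _]; apply: z; rewrite addnC -ltn_subRL.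
apply: le_trans (ler_sum _ (fun k _ => b k)) _.
rewrite sumr_const_nat -[leLHS]mulr_natr ler_pM2l// ler_nat.
by rewrite leq_subLR addnC -leq_subLR.
Qed.

(** The matrices of [S] and of its adjoint have, up to transposition, the same
    upper left block, and the columns of [S] are the longer ones. *)
Lemma corner_adj_le n : corner S' n <= corner S n.
Proof.
rewrite !cornerE; apply: lerB; first by apply: ler_sum => k _; exact: hyponormal.
rewrite exchange_big/= le_eqVlt; apply/orP; left; apply/eqP.
apply: eq_bigr => j _; apply: eq_bigr => k _.
by rewrite (bop_adj bS) (ipC H).
Qed.

Lemma bounded_corners_S : bounded_corners S.
Proof. exact: bounded_cornersP bS corner_hessenberg. Qed.

Lemma bounded_corners_S' : bounded_corners S'.
Proof.
apply: (bounded_cornersP (bopC H bS)) => n.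
exact: le_trans (corner_adj_le n) (corner_hessenberg n).
Qed.

(** The self-commutator is positive, and the first [n] terms of its trace add
    up to the difference of the [n]-th corners of [S] and of its adjoint. *)
Lemma berger_shaw : tc (rcomm S' S).
Proof.
have bD : bop (2 * (c * c) + 2 * (c * c)) (rcomm S' S) (rcomm S' S).
  exact: (bopD H (bop_comp (bopC H bS) bS) (bopN H (bop_comp bS (bopC H bS)))).
have DE x : q (rcomm S' S x) x = N (S x) - N (S' x).
  by rewrite /rcomm (ipBl H) (bop_adj bS) (bop_adj (bopC H bS)).
have [h [r [_ hh ->]]] : exists h d, [/\ bop d h h, hs h & rcomm S' S = h \o h].
  apply: (tc_psd H (M := c * d%:R) bD _ pp) => [x|n]; first by rewrite DE subr_ge0.
  under eq_bigr do rewrite DE.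
  apply: le_trans (corner_hessenberg n).
  have cS' : 0 <= corner S' n by apply: sumr_ge0 => k _; exact: ip_ge0.
  have e : \sum_(0 <= k < n) \sum_(0 <= j < n) q (S' (p k)) (p j) ^+ 2 =
      \sum_(0 <= k < n) \sum_(0 <= j < n) q (S (p k)) (p j) ^+ 2.
    rewrite exchange_big/=; apply: eq_bigr => j _; apply: eq_bigr => k _.
    by rewrite (bop_adj bS) (ipC H).
  by move: cS'; rewrite !cornerE e sumrB; lra.
exact: tc_mul.
Qed.

(** * Invariance of the trace form under Hilbert-Schmidt perturbations *)

Variables (T T' : V -> V) (c' : R).
Hypothesis bT : bop c' T T'.
Hypothesis hsTS : hs (fun x => T x - S x).
Hypothesis tcT : tc (rcomm T' T).

Lemma hs_iterB A A' B B' a b n : bop a A A' -> bop b B B' ->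
  hs (fun x => A x - B x) -> hs (fun x => iter n.+1 A x - iter n.+1 B x).
Proof.
move=> bA bB hAB; elim: n => [//|n ih].
rewrite (_ : (fun x => _) = fun x => (A \o (fun x => iter n.+1 A x - iter n.+1 B x)) x +
    ((fun x => A x - B x) \o iter n.+1 B) x).
  exact: (hsD H (hs_compl H bA ih) (hs_compr H (bop_iter n.+1 bB) hAB)).
by apply/funext => x; rewrite [in RHS]/= (linB (bop_lin bA)) subrKA.
Qed.

Lemma tc_rcomm_hyponormal k l : tc (rcomm (iter k.+1 S') (iter l.+1 S)).
Proof. exact: tc_rcomm_iter (bopC H bS) bS berger_shaw. Qed.

Lemma tc_rcomm_perturbed k l : tc (rcomm (iter k.+1 T') (iter l.+1 T)).
Proof. exact: tc_rcomm_iter (bopC H bT) bT tcT. Qed.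

(** Write [T'^(k+1) = B + K2] and [T^(l+1) = B' + K1] with [B = S'^(k+1)] and
    [B' = S^(l+1)]. The difference of the two commutators is
    [[B, K1] + [K2, B'] + [K2, K1]]; the truncated traces of the first two
    tend to zero, and the trace of the third vanishes. The operator [J] is here
    to reach the imaginary part of a complex trace. *)
Lemma trace_comm_invariant J J' cJ k l f : bop cJ J J' -> parseval q f ->
  (forall x, J (S x) = S (J x)) -> (forall x, J (S' x) = S' (J x)) ->
  (forall x, J (T x) = T (J x)) -> (forall x, J (T' x) = T' (J x)) ->
  has_trace q f (fun x => J (rcomm (iter k.+1 T') (iter l.+1 T) x -
                             rcomm (iter k.+1 S') (iter l.+1 S) x)) 0.
Proof.
move=> bJ pf JS JS' JT JT'.
have Jiter A n x : (forall x, J (A x) = A (J x)) -> J (iter n A x) = iter n A (J x).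
  by move=> JA; elim: n => //= n ih; rewrite JA ih.
set B := iter k.+1 S'; set B' := iter l.+1 S.
have bB : bop (c ^+ k.+1) B (iter k.+1 S) by exact: bop_iter (bopC H bS).
have bB' : bop (c ^+ l.+1) B' (iter l.+1 S') by exact: bop_iter.
have hsT'S' : hs (fun x => T' x - S' x).
  exact: (hs_adj H hsTS (bopD H bT (bopN H bS))).
pose K2 x := iter k.+1 T' x - B x; pose K1 x := iter l.+1 T x - B' x.
have hK1 : hs K1 by exact: (hs_iterB l bT bS).
have hK2 : hs K2 by exact: (hs_iterB k (bopC H bT) (bopC H bS)).
have hJK1 := hs_compl H bJ hK1; have hJK2 := hs_compl H bJ hK2.
have cS n : bounded_corners (iter n S) by exact: bounded_corners_iter bS bounded_corners_S.
have cS' n : bounded_corners (iter n S').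
  exact: bounded_corners_iter (bopC H bS) bounded_corners_S'.
have t1 := trace_comm_hs0 bB (cS' _) (cS _) hJK1.
have t2 := trace_comm_hs0 bB' (cS _) (cS' _) hJK2.
have [t [t3 t4]] := hs_trace H hJK2 hK1 pp pp.
have lJ := bop_lin bJ.
have E : (fun x => J (rcomm (iter k.+1 T') (iter l.+1 T) x - rcomm B B' x)) =
  fun x => (rcomm B (J \o K1) x - rcomm B' (J \o K2) x) +
           (((J \o K2) \o K1) x - (K1 \o (J \o K2)) x).
  apply/funext => x; rewrite /rcomm /comp.
  have T2 y : iter k.+1 T' y = B y + K2 y by rewrite /K2 addrC subrK.
  have T1 y : iter l.+1 T y = B' y + K1 y by rewrite /K1 addrC subrK.
  have JB y : J (B y) = B (J y) by exact: Jiter.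
  have JB' y : J (B' y) = B' (J y) by exact: Jiter.
  have JK1 y : J (K1 y) = K1 (J y).
    by rewrite /K1 (linB lJ) JB'; congr (_ - _); exact: Jiter.
  have JK2 y : J (K2 y) = K2 (J y).
    by rewrite /K2 (linB lJ) JB; congr (_ - _); exact: Jiter.
  have [T2' [T2c [_ [bK2 _ _]]]] := hK2; have [T1' [T1c [_ [bK1 _ _]]]] := hK1.
  clearbody K1 K2.
  rewrite T1 T2 T2 T1 !(linD (bop_lin bB)) !(linD (bop_lin bB')).
  rewrite !(linD (bop_lin bK2)) !(linD (bop_lin bK1)) -!JK1 -JB -JB' -!(linB lJ) -(linD lJ).
  congr (J _); apply: (ipxx_eq H) => z; rewrite !(ipE H); ring.
have tcX : tc (fun x => rcomm (iter k.+1 T') (iter l.+1 T) x - rcomm B B' x).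
  exact: (tcB H (tc_rcomm_perturbed k l) (tc_rcomm_hyponormal k l)).
have [s [s1 s2]] := tc_trace_indep H (tc_compl H bJ tcX) pf pp.
have p0 : has_trace q p (fun x => J (rcomm (iter k.+1 T') (iter l.+1 T) x - rcomm B B' x))
    ((0 - 0) + (t - t)).
  by rewrite E; apply: (has_traceD H); [exact: has_traceB|exact: has_traceB].
rewrite !subrr addr0 in p0.
by have <- : s = 0 by exact: has_trace_uniq s2 p0.
Qed.
End commutators.

(** * The real Hilbert space underlying a complex one *)

(** A copy of the type, to give it scalars in [R] *)
Definition realification (R : realType) (V : lmodType R[i]) : Type := V.

Section realification.
Context {R : realType} (V : lmodType R[i]).
HB.instance Definition _ := GRing.Zmodule.copy (realification V) V.

Definition real_scale (a : R) (x : realification V) : realification V := (a%:C)%C *: (x : V).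

Fact real_scaleA a b x : real_scale a (real_scale b x) = real_scale (a * b) x.
Proof. by rewrite /real_scale scalerA rmorphM. Qed.
Fact real_scale1 : left_id 1 real_scale.
Proof. by move=> x; rewrite /real_scale rmorph1 scale1r. Qed.
Fact real_scaleDr : right_distributive real_scale +%R.
Proof. by move=> a x y; rewrite /real_scale scalerDr. Qed.
Fact real_scaleDl x : {morph real_scale^~ x : a b / a + b}.
Proof. by move=> a b; rewrite /real_scale rmorphD scalerDl. Qed.

HB.instance Definition _ := GRing.Zmodule_isLmodule.Build R (realification V)
  real_scaleA real_scale1 real_scaleDr real_scaleDl.
End realification.

Section complex_hilbert.
Context {R : realType} {V : lmodType R[i]} (ip : V -> V -> R[i]).
Local Notation VR := (realification V).

Definition reip (x y : VR) : R := complex.Re (ip x y).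
Local Notation q := reip.
Local Notation N x := (q x x).

Record complex_hilbert : Prop := ComplexHilbert {
  cip_linear : forall a x y z, ip (a *: x + y) z = a * ip x z + ip y z ;
  cipC : forall x y, ip y x = (ip x y)^*%C ;
  cip_ge0 : forall x, 0 <= complex.Re (ip x x) ;
  cip_eq0 : forall x, complex.Re (ip x x) = 0 -> x = 0 ;
  cip_complete : forall u : nat -> VR, ncauchy q u -> exists l, ncvg q u l }.

Hypothesis CH : complex_hilbert.

Lemma cipZl a x z : ip (a *: x) z = a * ip x z.
Proof.
have z0 : ip 0 z = 0.
  have := cip_linear CH 1 0 0 z; rewrite scale1r addr0 mul1r => /eqP.
  by rewrite -subr_eq0 opprD addrA subrr sub0r oppr_eq0 => /eqP.
by rewrite -{1}(addr0 (a *: x)) cip_linear// z0 addr0.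
Qed.

Lemma cipDl x y z : ip (x + y) z = ip x z + ip y z.
Proof. by rewrite -{1}(scale1r x) cip_linear// mul1r. Qed.

Lemma realHilbert : real_hilbert q.
Proof.
split.
- by move=> x y z; rewrite /q cipDl; case: (ip x z) (ip y z) => a b [].
- move=> a x z; rewrite /q cipZl; case: (ip x z) => u v /=.
  by rewrite mul0r subr0.
- by move=> x y; rewrite /q (cipC CH y x); case: (ip _ _).
- exact: cip_ge0.
- exact: cip_eq0.
- exact: cip_complete.
Qed.

Local Notation H := realHilbert.

Definition mul_i (x : VR) : VR := ('i%C : R[i]) *: (x : V).

Lemma ipE_reip x y : ip x y = (q x y +i* q x (mul_i y))%C.
Proof.
rewrite /q /mul_i (cipC CH (_ *: _) x) cipZl (cipC CH x y).
by case: (ip x y) => a b /=; congr (_ +i* _)%C; ring.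
Qed.

Lemma mul_iK x : mul_i (mul_i x) = - x.
Proof. by rewrite /mul_i scalerA -expr2 complex.sqr_i scaleN1r. Qed.

Lemma mul_i_linear : linear mul_i.
Proof.
move=> a x y; rewrite /mul_i scalerDr; congr (_ + _).
by rewrite [LHS]scalerA [RHS]scalerA mulrC.
Qed.

Lemma reip_mul_i x y : q (mul_i x) y = - q x (mul_i y).
Proof.
have := ipE_reip (mul_i x) y; rewrite {1}/mul_i cipZl ipE_reip => -[h _].
by rewrite -h; ring.
Qed.

Lemma mul_i_bop : bop q 1 mul_i (fun x => - mul_i x).
Proof.
have e x : N (mul_i x) = N x by rewrite reip_mul_i mul_iK (ipNr H) opprK.
split=> //; first exact: mul_i_linear.
- by move=> a x y; rewrite mul_i_linear opprD scalerN.
- by move=> x y; rewrite reip_mul_i (ipNr H).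
- by move=> x; rewrite e mul1r.
- by move=> x; rewrite (normN2 H) e mul1r.
Qed.

Lemma real_linear (T : V -> V) : linear T -> linear (T : VR -> VR).
Proof. by move=> lT a x y; exact: lT. Qed.

Lemma scale_mul_i (a : R[i]) (x : V) :
  a *: x = (complex.Re a *: (x : VR)) + complex.Im a *: mul_i x :> VR.
Proof.
case: a => a b /=.
have -> : (a +i* b)%C = (a%:C + b%:C * 'i)%C.
  by apply/eqP; rewrite eq_complex/=; apply/andP; split; apply/eqP; ring.
by rewrite scalerDl -scalerA.
Qed.

Lemma complex_linear (T : VR -> VR) : linear T -> (forall x, T (mul_i x) = mul_i (T x)) ->
  linear (T : V -> V).
Proof.
move=> lT TJ a x y.
rewrite scale_mul_i (scale_mul_i a (T x)).
have := linD lT (complex.Re a *: (x : VR) + complex.Im a *: mul_i x) y => ->.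
by rewrite (linD lT) !(linZ lT) TJ.
Qed.

Lemma linear_mul_i (T : V -> V) : linear T -> forall x, T (mul_i x) = mul_i (T x).
Proof. by move=> lT x; rewrite /mul_i; exact: (linZ lT). Qed.
End complex_hilbert.

(** * Operators on a complex Hilbert space *)

Section series_bounds.
Context {R : realType}.

Lemma nneseries_bounded (a : nat -> R) : (forall k, 0 <= a k) ->
  (\sum_(0 <= k <oo) (a k)%:E < +oo)%E ->
  exists M, forall n, \sum_(0 <= k < n) a k <= M.
Proof.
move=> a0 fin; set s := (\sum_(0 <= k <oo) _)%E in fin.
have sf : s \is a fin_num.
  by rewrite ge0_fin_numE// nneseries_ge0// => k _ _; rewrite lee_fin.
exists (fine s) => n; rewrite -lee_fin fineK// -sumEFin.
by apply: nneseries_lim_ge => k _ _; rewrite lee_fin.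
Qed.

Lemma bounded_nneseries (a : nat -> R) M : (forall k, 0 <= a k) ->
  (forall n, \sum_(0 <= k < n) a k <= M) ->
  (\sum_(0 <= k <oo) (a k)%:E < +oo)%E.
Proof.
move=> a0 aM; apply: (@le_lt_trans _ _ M%:E); last exact: ltry.
apply: lime_le; first by apply: is_cvg_nneseries => k _ _; rewrite lee_fin.
by apply: nearW => n; rewrite sumEFin lee_fin.
Qed.

Lemma big_double (F : nat -> R) n :
  \sum_(0 <= k < n.*2) F k = \sum_(0 <= k < n) (F k.*2 + F k.*2.+1).
Proof.
elim: n => [|n ih]; first by rewrite !big_geq.
by rewrite doubleS !big_nat_recr//= ih addrA.
Qed.

Lemma complex_cvg0 (u : nat -> R[i]^o) :
  (fun n => complex.Re (u n)) @ \oo --> (0 : R) ->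
  (fun n => complex.Im (u n)) @ \oo --> (0 : R) ->
  u @ \oo --> (0 : R[i]^o).
Proof.
move=> ur ui; apply/cvgrPdist_le => e e0.
have e1 : e = ((complex.Re e)%:C)%C.
  by move: e0; case: e => a b; rewrite ltcE/= => /andP[/eqP-> _].
have e2 : 0 < complex.Re e by move: e0; rewrite ltcE/= => /andP[_].
have e3 : 0 < complex.Re e / 2 by rewrite divr_gt0.
move/cvgrPdist_le: ur => /(_ _ e3); move/cvgrPdist_le: ui => /(_ _ e3).
apply: filterS2 => n /=; rewrite !sub0r !normrN => hi hr.
rewrite e1 normc_def lecR.
move: hr hi; case: (u n) => a b /= hr hi.
set r := complex.Re e in e2 hr hi *.
have r0 : 0 <= r by exact: ltW.
have -> : r = Num.sqrt (r ^+ 2) by rewrite sqrtr_sqr ger0_norm.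
rewrite ler_wsqrtr// -(real_normK (num_real a)) -(real_normK (num_real b)).
have := normr_ge0 a; have := normr_ge0 b; nra.
Qed.
End series_bounds.

Section complex_operators.
Context {R : realType} {V : lmodType R[i]} (ip : V -> V -> R[i]).
Local Notation VR := (realification V).
Local Notation q := (reip ip : VR -> VR -> R).
Local Notation N x := (q x x).
Hypothesis CH : complex_hilbert ip.
Local Notation H := (realHilbert CH).
Local Notation mul_i := (@mul_i R V).
Implicit Types (T S A : V -> V).

Lemma hnormE (x : V) : hnorm ip x = qnorm q x. Proof. by []. Qed.

Lemma bounded_opP T : bounded_op ip T <->
  linear T /\ exists c T', bop q c (T : VR -> VR) T'.
Proof.
split=> [[lT [M TM]]|[lT [c [T' bT]]]].
  split=> //; exists (M ^+ 2 + 1).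
  apply: (exists_adjoint H (real_linear lT)); first by have := sqr_ge0 M; lra.
  move=> x; have := TM x; rewrite !hnormE => h.
  have h0 := qnorm_ge0 q (T x); have := qnorm_sqr H (T x); have := qnorm_sqr H x => <- <-.
  have := qnorm_ge0 q x; nra.
split=> //; exists (Num.sqrt c) => x; rewrite !hnormE.
rewrite (qnorm_le H) ?mulr_ge0 ?sqrtr_ge0 ?qnorm_ge0//.
by rewrite exprMn sqr_sqrtr ?(ltW (bop_gt0 bT))// (qnorm_sqr H); exact: bop_le bT _.
Qed.

Lemma bop_mul_i c (T : V -> V) (T' : VR -> VR) : linear T -> bop q c (T : VR -> VR) T' ->
  forall x, T' (mul_i x) = mul_i (T' x).
Proof.
move=> lT bT x; apply: (ipxx_eq H) => y.
rewrite -(bop_adj bT) -[RHS]opprK -(reip_mul_i CH) -(bop_adj bT) linear_mul_i//.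
by rewrite (reip_mul_i CH) opprK.
Qed.

(** [adjoint] is defined by a choice; the Riesz theorem supplies a candidate. *)
Lemma adjointP T : bounded_op ip T -> exists c,
  bop q c (T : VR -> VR) (adjoint ip T) /\ linear (adjoint ip T).
Proof.
move=> /bounded_opP[lT [c [T' bT]]].
have T'J := bop_mul_i lT bT.
have T'P : [set A | forall x y, ip (T x) y = ip x (A y)] T'.
  move=> x y; rewrite !(ipE_reip CH); congr (_ +i* _)%C; first exact: bop_adj bT _ _.
  by rewrite -T'J; exact: bop_adj bT _ _.
have := @xgetPex _ (fun=> 0) [set A | forall x y, ip (T x) y = ip x (A y)] (ex_intro _ _ T'P).
rewrite -/(adjoint ip T) /= => AP.
have AT' : adjoint ip T = T'.
  apply/funext => y; apply: (ipxx_eq H) => x; rewrite -(bop_adj bT) /reip.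
  by rewrite AP.
exists c; rewrite AT'; split=> //; apply: complex_linear => //; exact: bop_lin' bT.
Qed.

Lemma bounded_adjoint T : bounded_op ip T -> bounded_op ip (adjoint ip T).
Proof.
move=> /adjointP[c [bT lT]]; apply/bounded_opP; split=> //.
by exists c, T; exact: (bopC H).
Qed.

(** Over the complex numbers a positive operator is self-adjoint: the imaginary
    part of [ip (A z) z] vanishes for [z = x + i y]. *)
Lemma positive_opP A : positive_op ip A <->
  [/\ linear A, exists c, bop q c (A : VR -> VR) A & forall x, 0 <= q (A x) x].
Proof.
split=> [[bA A0]|[lA [c bA] A0]].
  have [c [b lA']] := adjointP bA.
  have lA := bA.1.
  have A0' x : 0 <= q (A x) x /\ q (A x) (mul_i x) = 0.
    by have := A0 x; rewrite (ipE_reip CH) lecE/= => /andP[/eqP-> ->].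
  split=> //; last by move=> x; have [] := A0' x.
  exists c; suff e : adjoint ip A = A by rewrite -{2}e.
  apply/funext => y; apply: (ipxx_eq H) => x; rewrite -(bop_adj b).
  have [_] := A0' ((x : VR) + mul_i y).
  have -> : A ((x : VR) + mul_i y) = (A x : VR) + mul_i (A y).
    by rewrite -linear_mul_i//; exact: (linD (real_linear lA)).
  rewrite (linD (@mul_i_linear _ _)) (mul_iK y) !(ipE H) !(reip_mul_i CH) (mul_iK x).
  have [_ ->] := A0' x; have [_ ->] := A0' y.
  by rewrite (ipNr H) opprK (ipC H x); lra.
split; first by apply/bounded_opP; split=> //; exists c, A.
move=> x; rewrite (ipE_reip CH) lecE/= A0 andbT; apply/eqP.
have : q (A x) (mul_i x) = - q (A x) (mul_i x).
  rewrite {1}(bop_adj bA) (linear_mul_i lA).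
  by rewrite -[LHS]opprK -(reip_mul_i CH x (A x)) (ipC H).
lra.
Qed.

Lemma bounded_op_comp A T : bounded_op ip A -> bounded_op ip T -> bounded_op ip (A \o T).
Proof.
move=> /bounded_opP[lA [c [A' bA]]] /bounded_opP[lT [d [T' bT]]].
apply/bounded_opP; split; first by move=> a x y /=; rewrite lT lA.
by exists (c * d), (T' \o A'); exact: bop_comp bA bT.
Qed.

Lemma bounded_opB A T : bounded_op ip A -> bounded_op ip T -> bounded_op ip (A \- T).
Proof.
move=> /bounded_opP[lA [c [A' bA]]] /bounded_opP[lT [d [T' bT]]].
apply/bounded_opP; split.
  by move=> a x y /=; rewrite lT lA scalerBr opprD addrACA.
by exists (2 * c + 2 * d), (fun x => A' x - T' x); exact: (bopD H bA (bopN H bT)).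
Qed.

Lemma bounded_op_iter T n : bounded_op ip T -> bounded_op ip (iter n.+1 T).
Proof. by move=> bT; elim: n => [//|n ih]; exact: (bounded_op_comp bT ih). Qed.

Lemma bounded_comm A T : bounded_op ip A -> bounded_op ip T -> bounded_op ip (comm A T).
Proof. by move=> bA bT; apply: bounded_opB; exact: bounded_op_comp. Qed.

(** Likewise [opabs] is defined by a choice, for which [psd_sqrt] supplies a
    candidate. *)
Lemma opabsP T : bounded_op ip T ->
  positive_op ip (opabs ip T) /\ opabs ip T \o opabs ip T = adjoint ip T \o T.
Proof.
move=> bT; have [c [b lT']] := adjointP bT; have lT := bT.1.
have bA := bop_comp (bopC H b) b.
have A0 (x : VR) : 0 <= q ((adjoint ip T \o T) x) x.
  by rewrite /= (bop_adj (bopC H b)); exact: (ip_ge0 H).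
have [h [d [bh h0 hh hJ]]] := psd_sqrt H bA A0.
have hP : positive_op ip h /\ h \o h = adjoint ip T \o T.
  split; last by apply/funext => x /=; rewrite hh.
  apply/positive_opP; split=> //; last by exists d.
  apply: complex_linear; first exact: bop_lin bh.
  move=> x; apply/esym; apply: (hJ mul_i 1); first exact: mul_i_linear.
    exact: bop_le (mul_i_bop CH).
  by move=> y /=; rewrite !linear_mul_i.
exact: (@xgetPex _ (fun=> 0) [set A | positive_op ip A /\ A \o A = adjoint ip T \o T]
  (ex_intro _ _ hP)).
Qed.
End complex_operators.

Section cvg_normed.
Context {K : numFieldType} {W : normedModType K}.
Implicit Types s t : nat -> W.

Lemma cvg_of_sub0 s t (l : W) : (fun n => s n - t n) @ \oo --> (0 : W) ->
  t @ \oo --> l -> s @ \oo --> l.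
Proof.
move=> st0 tl; rewrite (_ : s = (fun n => (s n - t n) + t n)).
  by rewrite -[l]add0r; exact: cvgD.
by apply/funext => n; rewrite subrK.
Qed.

Lemma cvg0_swap s t : (fun n => s n - t n) @ \oo --> (0 : W) ->
  (fun n => t n - s n) @ \oo --> (0 : W).
Proof.
move=> st0; rewrite (_ : (fun n => _) = (fun n => - (s n - t n))).
  by rewrite -oppr0; exact: cvgN.
by apply/funext => n; rewrite opprB.
Qed.
End cvg_normed.

Section complex_trace.
Context {R : realType} {V : lmodType R[i]} (ip : V -> V -> R[i]).
Local Notation VR := (realification V).
Local Notation q := (reip ip : VR -> VR -> R).
Local Notation N x := (q x x).
Hypothesis CH : complex_hilbert ip.
Local Notation H := (realHilbert CH).
Local Notation mul_i := (@mul_i R V).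
Implicit Types (T S A : V -> V) (e : nat -> V).

(** If [e] is a complex orthonormal basis then this is a real one. *)
Definition real_family e (n : nat) : VR := if odd n then mul_i (e n./2) else e n./2.

Lemma real_family_even e n : real_family e n.*2 = e n.
Proof. by rewrite /real_family odd_double doubleK. Qed.

Lemma real_family_odd e n : real_family e n.*2.+1 = mul_i (e n).
Proof. by rewrite /real_family /= odd_double uphalf_double. Qed.

Lemma real_family_total e : (forall x, (forall k, ip x (e k) = 0) -> x = 0) ->
  forall x : VR, (forall k, q x (real_family e k) = 0) -> x = 0.
Proof.
move=> et x x0; apply: et => k; rewrite (ipE_reip CH).
have := x0 k.*2; rewrite real_family_even => ->.
by have := x0 k.*2.+1; rewrite real_family_odd => ->.
Qed.

Lemma onb_parseval e : orthonormal_basis ip e -> parseval q (real_family e).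
Proof.
move=> [eo et]; apply: (ortho_total_parseval H); last exact: real_family_total.
have qe m n : q (e m) (e n) = (m == n)%:R /\ q (e m) (mul_i (e n)) = 0.
  have := eo m n; rewrite (ipE_reip CH) => h; split.
    by have := congr1 (@complex.Re R) h; case: (m == n).
  by have := congr1 (@complex.Im R) h; case: (m == n).
have qJ x y : q (mul_i x) (mul_i y) = q x y by rewrite (reip_mul_i CH) mul_iK (ipNr H) opprK.
have qJe m n : q (mul_i (e m)) (e n) = 0 by rewrite (ipC H); have [] := qe n m.
have rr j k : q (real_family e j) (real_family e k) = (j == k)%:R.
  have -> : (j == k) = (odd j == odd k) && (j./2 == k./2).
    apply/eqP/andP => [->//|[/eqP oj /eqP hj]].
    by rewrite -(odd_double_half j) oj hj odd_double_half.
  rewrite /real_family; case: (odd j); case: (odd k) => /=.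
  - by rewrite qJ (qe _ _).1.
  - by rewrite qJe.
  - by rewrite (qe _ _).2.
  - by rewrite (qe _ _).1.
move=> n j k _ _; rewrite rr; case: eqP => // _; rewrite /=.
case: eqVneq => //= j0; have := rr j j; rewrite j0 (ip0l H) eqxx => /eqP.
by rewrite eq_sym oner_eq0.
Qed.

Lemma real_family_bounded e (F : V -> R) : (forall x, 0 <= F x) ->
  (forall x, F (mul_i x) = F x) ->
  (\sum_(0 <= k <oo) (F (e k))%:E < +oo)%E <->
  exists M, forall n, \sum_(0 <= k < n) F (real_family e k) <= M.
Proof.
move=> F0 FJ.
have dbl n : \sum_(0 <= k < n.*2) F (real_family e k) =
    2 * \sum_(0 <= k < n) F (e k).
  rewrite big_double mulr_sumr; apply: eq_bigr => k _.
  by rewrite real_family_even real_family_odd FJ; ring.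
split=> [/nneseries_bounded[//|M eM]|[M eM]].
  exists (2 * M) => n.
  apply: (@le_trans _ _ (\sum_(0 <= k < n.*2) F (real_family e k))).
    rewrite (big_cat_nat (leq0n n) (_ : n <= n.*2)%N)/=; last by rewrite -addnn leq_addr.
    by rewrite lerDl; apply: sumr_ge0.
  by rewrite dbl ler_pM2l.
apply: (bounded_nneseries (M := M)) => // n.
have := eM n.*2; rewrite dbl => h.
have : 0 <= \sum_(0 <= k < n) F (e k) by apply: sumr_ge0.
lra.
Qed.

Lemma reip_op_mul_i A : linear A -> forall x, q (A (mul_i x)) (mul_i x) = q (A x) x.
Proof. by move=> lA x; rewrite linear_mul_i// (reip_mul_i CH) mul_iK (ipNr H) opprK. Qed.

(** The definition of a finite trace involves all orthonormal bases; one of them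
    suffices to conclude. *)
Lemma finite_trace_tc T e : bounded_op ip T -> finite_trace ip (opabs ip T) ->
  orthonormal_basis ip e -> tc q (T : VR -> VR).
Proof.
move=> bT fT eo; have [c [b _]] := adjointP CH bT.
have [/(positive_opP CH)[lA [d bA] A0] AA] := opabsP CH bT.
have AF (x : V) : 0 <= complex.Re (ip (opabs ip T x) x) by exact: A0.
have [M hM] := (real_family_bounded e AF (reip_op_mul_i lA)).1 (fT _ eo).
apply: (tc_of_abs H b bA A0 _ (onb_parseval eo) hM) => x.
exact: (congr1 (fun f => f x) AA).
Qed.

Lemma tc_finite_trace T e : bounded_op ip T -> tc q (T : VR -> VR) ->
  orthonormal_basis ip e ->
  (\sum_(0 <= n <oo) (complex.Re (ip (opabs ip T (e n)) (e n)))%:E < +oo)%E.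
Proof.
move=> bT hT eo; have [c [b _]] := adjointP CH bT.
have [/(positive_opP CH)[lA [d bA] A0] AA] := opabsP CH bT.
have hA : tc q (opabs ip T : VR -> VR).
  by apply: (tc_abs H b bA _ hT) => x; exact: (congr1 (fun f => f x) AA).
have pe := onb_parseval eo.
have [t [tP _]] := tc_trace_indep H hA pe pe.
apply/(real_family_bounded e A0 (reip_op_mul_i lA)); exists t.
apply: (nondecreasing_le_cvg _ tP).
by apply: sum_ge0_nondecreasing => k; exact: A0.
Qed.

Lemma hilbert_schmidt_hs T e : hilbert_schmidt ip T -> orthonormal_basis ip e ->
  hs q (T : VR -> VR).
Proof.
move=> [bT fT] eo; have [c [b _]] := adjointP CH bT.
have F0 (x : V) : 0 <= hnorm ip (T x) ^+ 2 by exact: sqr_ge0.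
have FJ x : hnorm ip (T (mul_i x)) ^+ 2 = hnorm ip (T x) ^+ 2.
  rewrite !(qnorm_sqr H) linear_mul_i; first by rewrite (reip_mul_i CH) mul_iK (ipNr H) opprK.
  exact: bT.1.
have [M hM] := (real_family_bounded e F0 FJ).1 (fT _ eo).
apply: (hs_parseval H b (onb_parseval eo) (M := M)) => n.
by have := hM n; under eq_bigr do rewrite (qnorm_sqr H).
Qed.

Lemma real_family_trace0 e (Z : VR -> VR) : (forall x, Z (mul_i x) = mul_i (Z x)) ->
  has_trace q (real_family e) Z 0 ->
  (fun n => \sum_(0 <= k < n) q (Z (e k)) (e k)) @ \oo --> (0 : R).
Proof.
move=> ZJ tZ; apply/cvgrPdist_le => eps e0.
have e2 : 0 < 2 * eps by rewrite mulr_gt0.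
have /cvgrPdist_le/(_ _ e2)[m _ hm] := tZ.
exists m => // n mn; rewrite sub0r normrN.
have := hm n.*2 (leq_trans mn _); rewrite -addnn leq_addr addnn => /(_ isT).
rewrite /= sub0r normrN big_double.
rewrite (eq_bigr (fun k => 2 * q (Z (e k)) (e k))) => [|k _].
  by rewrite -mulr_sumr normrM ger0_norm// ler_pM2l.
rewrite real_family_even real_family_odd ZJ (reip_mul_i CH) mul_iK (ipNr H) opprK.
by ring.
Qed.

(** [Tr] is a choice among the common limits of the series over all bases. The
    candidates for [A] and for [B] are the same if the two series differ by a null
    sequence. *)
Lemma Tr_eq A B : (forall x, A (mul_i x) = mul_i (A x)) -> (forall x, B (mul_i x) = mul_i (B x)) ->
  (forall e, orthonormal_basis ip e ->
    has_trace q (real_family e) (fun x => (B x : VR) - A x) 0 /\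
    has_trace q (real_family e) (fun x => mul_i ((B x : VR) - A x)) 0) ->
  Tr ip A = Tr ip B.
Proof.
move=> AJ BJ AB.
have diff e : orthonormal_basis ip e ->
    (fun n => series (fun n => ip (B (e n)) (e n) : R[i]^o) n -
              series (fun n => ip (A (e n)) (e n) : R[i]^o) n) @ \oo --> (0 : R[i]^o).
  move=> eo; have [t1 t2] := AB _ eo.
  have ZJ (x : VR) : ((B (mul_i x) : VR) - A (mul_i x)) = mul_i ((B x : VR) - A x).
    by rewrite AJ BJ (linB (@mul_i_linear _ _)).
  have s1 := real_family_trace0 ZJ t1.
  have s2 : (fun n => \sum_(0 <= k < n) q (mul_i ((B (e k) : VR) - A (e k))) (e k)) @ \oo --> (0 : R).
    by apply: real_family_trace0 t2 => x; rewrite ZJ.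
  have E n : series (fun n => ip (B (e n)) (e n) : R[i]^o) n -
      series (fun n => ip (A (e n)) (e n) : R[i]^o) n =
      ((\sum_(0 <= k < n) q ((B (e k) : VR) - A (e k)) (e k))
       +i* (- \sum_(0 <= k < n) q (mul_i ((B (e k) : VR) - A (e k))) (e k)))%C.
    rewrite /series /= -sumrB; elim: n => [|n ih]; first by rewrite !big_geq//= oppr0.
    rewrite !big_nat_recr//= ih !(ipE_reip CH).
    rewrite [X in (_ +i* - (_ + X))%C](reip_mul_i CH) !(ipBl H).
    by apply/eqP; rewrite eq_complex/=; apply/andP; split; apply/eqP; ring.
  under eq_fun do rewrite E.
  apply: complex_cvg0 => //=.
  by rewrite -[X in _ --> X]oppr0; exact: cvgN.
congr (xget _ _); apply/seteqP; split=> t At e eo.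
  exact: cvg_of_sub0 (diff e eo) (At e eo).
have d0 := cvg0_swap (diff e eo).
exact: cvg_of_sub0 d0 (At e eo).
Qed.

(** * The invariance theorem in a complex Hilbert space *)

Variables (S T : V -> V) (u : V).
Hypothesis bS : bounded_op ip S.
Hypothesis hyponormal : forall x, N (adjoint ip S x) <= N (S x).
Hypothesis cyclic : forall x, (forall k, ip x (iter k S u) = 0) -> x = 0.
Hypothesis bT : bounded_op ip T.
Hypothesis perturbation : trace_class ip (T \- S) \/
  (hilbert_schmidt ip (T \- S) /\
   finite_trace ip (opabs ip (comm (adjoint ip T) T))).

Local Notation S' := (adjoint ip S).
Local Notation T' := (adjoint ip T).

(* The sequence u, iu, Su, iSu, ... spans a dense real subspace, and [S] shifts it
   by two places. *)
Let v := real_family (fun k => iter k S u).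
Let p := gram_schmidt q v.

Let po n : ortho q p n. Proof. exact: (gram_schmidt_ortho H). Qed.

Let pp : parseval q p.
Proof. by apply: (gram_schmidt_parseval H); exact: real_family_total. Qed.

Let shift k : S (v k) = v (k + 2)%N.
Proof.
rewrite /v /real_family addn2 /= negbK; case: (odd k) => //=.
by rewrite linear_mul_i; [|exact: bS.1].
Qed.

Let hessenberg k : proj q p (k + 2).+1 (S (p k)) = S (p k).
Proof.
by apply: (gram_schmidt_hessenberg H) => //; exact: real_linear bS.1.
Qed.

Lemma tc_selfcomm : tc q (rcomm (S' : VR -> VR) S).
Proof.
have [c [b _]] := adjointP CH bS.
exact: (berger_shaw H po pp b hyponormal hessenberg).
Qed.

(** The first alternative is a special case of the second: a perturbation of trace
    class is Hilbert-Schmidt, and it changes the self-commutator by trace class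
    terms. *)
Lemma perturbation_hs_tc e : orthonormal_basis ip e ->
  hs q (fun x : VR => (T x : VR) - S x) /\ tc q (rcomm (T' : VR -> VR) T).
Proof.
move=> eo; have [c [b lS']] := adjointP CH bS; have [d [b' lT']] := adjointP CH bT.
case: perturbation => [[bK fK]|[hK fT]].
  have hK : tc q (fun x : VR => (T x : VR) - S x) by exact: (finite_trace_tc bK fK eo).
  split; first exact: (tc_hs H).
  have [K' [r [bK' hK']]] := tc_adjoint H hK.
  have K'E : K' = (fun x : VR => (T' x : VR) - S' x).
    exact: (bop_adj_uniq H bK' (bopD H b' (bopN H b))).
  rewrite K'E in bK' hK'.
  rewrite (_ : rcomm _ _ = fun x : VR =>
    (rcomm (S' : VR -> VR) S x + ((fun x : VR => (T' x : VR) - S' x) \o T) x) +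
    ((S' \o (fun x : VR => (T x : VR) - S x)) x -
     ((T \o (fun x : VR => (T' x : VR) - S' x)) x +
      ((fun x : VR => (T x : VR) - S x) \o S') x))).
    apply: tcD; first exact: (tcD tc_selfcomm (tc_compr H b' hK')).
    apply: (tcB H); first exact: (tc_compl H (bopC H b) hK).
    exact: (tcD (tc_compl H b' hK') (tc_compr H (bopC H b) hK)).
  apply/funext => x; rewrite /rcomm /comp.
  rewrite (linB (bop_lin' b)) (linB (bop_lin b')).
  by apply: (ipxx_eq H) => z; rewrite !(ipE H); ring.
split; first exact: (hilbert_schmidt_hs hK eo).
by apply: (finite_trace_tc _ fT eo); apply: bounded_comm => //; exact: bounded_adjoint.
Qed.

Theorem complex_trace_invariance k l :
  let X := comm (iter k.+1 S') (iter l.+1 S) in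
  let Y := comm (iter k.+1 T') (iter l.+1 T) in
  [/\ trace_class ip X, trace_class ip Y & Tr ip X = Tr ip Y].
Proof.
move=> X Y.
have bS' := bounded_adjoint CH bS; have bT' := bounded_adjoint CH bT.
have [c [b lS']] := adjointP CH bS; have [d [b' lT']] := adjointP CH bT.
have bX : bounded_op ip X by apply: bounded_comm => //; exact: bounded_op_iter.
have bY : bounded_op ip Y by apply: bounded_comm => //; exact: bounded_op_iter.
have tcX : tc q (X : VR -> VR).
  exact: (tc_rcomm_hyponormal H po pp b hyponormal hessenberg k l).
split.
- by split=> // e eo; exact: tc_finite_trace.
- split=> // e eo; apply: tc_finite_trace => //.
  have [_ tcT] := perturbation_hs_tc eo.
  exact: (tc_rcomm_perturbed H b' tcT k l).
apply: Tr_eq => [x|x|e eo]; [exact: linear_mul_i bX.1 _|exact: linear_mul_i bY.1 _|].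
have [hK tcT] := perturbation_hs_tc eo.
have tr := trace_comm_invariant H po pp b hyponormal hessenberg b' hK tcT.
split.
  exact: (tr id id 1 k l _ (bop_id q) (onb_parseval eo)).
by apply: (tr mul_i _ 1 k l _ (mul_i_bop CH) (onb_parseval eo)) => x; rewrite linear_mul_i//; [exact: bS.1|exact: bT.1].
Qed.

End complex_trace.

(** * Completeness of spaces of square integrable functions *)

Lemma geometric_increments_cvg (R : realType) (u : nat -> R) (c : R) :
  (forall n, `|u n.+1 - u n| <= c * 2^-1 ^+ n) ->
  exists l : R, u @ \oo --> l /\ forall n, `|u n - l| <= 2 * c * 2^-1 ^+ n.
Proof.
move=> uc.
have g0 : (fun n => 2 * c * 2^-1 ^+ n) @ \oo --> (0 : R).
  by apply: cvg0Ml; apply: cvg_expr; rewrite ger0_norm ?invr_ge0// invf_lt1// ltr1n.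
pose a n := u n - 2 * c * 2^-1 ^+ n; pose b n := u n + 2 * c * 2^-1 ^+ n.
have c0 : 0 <= c by have := le_trans (normr_ge0 _) (uc 0%N); rewrite expr0 mulr1.
have p0 n : 0 <= 2 * c * 2^-1 ^+ n.
  by rewrite mulr_ge0 ?exprn_ge0 ?invr_ge0// mulr_ge0.
have incr n : a n <= a n.+1 /\ b n.+1 <= b n.
  have := uc n; rewrite ler_norml /a /b exprS => /andP[]; lra.
have bn n : b n <= b 0%N.
  by elim: n => [//|n ih]; apply: le_trans ih; have [] := incr n.
have ab n : a n <= b 0%N.
  by apply: le_trans (bn n); rewrite /a /b; have := p0 n; lra.
have [l al _] := nondecreasing_bounded_cvg (fun n => (incr n).1) ab.
have ul : u @ \oo --> l.
  rewrite (_ : u = fun n => a n + 2 * c * 2^-1 ^+ n).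
    by rewrite -[l]addr0; exact: cvgD.
  by apply/funext => n; rewrite subrK.
have bl : (fun n => - b n) @ \oo --> - l.
  apply: cvgN; rewrite -[l]addr0; exact: cvgD.
have dec n : - b n <= - b n.+1 by rewrite lerN2; have [] := incr n.
exists l; split=> // n.
have h1 := nondecreasing_le_cvg (fun n => (incr n).1) al n.
have h2 := nondecreasing_le_cvg dec bl n.
by rewrite ler_norml; apply/andP; split; move: h1 h2; rewrite /a /b; lra.
Qed.

Section riesz_fischer.
Context d (T : measurableType d) (R : realType) (mu : {measure set T -> \bar R}).

(** A sequence with [|g_(n+1) - g_n|^2 <= 8^-n] in the mean converges almost
    everywhere, because the sum of [4^n |g_(n+1) - g_n|^2] is integrable, hence
    almost everywhere finite; the same sum controls the rate of convergence. *)
Lemma riesz_fischer (g : nat -> T -> R) :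
  (forall n, measurable_fun setT (g n)) ->
  (forall n, (\int[mu]_x ((g n.+1 x - g n x) ^+ 2)%:E <= (8^-1 ^+ n)%:E)%E) ->
  exists f : T -> R, measurable_fun setT f /\ exists C : R, forall n,
    (\int[mu]_x ((g n x - f x) ^+ 2)%:E <= (C * 4^-1 ^+ n)%:E)%E.
Proof.
move=> mg gd.
pose t n x := ((4 ^+ n * (g n.+1 x - g n x) ^+ 2)%:E : \bar R).
have t0 n x : (0 <= t n x)%E by rewrite lee_fin mulr_ge0 ?sqr_ge0 ?exprn_ge0.
have mt n : measurable_fun setT (t n).
  apply/measurable_EFinP; apply: measurable_funM; first exact: measurable_cst.
  by apply: measurable_funX; exact: measurable_funB.
pose F x := (\sum_(0 <= n <oo) t n x)%E.
have F0 x : (0 <= F x)%E by apply: nneseries_ge0.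
have mF : measurable_fun setT F by exact: ge0_emeasurable_sum.
have Ffin : (\int[mu]_x F x < +oo)%E.
  rewrite integral_nneseries//.
  apply: (@le_lt_trans _ _ (\sum_(0 <= n <oo) (2^-1 ^+ n)%:E)%E).
    apply: lee_nneseries => [n _ _|n _]; first by apply: integral_ge0 => x _; exact: t0.
    rewrite /t; under eq_integral do rewrite EFinM.
    rewrite ge0_integralZl//.
    - apply: (@le_trans _ _ ((4 ^+ n)%:E * (8^-1 ^+ n)%:E)%E).
        by apply: lee_wpmul2l; [rewrite lee_fin exprn_ge0|exact: gd].
      rewrite -EFinM lee_fin -exprMn le_eqVlt; apply/orP; left; apply/eqP.
      by congr (_ ^+ _); field.
    - by apply/measurable_EFinP; apply: measurable_funX; exact: measurable_funB.
    - by move=> x _; rewrite lee_fin sqr_ge0.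
  apply: (@bounded_nneseries _ _ 2) => [k|n]; first by rewrite exprn_ge0// invr_ge0.
  suff : \sum_(0 <= k < n) (2^-1 ^+ k : R) = 2 - 2 * 2^-1 ^+ n.
    by move=> ->; rewrite gerBl mulr_ge0// exprn_ge0// invr_ge0.
  elim: n => [|n ih]; first by rewrite big_geq// expr0 mulr1 subrr.
  by rewrite big_nat_recr//= ih exprS; field.
have Fi : mu.-integrable setT F.
  by apply/integrableP; split=> //; under eq_integral do rewrite gee0_abs//.
have Fae := integrable_ae measurableT Fi.
have term n x : F x \is a fin_num -> 4 ^+ n * (g n.+1 x - g n x) ^+ 2 <= fine (F x).
  move=> Fx; rewrite -lee_fin fineK//.
  apply: (@le_trans _ _ (\sum_(0 <= k < n.+1) t k x)%E); last exact: nneseries_lim_ge.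
  by rewrite big_nat_recr//= leeDr// sume_ge0.
pose E := [set x | F x \is a fin_num].
have mE : measurable E.
  by have := emeasurable_fin_num measurableT mF; rewrite setTI.
have /choice[f fP] : forall x, exists l, (fun n => g n x * \1_E x) @ \oo --> l /\
    (F x \is a fin_num -> forall n, (g n x - l) ^+ 2 <= 4 * 4^-1 ^+ n * fine (F x)).
  move=> x; have [Fx|nFx] := boolP (F x \is a fin_num); last first.
    exists 0; split=> //; rewrite (_ : (fun n => _) = fun=> 0); first exact: cvg_cst.
    by apply/funext => n; rewrite indicE memNset ?mulr0//; apply/negP.
  have [|l [gl lb]] := @geometric_increments_cvg R (fun n => g n x) (Num.sqrt (fine (F x))).
    move=> n; have p2 : 0 <= (2^-1 ^+ n : R) by rewrite exprn_ge0// invr_ge0.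
    rewrite -(@ler_pXn2r _ 2)// ?nnegrE ?mulr_ge0 ?sqrtr_ge0//.
    rewrite real_normK ?num_real// exprMn sqr_sqrtr ?fine_ge0//.
    have := term n x Fx; rewrite -exprM mulnC exprM.
    rewrite (_ : 2^-1 ^+ 2 = 4^-1 :> R); last by field.
    by rewrite exprVn ler_pdivlMr ?exprn_gt0// mulrC.
  exists l; split.
    rewrite (_ : (fun n => _) = (fun n => g n x))//.
    by apply/funext => n; rewrite indicE mem_set ?mulr1.
  move=> _ n; have p2 : 0 <= (2^-1 ^+ n : R) by rewrite exprn_ge0// invr_ge0.
  have h0 := lb n.
  have : `|g n x - l| ^+ 2 <= (2 * Num.sqrt (fine (F x)) * 2^-1 ^+ n) ^+ 2.
    by rewrite ler_pXn2r// nnegrE ?normr_ge0// !mulr_ge0 ?sqrtr_ge0.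
  rewrite real_normK ?num_real// !exprMn sqr_sqrtr ?fine_ge0// -exprM mulnC exprM.
  rewrite (_ : 2^-1 ^+ 2 = 4^-1 :> R); last by field.
  by move/le_trans; apply; rewrite le_eqVlt; apply/orP; left; apply/eqP; ring.
have mf : measurable_fun setT f.
  apply: (measurable_fun_cvg (h := fun n x => g n x * \1_E x)) => [n|x _].
    by apply: measurable_funM => //; exact: measurable_indic.
  by have [] := fP x.
exists f; split=> //; exists (4 * fine (\int[mu]_x F x)%E) => n.
apply: (@le_trans _ _ (\int[mu]_x ((4 * 4^-1 ^+ n)%:E * F x))%E).
  apply: ae_ge0_le_integral => //.
  - by move=> x _; rewrite lee_fin sqr_ge0.
  - by apply/measurable_EFinP; apply: measurable_funX; exact: measurable_funB.
  - by move=> x _; rewrite mule_ge0// lee_fin mulr_ge0// exprn_ge0// invr_ge0.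
  - exact: measurable_funeM.
  - apply: filterS Fae => x /(_ I) Fx _; have [_ /(_ Fx n) h] := fP x.
    by rewrite -(fineK Fx) -EFinM lee_fin.
rewrite ge0_integralZl//.
rewrite -(@fineK _ (\int[mu]_x F x)%E); last by rewrite ge0_fin_numE// integral_ge0.
by rewrite -EFinM lee_fin le_eqVlt; apply/orP; left; apply/eqP; ring.
Qed.
End riesz_fischer.

(** * The Hilbert space of classes in [P^2(mu)] *)

Section square_integrable_functions.
Context {R : realType} (mu : {measure set (plane R) -> \bar R}).
Local Notation fn := (plane R -> R[i]^o).
Local Notation Re := complex.Re.
Local Notation Im := complex.Im.
Implicit Types f g h : fn.

Definition sqn (z : R[i]) : R := Re z ^+ 2 + Im z ^+ 2.

Lemma normc_sqn (z : R[i]) : ComplexField.Normc.normc z ^+ 2 = sqn z.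
Proof. by case: z => a b; rewrite /sqn /= sqr_sqrtr// addr_ge0// sqr_ge0. Qed.

Lemma sqn_ge0 z : 0 <= sqn z. Proof. by rewrite addr_ge0// sqr_ge0. Qed.

Lemma sqn0 : sqn 0 = 0. Proof. by rewrite /sqn /= expr0n addr0. Qed.

Lemma sqnM a z : sqn (a * z) = sqn a * sqn z.
Proof. by case: a z => a b [c d]; rewrite /sqn /=; ring. Qed.

Lemma sqnD_le u v : sqn (u + v) <= 2 * sqn u + 2 * sqn v.
Proof.
rewrite /sqn; case: u v => a b [c d] /=.
by have := sqr_ge0 (a - c); have := sqr_ge0 (b - d); nra.
Qed.

Lemma sqdistE f g : sqdist mu f g = (\int[mu]_p (sqn (f p - g p))%:E)%E.
Proof. by apply: eq_integral => p _; rewrite normc_sqn. Qed.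

Lemma sqdist0E f : sqdist mu f 0 = (\int[mu]_p (sqn (f p))%:E)%E.
Proof. by rewrite sqdistE; apply: eq_integral => p _; rewrite subr0. Qed.

Lemma cmeasurableB f g : cmeasurable f -> cmeasurable g -> cmeasurable (fun p => f p - g p).
Proof.
move=> mf mg; rewrite (_ : (fun p => _) = f \+ ((fun=> -1) \* g)); last first.
  by apply/funext => p /=; rewrite mulN1r.
by apply: cmeasurableD => //; apply: cmeasurableM => //; exact: cmeasurable_cst.
Qed.

Lemma cmeasurableJ f : cmeasurable f -> cmeasurable (fun p => (f p)^*%C).
Proof.
move=> [mr mi]; split.
  by rewrite (_ : (fun p => _) = (fun p => Re (f p)))//; apply/funext => p; case: (f p).
rewrite (_ : (fun p => _) = (fun p => - Im (f p))).
  exact: measurableT_comp.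
by apply/funext => p; case: (f p).
Qed.

Lemma measurable_sqn f : cmeasurable f -> measurable_fun setT (fun p => sqn (f p)).
Proof. by move=> /cmeasurable_sqn; under eq_fun do rewrite normc_sqn. Qed.

Lemma square_integrableP f : square_integrable mu f <->
  cmeasurable f /\ mu.-integrable setT (fun p => (sqn (f p))%:E).
Proof.
rewrite /square_integrable sqdist0E; split=> -[mf h]; split=> //.
  apply/integrableP; split; first by apply/measurable_EFinP; exact: measurable_sqn.
  by under eq_integral do rewrite gee0_abs ?lee_fin ?sqn_ge0//.
by move/integrableP : h => [_]; under eq_integral do rewrite gee0_abs ?lee_fin ?sqn_ge0//.
Qed.

Lemma integrable_le (u v : plane R -> R) : measurable_fun setT u ->
  mu.-integrable setT (EFin \o v) -> (forall p, `|u p| <= v p) ->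
  mu.-integrable setT (EFin \o u).
Proof.
move=> mu' iv uv; apply: (le_integrable measurableT _ _ iv).
  exact/measurable_EFinP.
by move=> p _ /=; rewrite lee_fin (le_trans (uv p)) ?ler_norm.
Qed.

Lemma square_integrableM f g : square_integrable mu f -> square_integrable mu g ->
  cmeasurable (fun p => f p * (g p)^*%C) /\ cintegrable mu (fun p => f p * (g p)^*%C).
Proof.
move=> /square_integrableP[mf If] /square_integrableP[mg Ig].
have m : cmeasurable (fun p => f p * (g p)^*%C).
  by apply: (cmeasurableM mf); exact: cmeasurableJ.
have I2 : mu.-integrable setT (EFin \o (fun p => sqn (f p) + sqn (g p))).
  have := integrableD measurableT If Ig.
  by apply: eq_integrable.
split=> //; split; (apply: integrable_le I2 _; [by case: m|]) => p;
  case: (f p) (g p) => a b [c d]; rewrite /sqn /= ler_norml;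
  have := sqr_ge0 (a - c); have := sqr_ge0 (a + c); have := sqr_ge0 (b - d);
  have := sqr_ge0 (b + d); have := sqr_ge0 (a - d); have := sqr_ge0 (a + d);
  have := sqr_ge0 (b - c); have := sqr_ge0 (b + c) => *; apply/andP; split; nra.
Qed.

Lemma cintegral_linear a f g : cintegrable mu f -> cintegrable mu g ->
  cintegral mu (fun p => a * f p + g p) = a * cintegral mu f + cintegral mu g.
Proof.
move=> [fr fi] [gr gi]; rewrite /cintegral; case: a => a b.
have Z (c : R) (u : plane R -> R) : mu.-integrable setT (EFin \o u) ->
    mu.-integrable setT (EFin \o (fun p => c * u p)).
  by move=> iu; have := integrableZl measurableT c iu; apply: eq_integrable.
have D (u v : plane R -> R) : mu.-integrable setT (EFin \o u) ->
    mu.-integrable setT (EFin \o v) -> mu.-integrable setT (EFin \o (fun p => u p + v p)).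
  by move=> iu iv; have := integrableD measurableT iu iv; apply: eq_integrable.
apply/eqP; rewrite eq_complex /=; apply/andP; split; apply/eqP.
  rewrite (_ : (fun p => _) = fun p => (a * Re (f p) + (- b) * Im (f p)) + Re (g p)).
    rewrite !RintegralD// ?RintegralZl//; [by rewrite mulNr|exact: Z|exact: Z|].
    by apply: D; exact: Z.
  by apply/funext => p; case: (f p) (g p) => u v [s t] /=; rewrite mulNr.
rewrite (_ : (fun p => _) = fun p => (a * Im (f p) + b * Re (f p)) + Im (g p)).
  rewrite !RintegralD// ?RintegralZl//; [exact: Z|exact: Z|].
  by apply: D; exact: Z.
by apply/funext => p; case: (f p) (g p) => u v [s t] /=.
Qed.

Lemma cintegralJ f : cintegrable mu f ->
  cintegral mu (fun p => (f p)^*%C) = (cintegral mu f)^*%C.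
Proof.
move=> [fr fi]; rewrite /cintegral /=; congr (_ +i* _)%C.
  by apply: eq_Rintegral => p _; case: (f p).
rewrite -mulN1r -RintegralZl//; apply: eq_Rintegral => p _.
by case: (f p) => a b /=; rewrite mulN1r.
Qed.

Lemma ae_eq_Rintegral (u v : plane R -> R) : measurable_fun setT u ->
  measurable_fun setT v -> {ae mu, forall p, u p = v p} ->
  (\int[mu]_p u p = \int[mu]_p v p)%R.
Proof.
move=> mu' mv uv; congr fine; apply: ae_eq_integral => //; try exact/measurable_EFinP.
by apply: filterS uv => p -> .
Qed.

Lemma ae_eq_cintegral f g : cmeasurable f -> cmeasurable g ->
  {ae mu, forall p, f p = g p} -> cintegral mu f = cintegral mu g.
Proof.
move=> [fr fi] [gr gi] fg; rewrite /cintegral.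
by congr (_ +i* _)%C; apply: ae_eq_Rintegral => //; apply: filterS fg => p ->.
Qed.
End square_integrable_functions.

Section P2_classes.
Local Open Scope quotient_scope.
Context {R : realType} (mu : {measure set (plane R) -> \bar R}).
Local Notation fn := (plane R -> R[i]^o).
Local Notation Re := complex.Re.
Local Notation Im := complex.Im.
Local Notation Q := (P2 mu).
Implicit Types (f g h : fn) (x y z : P2 mu).

Lemma P2fn_in x : P2fun mu (P2fn x).
Proof. by rewrite /P2fn; case: (repr x) => f /= fP; move: fP; rewrite inE. Qed.

Lemma P2fn_si x : square_integrable mu (P2fn x).
Proof. by have [] := P2fn_in x. Qed.

Lemma P2_eq x y : {ae mu, forall p, P2fn x p = P2fn y p} -> x = y.
Proof.
move=> xy; rewrite -[x]reprK -[y]reprK; apply/eqP; rewrite -Quotient.idealrBE.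
apply/asboolP; apply: filterS xy => p xyp.
by have -> : P2rep_fun (repr x - repr y) p = P2fn x p - P2fn y p by []; rewrite xyp subrr.
Qed.

Lemma P2fn_pi (r : P2rep mu) : {ae mu, forall p, P2fn (\pi_Q r) p = r p}.
Proof.
have : (repr (\pi_Q r) : P2rep mu) - r \in @P2null R mu.
  by rewrite Quotient.idealrBE reprK.
move=> /asboolP; apply: filterS => p h.
by apply/eqP; rewrite -subr_eq0; apply/eqP; exact: h.
Qed.

Lemma P2fn_lin a x y : {ae mu, forall p, P2fn (a *: x + y) p = a * P2fn x p + P2fn y p}.
Proof.
have -> : a *: x + y = \pi_Q (a *: (repr x : P2rep mu) + repr y).
  by rewrite P2_piD P2_piZ !reprK.
exact: P2fn_pi.
Qed.

Lemma P2_class f : P2fun mu f -> exists x, {ae mu, forall p, P2fn x p = f p}.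
Proof.
move=> fP; have fP' : f \in P2pred mu by rewrite inE.
by exists (\pi_Q (MkP2rep fP')); exact: P2fn_pi.
Qed.

Lemma P2ip_ae x y f g : square_integrable mu f -> square_integrable mu g ->
  {ae mu, forall p, P2fn x p = f p} -> {ae mu, forall p, P2fn y p = g p} ->
  P2ip x y = cintegral mu (fun p => f p * (g p)^*%C).
Proof.
move=> sf sg xf yg; apply: ae_eq_cintegral.
- by have [] := square_integrableM (P2fn_si x) (P2fn_si y).
- by have [] := square_integrableM sf sg.
- by apply: filterS2 xf yg => p -> ->.
Qed.

Lemma mulJ_sqn (z : R[i]) : z * z^*%C = (sqn z)%:C%C.
Proof. by case: z => a b; rewrite /sqn; apply/eqP; rewrite eq_complex/=; apply/andP; split; apply/eqP; ring. Qed.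

Lemma P2norm_ae x f : square_integrable mu f ->
  {ae mu, forall p, P2fn x p = f p} ->
  reip (@P2ip R mu) x x = (\int[mu]_p sqn (f p))%R.
Proof.
move=> sf xf; rewrite /reip (P2ip_ae sf sf xf xf) /cintegral/=.
by apply: eq_Rintegral => p _; rewrite mulJ_sqn.
Qed.

Lemma P2norm_EFin x f : square_integrable mu f ->
  {ae mu, forall p, P2fn x p = f p} ->
  (reip (@P2ip R mu) x x)%:E = (\int[mu]_p (sqn (f p))%:E)%E.
Proof.
move=> sf xf; rewrite (P2norm_ae sf xf) fineK//; apply: integrable_fin_num => //.
by have [] := (square_integrableP mu f).1 sf.
Qed.

Lemma P2fnB x y : {ae mu, forall p, P2fn (x - y) p = P2fn x p - P2fn y p}.
Proof.
have := P2fn_lin (-1) y x; rewrite scaleN1r addrC; apply: filterS => p ->.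
by rewrite mulN1r addrC.
Qed.

Lemma square_integrableB f g : square_integrable mu f -> square_integrable mu g ->
  square_integrable mu (fun p => f p - g p).
Proof.
move=> /square_integrableP[mf If] /square_integrableP[mg Ig].
have m := cmeasurableB mf mg.
apply/square_integrableP; split=> //.
have I2 : mu.-integrable setT (EFin \o (fun p => 2 * sqn (f p) + 2 * sqn (g p))).
  have := integrableD measurableT (integrableZl measurableT 2 If) (integrableZl measurableT 2 Ig).
  by apply: eq_integrable.
apply: (integrable_le _ I2); first exact: measurable_sqn.
move=> p; rewrite ger0_norm ?sqn_ge0//; apply: le_trans (sqnD_le _ _) _.
by rewrite lerD2l ler_wpM2l// /sqn; case: (g p) => a b /=; rewrite !sqrrN.
Qed.

End P2_classes.

Section P2_hilbert.
Context {R : realType} (mu : {measure set (plane R) -> \bar R}).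
Local Notation fn := (plane R -> R[i]^o).
Local Notation Re := complex.Re.
Local Notation Im := complex.Im.
Local Notation q := (reip (@P2ip R mu)).
Local Notation N x := (q x x).
Implicit Types (f g h : fn) (x y z : P2 mu).

Lemma P2dist_EFin x y f g : square_integrable mu f -> square_integrable mu g ->
  {ae mu, forall p, P2fn x p = f p} -> {ae mu, forall p, P2fn y p = g p} ->
  (q (x - y) (x - y))%:E = sqdist mu f g.
Proof.
move=> sf sg xf yg; rewrite sqdistE; apply: P2norm_EFin; first exact: square_integrableB.
by have := P2fnB x y; move: xf yg; apply: filterS3 => p -> -> ->.
Qed.

Lemma sqdist_triangle f g h : cmeasurable f -> cmeasurable g -> cmeasurable h ->
  (sqdist mu f h <= 2%:E * sqdist mu f g + 2%:E * sqdist mu g h)%E.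
Proof.
move=> mf mg mh; have := sqdist_lin_le mu 1 mf mg mg mh.
rewrite normc_sqn (_ : sqn 1 = 1) ?mulr1; last by rewrite /sqn /= expr1n expr0n addr0.
rewrite (_ : sqdist mu _ _ = sqdist mu f h)// !sqdistE; apply: eq_integral => p _.
congr ((sqn _)%:E).
change (1 *: f p + g p - (1 *: g p + h p) = f p - h p).
by rewrite !scale1r opprD addrA addrK.
Qed.

Lemma sqdistC f g : sqdist mu f g = sqdist mu g f.
Proof.
rewrite !sqdistE; apply: eq_integral => p _; congr (_%:E).
by rewrite /sqn; case: (f p) (g p) => a b [c d] /=; ring.
Qed.

Lemma P2_linear a x y z : P2ip (a *: x + y) z = a * P2ip x z + P2ip y z.
Proof.
have [m1 i1] := square_integrableM (P2fn_si x) (P2fn_si z).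
have [m2 i2] := square_integrableM (P2fn_si y) (P2fn_si z).
rewrite /P2ip -cintegral_linear//; apply: ae_eq_cintegral.
- by have [] := square_integrableM (P2fn_si (a *: x + y)) (P2fn_si z).
- apply: cmeasurableD => //.
  by apply: (cmeasurableM (f := fun=> a)) => //; exact: cmeasurable_cst.
- by apply: filterS (P2fn_lin a x y) => p ->; rewrite mulrDl mulrA.
Qed.

Lemma P2_conj x y : P2ip y x = (P2ip x y)^*%C.
Proof.
have [m1 i1] := square_integrableM (P2fn_si x) (P2fn_si y).
rewrite /P2ip -cintegralJ//; congr cintegral; apply/funext => p.
by case: (P2fn x p) (P2fn y p) => a b [c d]; apply/eqP; rewrite eq_complex/=; apply/andP; split; apply/eqP; ring.
Qed.

Lemma aeT (P : plane R -> Prop) : (forall p, P p) -> {ae mu, forall p, P p}.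
Proof. by move=> h; apply: nearW. Qed.

Lemma P2normE x : N x = (\int[mu]_p sqn (P2fn x p))%R.
Proof. by apply: P2norm_ae; [exact: P2fn_si|exact: aeT]. Qed.

Lemma P2norm_ge0 x : 0 <= N x.
Proof. by rewrite P2normE; apply: Rintegral_ge0 => p _; exact: sqn_ge0. Qed.

Lemma P2norm_eq0 x : N x = 0 -> x = 0.
Proof.
move=> x0; have [m _] := P2fn_si x.
have := P2norm_EFin (P2fn_si x) (aeT (fun p => erefl (P2fn x p))).
rewrite x0 => /esym i0.
have : (\int[mu]_p `|(sqn (P2fn x p))%:E| = 0)%E.
  by apply: etrans i0; apply: eq_integral => p _; rewrite gee0_abs// lee_fin sqn_ge0.
have ms : measurable_fun setT (fun p => (sqn (P2fn x p))%:E).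
  by apply/measurable_EFinP; exact: measurable_sqn.
move/(ae_eq_integral_abs mu measurableT ms) => h; apply: P2_eq; have := P2fnB x x; rewrite subrr.
move: h; apply: filterS2 => p /(_ I) [s0] ->; rewrite subrr.
move: s0; rewrite /sqn; case: (P2fn x p) => a b /= /eqP.
rewrite paddr_eq0 ?sqr_ge0// !sqrf_eq0 => /andP[/eqP-> /eqP->].
by [].
Qed.

(** A Cauchy sequence converges as soon as a fast Cauchy subsequence does, and for
    the latter real and imaginary parts converge by [riesz_fischer]. *)
Lemma P2_complete (u : nat -> realification (P2 mu)) : ncauchy q u -> exists l, ncvg q u l.
Proof.
have D2 (a b c : P2 mu) : N (a - c) <= 2 * N (a - b) + 2 * N (b - c).
  rewrite -lee_fin EFinD !EFinM.
  rewrite !(P2dist_EFin (P2fn_si _) (P2fn_si _) (aeT (fun p => erefl _)) (aeT (fun p => erefl _))).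
  by apply: sqdist_triangle; [have [] := P2fn_si a|have [] := P2fn_si b|have [] := P2fn_si c].
move=> cu.
have /choice[m mP] : forall k : nat, exists m, forall j j', (m <= j)%N -> (m <= j')%N ->
    N ((u j : P2 mu) - u j') <= 8^-1 ^+ k.
  by move=> k; apply: cu; rewrite exprn_gt0// invr_gt0.
(* a nondecreasing sequence of indices, as [m] need not be monotone *)
pose M k := (\sum_(i < k.+1) m i)%N.
have mM k : (m k <= M k)%N by rewrite /M big_ord_recr/= leq_addl.
have MS k : (M k <= M k.+1)%N by rewrite {2}/M big_ord_recr/= leq_addr.
pose w k : P2 mu := u (M k).
have wd k : N (w k.+1 - w k) <= 8^-1 ^+ k.
  by apply: mP => //; exact: leq_trans (mM k) (MS k).
have mw k : cmeasurable (P2fn (w k)) by have [] := P2fn_si (w k).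
have dE k : (\int[mu]_p (sqn (P2fn (w k.+1) p - P2fn (w k) p))%:E <= (8^-1 ^+ k)%:E)%E.
  rewrite -sqdistE -(P2dist_EFin (P2fn_si _) (P2fn_si _) (aeT (fun p => erefl _)) (aeT (fun p => erefl _))).
  by rewrite lee_fin.
have part (P : R[i] -> R) : (forall a b, P (a - b) = P a - P b) ->
    (forall a, P a ^+ 2 <= sqn a) -> (forall k, measurable_fun setT (fun p => P (P2fn (w k) p))) ->
    exists h : plane R -> R, measurable_fun setT h /\ exists C : R, forall k,
    (\int[mu]_p ((P (P2fn (w k) p) - h p) ^+ 2)%:E <= (C * 4^-1 ^+ k)%:E)%E.
  move=> PB Ple mP'; apply: riesz_fischer => // k; apply: le_trans (dE k).
  apply: ge0_le_integral => //.
  - by move=> p _; rewrite lee_fin sqr_ge0.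
  - by apply/measurable_EFinP; apply: measurable_funX; exact: measurable_funB.
  - by apply/measurable_EFinP; apply: measurable_sqn; exact: cmeasurableB.
  - by move=> p _; rewrite lee_fin -PB.
have [|a|k|hr [mr [Cr Hr]]] := part (@complex.Re R); [by move=> [? ?] [? ?]|by rewrite lerDl sqr_ge0|by have [] := mw k|].
have [|a|k|hi [mi [Ci Hi]]] := part (@complex.Im R); [by move=> [? ?] [? ?]|by rewrite lerDr sqr_ge0|by have [] := mw k|].
pose f : fn := fun p => (hr p +i* hi p)%C.
have mf : cmeasurable f by [].
pose C := Cr + Ci.
have dist k : (sqdist mu (P2fn (w k)) f <= (C * 4^-1 ^+ k)%:E)%E.
  rewrite sqdistE mulrDl EFinD; apply: le_trans (leeD (Hr k) (Hi k)).
  rewrite -ge0_integralD//.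
  - apply: ge0_le_integral => //.
    + by move=> p _; rewrite lee_fin sqn_ge0.
    + by apply/measurable_EFinP; apply: measurable_sqn; exact: cmeasurableB.
    + apply: emeasurable_funD; apply/measurable_EFinP; apply: measurable_funX;
        apply: measurable_funB => //; by have [] := mw k.
    + by move=> p _; rewrite -EFinD lee_fin /sqn /f; case: (P2fn (w k) p).
  - by move=> p _; rewrite lee_fin sqr_ge0.
  - by apply/measurable_EFinP; apply: measurable_funX; apply: measurable_funB => //; have [] := mw k.
  - by move=> p _; rewrite lee_fin sqr_ge0.
  - by apply/measurable_EFinP; apply: measurable_funX; apply: measurable_funB => //; have [] := mw k.
have sf : square_integrable mu f.
  split=> //; have m0 : @cmeasurable R 0 by exact: cmeasurable_cst.
  apply: le_lt_trans (sqdist_triangle mf (mw 0%N) m0) _.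
  apply: lte_add_pinfty; rewrite lte_mul_pinfty ?lee_fin//.
    by rewrite sqdistC; exact: le_lt_trans (dist 0%N) (ltry _).
  by have [] := P2fn_si (w 0%N).
have C0 : 0 <= C.
  have : (0 <= sqdist mu (P2fn (w 0%N)) f)%E.
    by rewrite sqdistE; apply: integral_ge0 => p _; rewrite lee_fin sqn_ge0.
  by move=> /le_trans/(_ (dist 0%N)); rewrite lee_fin expr0 mulr1.
have lim8 (c eps : R) (b : R) : 0 < eps -> 0 <= b -> b < 1 -> exists k0, forall k, (k0 <= k)%N -> c * b ^+ k <= eps.
  move=> e0 b0 b1; have : (fun k => c * b ^+ k) @ \oo --> (0 : R).
    by apply: cvg0Ml; apply: cvg_expr; rewrite ger0_norm.
  move=> /cvgrPdist_le/(_ eps e0)[k0 _ hk]; exists k0 => k /hk.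
  by rewrite /= sub0r normrN; apply: le_trans; exact: ler_norm.
have i4 : 0 <= (4^-1 : R) < 1 by rewrite invr_ge0 ler0n invf_lt1// ltr1n.
have i8 : 0 <= (8^-1 : R) < 1 by rewrite invr_ge0 ler0n invf_lt1// ltr1n.
have fP : P2fun mu f.
  split=> // eps e0; have e2 : 0 < eps ^+ 2 / 8 by rewrite divr_gt0// exprn_gt0.
  have [|//|k0 hk] := @lim8 C _ 4^-1 e2; [by case/andP: i4|by case/andP: i4|].
  have [_ /(_ (eps / 4))[|r hr']] := P2fn_in (w k0); first by rewrite divr_gt0.
  exists r; apply: le_lt_trans (sqdist_triangle mf (mw k0) (cmeasurable_poly r)) _.
  apply: (@le_lt_trans _ _ (2%:E * (eps ^+ 2 / 8)%:E + 2%:E * ((eps / 4) ^+ 2)%:E)%E).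
    apply: leeD; apply: lee_wpmul2l; rewrite ?lee_fin//; last exact: ltW.
    by rewrite sqdistC; apply: le_trans (dist k0) _; rewrite lee_fin hk.
  rewrite -!EFinM -EFinD lte_fin; have h := exprn_gt0 2 e0.
  have -> : (eps / 4) ^+ 2 = eps ^+ 2 / 16 by field.
  lra.
have [l lf] := P2_class fP.
exists l; apply/cvgrPdist_le => eps e0.
have e4 : 0 < eps / 4 by rewrite divr_gt0.
have [||k1 hk1] := @lim8 C _ 4^-1 e4; [by case/andP: i4|by case/andP: i4|].
have [||k2 hk2] := @lim8 1 _ 8^-1 e4; [by case/andP: i8|by case/andP: i8|].
pose k := maxn k1 k2.
exists (M k) => // n Mn; rewrite sub0r normrN /= ger0_norm ?P2norm_ge0//.
apply: le_trans (D2 _ (w k) _) _.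
have h1 : N ((u n : P2 mu) - w k) <= eps / 4.
  apply: le_trans (mP k _ _ _ _) _; [exact: leq_trans (mM k) Mn|exact: mM|].
  by have := hk2 k; rewrite mul1r; apply; exact: leq_maxr.
have h2 : N (w k - l) <= eps / 4.
  rewrite -lee_fin (P2dist_EFin (P2fn_si _) sf (aeT (fun p => erefl _)) lf).
  by apply: le_trans (dist k) _; rewrite lee_fin hk1// leq_maxl.
lra.
Qed.

Lemma P2_complex_hilbert : complex_hilbert (@P2ip R mu).
Proof.
split; [exact: P2_linear|exact: P2_conj|exact: P2norm_ge0|exact: P2norm_eq0|exact: P2_complete].
Qed.
End P2_hilbert.

(** * Multiplication by [z] *)

Section multiplication.
Context {R : realType} (mu : {measure set (plane R) -> \bar R}).
Local Notation fn := (plane R -> R[i]^o).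
Local Notation q := (reip (@P2ip R mu)).
Local Notation N x := (q x x).
Implicit Types (f g h : fn) (x y z : P2 mu).

Variable M : R.
Hypothesis M0 : 0 < M.
Hypothesis suppM : {ae mu, forall p, sqn (zpt p) <= M}.
Hypothesis one_P2 : square_integrable mu (fun=> 1).

Local Notation CH := (P2_complex_hilbert mu).
Local Notation S := (@mulz R mu).

Lemma cmeasurable_zM f : cmeasurable f -> cmeasurable (fun p => zpt p * f p).
Proof.
move=> mf; apply: (cmeasurableM (f := @zpt R)) => //.
by split; [exact: measurable_fst|exact: measurable_snd].
Qed.

Lemma sqdist_zM f g : cmeasurable f -> cmeasurable g ->
  (sqdist mu (fun p => (zpt p * f p)%R) (fun p => (zpt p * g p)%R) <= M%:E * sqdist mu f g)%E.
Proof.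
move=> mf mg; rewrite !sqdistE -ge0_integralZl//; last first.
- by rewrite lee_fin ltW.
- by move=> p _; rewrite lee_fin sqn_ge0.
- by apply/measurable_EFinP; apply: measurable_sqn; exact: cmeasurableB.
apply: ae_ge0_le_integral => //.
- by move=> p _; rewrite lee_fin sqn_ge0.
- by apply/measurable_EFinP; apply: measurable_sqn; apply: cmeasurableB; exact: cmeasurable_zM.
- by move=> p _; rewrite -EFinM lee_fin mulr_ge0 ?sqn_ge0// ltW.
- apply/measurable_EFinP; apply: measurable_funM; first exact: measurable_cst.
  by apply: measurable_sqn; exact: cmeasurableB.
- apply: filterS suppM => p pM _.
  by rewrite -EFinM lee_fin -mulrBr sqnM ler_wpM2r// sqn_ge0.
Qed.

Lemma P2fun_zM f : P2fun mu f -> P2fun mu (fun p => zpt p * f p).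
Proof.
move=> [[mf sf] cf]; have mz := cmeasurable_zM mf.
have m0 : @cmeasurable R 0 by exact: cmeasurable_cst.
split.
  split=> //; have := sqdist_zM mf m0.
  rewrite (_ : (fun p => zpt p * 0%R p)%R = 0); last by apply/funext => p; rewrite mulr0.
  by move/le_lt_trans; apply; rewrite lte_mul_pinfty// lee_fin ltW.
move=> e e0; have e1 : 0 < e / (M + 1) by rewrite divr_gt0// addr_gt0.
have [r hr] := cf _ e1; exists (r * 'X).
rewrite (_ : (fun p => (r * 'X).[zpt p]) = (fun p => zpt p * r.[zpt p])); last first.
  by apply/funext => p; rewrite hornerMX mulrC.
apply: le_lt_trans (sqdist_zM mf (cmeasurable_poly r)) _.
apply: (@le_lt_trans _ _ (M%:E * ((e / (M + 1)) ^+ 2)%:E)%E).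
  by apply: lee_wpmul2l; [rewrite lee_fin ltW|exact: ltW].
rewrite -EFinM lte_fin; have M1 : 0 < (M + 1) ^+ 2 by rewrite exprn_gt0// addr_gt0.
rewrite expr_div_n mulrA ltr_pdivrMr// mulrC ltr_pM2l ?exprn_gt0//.
by have := sqr_ge0 M; rewrite sqrrD; lra.
Qed.

Lemma mulzP x : {ae mu, forall p, P2fn (S x) p = zpt p * P2fn x p}.
Proof.
have [y yP] := P2_class (P2fun_zM (P2fn_in x)).
exact: (@xgetPex _ 0 [set y | {ae mu, forall p, P2fn y p = zpt p * P2fn x p}]
  (ex_intro _ y yP)).
Qed.

Lemma square_integrable_zM x : square_integrable mu (fun p => zpt p * P2fn x p).
Proof. by have [] := P2fun_zM (P2fn_in x). Qed.

Lemma mulz_linear : linear S.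
Proof.
move=> a x y; apply: P2_eq.
have h : {ae mu, forall p, P2fn (S x) p = zpt p * P2fn x p /\
    P2fn (S y) p = zpt p * P2fn y p}.
  by move: (mulzP x) (mulzP y); apply: filterS2.
have h2 : {ae mu, forall p, P2fn (S (a *: x + y)) p = zpt p * (a * P2fn x p + P2fn y p)}.
  by move: (mulzP (a *: x + y)) (P2fn_lin a x y); apply: filterS2 => p -> ->.
move: h h2 (P2fn_lin a (S x) (S y)).
apply: filterS3 => p [ex ey] -> ->; rewrite ex ey mulrDr.
by rewrite !mulrA (mulrC a).
Qed.

Lemma mulz_norm x : N (S x) <= M * N x.
Proof.
rewrite -lee_fin EFinM (P2norm_EFin (square_integrable_zM x) (mulzP x)).
rewrite (P2norm_EFin (P2fn_si x) (aeT mu (fun p => erefl _))).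
have [mf _] := P2fn_si x; have m0 : @cmeasurable R 0 by exact: cmeasurable_cst.
have := sqdist_zM mf m0; rewrite sqdist0E.
rewrite (_ : (fun p => zpt p * 0%R p)%R = 0); last by apply/funext => p; rewrite mulr0.
by rewrite sqdist0E.
Qed.

Lemma mulz_bounded : bounded_op (@P2ip R mu) S.
Proof.
apply/(bounded_opP CH); split; first exact: mulz_linear.
exists M; apply: (exists_adjoint (realHilbert CH) (real_linear mulz_linear) M0).
exact: mulz_norm.
Qed.

(** The adjoint of multiplication by [z] is multiplication by the conjugate of
    [z] followed by a projection, and [|conj z x| = |z x|]. *)
Lemma mulz_hyponormal x : N (adjoint (@P2ip R mu) S x) <= N (S x).
Proof.
have [c [b _]] := adjointP CH mulz_bounded.
set y := adjoint _ S x.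
have e : N y = q (S y) x by rewrite (bop_adj b).
have sy := square_integrable_zM y; have sx := square_integrable_zM x.
have [_ [i1 _]] := square_integrableM sy (P2fn_si x).
have [_ iy] := (square_integrableP mu _).1 (P2fn_si y).
have [_ ix] := (square_integrableP mu _).1 sx.
have h : 2 * q (S y) x <= N y + N (S x).
  rewrite {1}/reip (P2ip_ae sy (P2fn_si x) (mulzP y) (aeT mu (fun p => erefl _))).
  rewrite (P2normE y) (P2norm_ae sx (mulzP x)) -RintegralD// /cintegral /= -RintegralZl//.
  apply: le_Rintegral => //.
  - by have := integrableZl measurableT 2 i1; apply: eq_integrable.
  - by have := integrableD measurableT iy ix; apply: eq_integrable.
  - move=> p _; case: (zpt p) (P2fn y p) (P2fn x p) => a1 b1 [a2 b2] [a3 b3].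
    rewrite /sqn /= -subr_ge0.
    (* 2 Re (z y conj x) <= |y|^2 + |z x|^2, with difference |y - conj z x|^2 *)
    rewrite (_ : _ - _ = (a2 - (a1 * a3 + b1 * b3)) ^+ 2 +
      (b2 - (a1 * b3 - b1 * a3)) ^+ 2); last by ring.
    by rewrite addr_ge0 ?sqr_ge0.
by move: h; rewrite -e mulr_natl mulr2n lerD2l.
Qed.

Lemma exists_one : exists u : P2 mu, {ae mu, forall p, P2fn u p = 1}.
Proof.
apply: P2_class; split=> // e e0; exists 1.
rewrite (_ : sqdist _ _ _ = 0%E) ?lte_fin ?exprn_gt0//.
rewrite sqdistE; apply: integral0_eq => p _.
by rewrite hornerC subrr sqn0.
Qed.

Lemma iter_mulz_lin k a x y : iter k S (a *: x + y) = a *: iter k S x + iter k S y.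
Proof. by elim: k => //= k ->; rewrite mulz_linear. Qed.

Lemma P2ip_orthD a x y z : P2ip x y = 0 -> P2ip x z = 0 -> P2ip x (a *: y + z) = 0.
Proof.
rewrite (P2_conj y x) (P2_conj z x) (P2_conj _ x) P2_linear => y0 z0.
have c0 (w : R[i]) : w^*%C = 0 -> w = 0.
  by case: w => u v [-> /eqP]; rewrite oppr_eq0 => /eqP->.
rewrite (c0 _ y0) (c0 _ z0) mulr0 addr0.
by apply/eqP; rewrite eq_complex/= oppr0 eqxx.
Qed.

(** The polynomials in [z] are obtained from the constant function [1] by
    Horner's scheme. *)
Lemma poly_class (u : P2 mu) (r : {poly R[i]}) : {ae mu, forall p, P2fn u p = 1} ->
  exists y, {ae mu, forall p, P2fn y p = r.[zpt p]} /\
    forall x, (forall k, P2ip x (iter k S u) = 0) -> forall k, P2ip x (iter k S y) = 0.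
Proof.
move=> u1; elim/poly_ind: r => [|r c [y [yP yx]]].
  exists (-1 *: u + u); split=> [|x xu k].
    by move: (P2fn_lin (-1) u u); apply: filterS => p ->; rewrite horner0 mulN1r addNr.
  by rewrite iter_mulz_lin; apply: P2ip_orthD; exact: xu.
exists (c *: u + S y); split=> [|x xu k].
  have h : {ae mu, forall p, P2fn (S y) p = zpt p * r.[zpt p]}.
    by move: (mulzP y) yP; apply: filterS2 => p -> ->.
  move: (P2fn_lin c u (S y)) u1 h; apply: filterS3 => p -> -> ->.
  by rewrite hornerMXaddC mulr1 addrC mulrC.
rewrite iter_mulz_lin; apply: P2ip_orthD; first exact: xu.
by rewrite -iterSr; exact: yx.
Qed.

(** Approximate [x] by a polynomial [y] at distance less than [|x|]; if [x] were
    orthogonal to [y] then the distance would be at least [|x|]. *)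
Lemma mulz_cyclic (u : P2 mu) : {ae mu, forall p, P2fn u p = 1} ->
  forall x, (forall k, P2ip x (iter k S u) = 0) -> x = 0.
Proof.
move=> u1 x xu; apply: P2norm_eq0; apply/eqP; rewrite eq_le P2norm_ge0 andbT.
rewrite leNgt; apply/negP => Nx.
have [_ /(_ (Num.sqrt (N x)))[|r]] := P2fn_in x; first by rewrite sqrtr_gt0.
have [y [yP yx]] := poly_class r u1.
have sr : square_integrable mu (fun p => r.[zpt p]).
  split; first exact: cmeasurable_poly.
  rewrite sqdist0E -(@ge0_ae_eq_integral _ _ _ mu setT (fun p => (sqn (P2fn y p))%:E))//.
  - by have [_] := P2fn_si y; rewrite sqdist0E.
  - by apply/measurable_EFinP; apply: measurable_sqn; have [] := P2fn_si y.
  - by apply/measurable_EFinP; apply: measurable_sqn; exact: cmeasurable_poly.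
  - by move=> p _; rewrite lee_fin sqn_ge0.
  - by move=> p _; rewrite lee_fin sqn_ge0.
  - by apply: filterS yP => p ->.
rewrite -(P2dist_EFin (P2fn_si x) sr (aeT mu (fun p => erefl _)) yP) sqr_sqrtr ?ltW//.
rewrite lte_fin (normB2 (realHilbert CH)) [q x y](_ : _ = 0); last by rewrite /reip (yx x xu 0%N).
by have := P2norm_ge0 y; lra.
Qed.
End multiplication.

(** * The support of the measure, and the theorem *)

Section support.
Context {R : realType}.

Lemma sqn_le_sqr (z : R[i]^o) (r : R) : `|z| <= (r%:C)%C -> sqn z <= r ^+ 2.
Proof.
rewrite normc_def lecR => h; rewrite -(@sqr_sqrtr _ (sqn z)) ?sqn_ge0//.
by rewrite ler_pXn2r// nnegrE ?sqrtr_ge0// (le_trans _ h)// sqrtr_ge0.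
Qed.

Lemma bounded_set_sqn (Omega : set R[i]^o) : bounded_set Omega ->
  exists M : R, forall z, Omega z -> sqn z <= M.
Proof.
move=> [r [rr bO]]; have /complex_realP[r' r'E] : r + 1 \is Num.real by rewrite realD.
exists (r' ^+ 2) => z Oz; apply: sqn_le_sqr; rewrite -r'E.
by apply: bO => //; rewrite ltrDl.
Qed.

(** [mu0] does not charge the complement of [Omega], and [nu] is carried by its
    atoms. *)
Lemma support_bounded (Omega : set R[i]^o) (w : R[i]^o -> R)
    (mu0 nu mu : {measure set (plane R) -> \bar R}) :
  bounded_set Omega -> weighted_area Omega w mu0 -> finitely_atomic nu ->
  (forall A, measurable A -> mu A = (mu0 A + nu A)%E) ->
  exists2 M, 0 < M & {ae mu, forall p, sqn (zpt p) <= M}.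
Proof.
move=> /bounded_set_sqn[M0 hM0] mu0E [n [a [c [c0 nuE]]]] muE.
pose M := `|M0| + 1 + \sum_(j < n) sqn (zpt (a j)).
have s0 : 0 <= \sum_(j < n) sqn (zpt (a j)) by apply: sumr_ge0 => j _; exact: sqn_ge0.
exists M; first by rewrite /M; have := normr_ge0 M0; lra.
pose A := (fun p : plane R => sqn (zpt p)) @^-1` `]M, +oo[.
have mA : measurable A.
  rewrite -[A]setTI; apply: measurable_sqn => //.
  by split; [exact: measurable_fst|exact: measurable_snd].
exists A; split=> //; last first.
  by move=> p /= /negP; rewrite -ltNge /A /= in_itv/= andbT.
rewrite muE// mu0E// nuE//.
have -> : A `&` @zpt R @^-1` Omega = set0.
  apply/seteqP; split=> // p [/=]; rewrite /A /= in_itv/= andbT => Mp /hM0 pM.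
  have := ler_norm M0; move: Mp; rewrite /M; lra.
rewrite integral_set0 add0e big1// => j _.
rewrite diracE memNset ?mule0// /A /= in_itv/= andbT.
apply/negP; rewrite -leNgt /M (bigD1 j)//=.
have : 0 <= \sum_(i < n | i != j) sqn (zpt (a i)) by apply: sumr_ge0 => i _; exact: sqn_ge0.
have := normr_ge0 M0; lra.
Qed.
End support.

Theorem proposition4p5 (R : realType) (Omega : set R[i]^o) (w : R[i]^o -> R)
    (mu0 nu mu : {measure set (plane R) -> \bar R})
    (Omega_domain : domain Omega)
    (Omega_bounded : bounded_set Omega)
    (Omega_sc : simply_connected Omega)
    (Omega_boundary : piecewise_smooth_boundary Omega)
    (w_gt0 : forall z, Omega z -> 0 < w z)
    (w_continuous : {in Omega, continuous w})
    (mu0E : weighted_area Omega w mu0)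
    (nu_atomic : finitely_atomic nu)
    (muE : forall A, measurable A -> mu A = (mu0 A + nu A)%E)
    (mu_moments : finite_moments mu)
    (bergman_P2 : bergman Omega mu0 = P2fun mu0)
    (St : P2 mu -> P2 mu)
    (St_bounded : bounded_op (@P2ip R mu) St) :
  let ip := @P2ip R mu in
  let S := @mulz R mu in
  let adj := adjoint ip in
  trace_class ip (St \- S) \/
  (hilbert_schmidt ip (St \- S) /\
   finite_trace ip (opabs ip (comm (adj St) St))) ->
  forall k l : nat,
    let X := comm (iter k.+1 (adj S)) (iter l.+1 S) in
    let Y := comm (iter k.+1 (adj St)) (iter l.+1 St) in
    [/\ trace_class ip X, trace_class ip Y & Tr ip X = Tr ip Y].
Proof.
move=> ip S adj pert k l.
have [M M0 suppM] := support_bounded Omega_bounded mu0E nu_atomic muE.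
have one_P2 : square_integrable mu (fun=> 1).
  apply/square_integrableP; split; first exact: cmeasurable_cst.
  have [h _] := mu_moments 0%N 0%N; move: h; apply: eq_integrable => // p _.
  by rewrite !expr0 mul1r /sqn /= expr1n expr0n addr0.
have [u u1] := exists_one one_P2.
apply: (complex_trace_invariance (P2_complex_hilbert mu) (u := u)) => //.
- exact: mulz_bounded M0 suppM.
- exact: mulz_hyponormal M0 suppM.
- exact: mulz_cyclic M0 suppM _ u1.
Qed.
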